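(* Let $d$ be a positive integer and let $f(x)=x^d+a_{d-1}x^{d-1}+\dots+a_1x+a_0\in\mathbb{Z}[x]$, where the integer coefficients $a_0,\dots,a_{d-1}$ are random. Let $H$ be a positive integer. (1) (Sparse coefficient distribution.) For every nonzero polynomial $P\in\mathbb{Z}[x]$ there is a constant $C(P)$ depending only on $P$ such that the following holds for $H\ge 3$. Suppose that $a_0$ is uniformly distributed over the set of polynomial values $P(n)$ for integers $n\in[-H,H]$, that each $a_j$ with $1\le j\le d-1$ is uniformly distributed over an arbitrary set of $H$ integers, and that $a_0,a_1,\dots,a_{d-1}$ are independent. Then $$\mathbb{P}(f(x)\text{ is irreducible over }\mathbb{Z})\ \ge\ 1-\frac{\deg(P)}{2H+1}-\frac{2d2^d(\log H)^{C(P)}}{H}.$$ (2) (Nonuniform coefficient distribution.) Suppose that each $a_j$, $0\le j\le d-1$, is distributed according to the binomial distribution $B(H,p)$, and that $a_0,\dots,a_{d-1}$ are independent. Then, for fixed $d$, as $\min(Hp,H(1-p))\to\infty$, $$\mathbb{P}(f(x)\text{ is irreducible over }\mathbb{Z})\ \ge\ 1-o(1).$$ That is, for every $\varepsilon>0$ there is $M=M(d,\varepsilon)$ such that this probability is at least $1-\varepsilon$ whenever $\min(Hp,H(1-p))\ge M$. (3) (Dependent coefficient distribution.) For every nonzero polynomial $P\in\mathbb{Z}[x]$ there is a constant $C(P)$ depending only on $P$ such that the following holds for $H\ge 3$. Let $L$ be a positive integer. Suppose that $a_0$ is uniformly distributed over the set of polynomial values $P(n)$ for integers $n\in[-H,H]$,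 and that for $i\in\{1,2,\dots,d-1\}$, $a_i=P_i(a_{i-1},\dots,a_0,t_i)$, where the $P_i$ are real polynomials of degree at most $L$ such that, for any fixed nonzero value of $a_0$, $P_i$ has positive degree in $t_i$; here $t_1,\dots,t_{d-1}$ are chosen independently (of each other and of $a_0$) and uniformly from an arbitrary set of $H$ real numbers, and all the $a_i$ are integers. Then $$\mathbb{P}(f(x)\text{ is irreducible over }\mathbb{Z})\ \ge\ 1-\frac{\deg(P)}{2H+1}-\frac{2d^2(2L)^d(\log H)^{C(P)}}{H}.$$
   Context: $B(H,p)$ denotes the binomial distribution with $H$ trials and success probability $p\in(0,1)$ ($p$ may depend on $H$). A monic integer polynomial of positive degree is irreducible over $\mathbb{Z}$ if it is not a product of two polynomials in $\mathbb{Z}[x]$ of positive degree. ''$P_i$ has positive degree in $t_i$ for any fixed nonzero value of $a_0$'' means: after substituting any fixed nonzero integer for the variable $a_0$, the resulting polynomial in the remaining variables $a_{i-1},\dots,a_1,t_i$ has positive degree in the variable $t_i$. *)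

(* Defs.v *)
(* MathComp with MathComp-Analysis.  Multinomials' [mpoly] is only Required,
   because its notations clash with those of MathComp-Analysis. *)
From HB Require Import structures.
From mathcomp Require Import all_boot all_order all_algebra finmap.
From mathcomp Require Import all_classical all_reals all_analysis.
From mathcomp Require mpoly.

Set Implicit Arguments.
Unset Strict Implicit.
Unset Printing Implicit Defensive.

Import Order.TTheory GRing.Theory Num.Theory.
Import numFieldNormedType.Exports.

Local Open Scope classical_set_scope.
Local Open Scope ring_scope.

(* [int] with the discrete sigma-algebra, as the library does for [nat]. *)
HB.instance Definition _ := isPointed.Build int 0.
HB.instance Definition _ := @isMeasurable.Build default_measure_display
  int discrete_measurable discrete_measurable0
  discrete_measurableC discrete_measurableU.

(* Only meant for monic polynomials of positive degree: the content of a
   polynomial is ignored.  Recall that [size p] is [deg p + 1]. *)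
Definition irreducible_overZ (f : {poly int}) : Prop :=
  ~ exists g h : {poly int},
      [/\ (1 < size g)%N, (1 < size h)%N & f = g * h].

Definition monic_poly_of (d : nat) (a : 'I_d -> int) : {poly int} :=
  'X^d + \sum_(j < d) a j *: 'X^j.

(* The index n - H runs over the integers of [-H, H].  This is a set: a value
   attained several times is listed once. *)
Definition poly_values (P : {poly int}) (H : nat) : {fset int} :=
  [fset P.[n%:Z - H%:Z] | n in iota 0 (2 * H).+1]%fset.

(* Mutual independence: taking some of the [B i] to be the full set gives the
   product rule for every subfamily. *)
Definition mutually_independent d d' (T : measurableType d)
    (U : measurableType d') (R : realType) (Pr : probability T R)
    (I : finType) (X : I -> T -> U) : Prop :=
  forall B : I -> set U, (forall i, measurable (B i)) ->
    Pr (\bigcap_(i in [set: I]) (X i @^-1` B i)) =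
    (\prod_(i in I) Pr (X i @^-1` B i))%E.

(* As the masses of the points of [A] sum to 1, [X] is almost surely in [A]. *)
Definition uniform_on d d' (T : measurableType d) (U : measurableType d')
    (R : realType) (Pr : probability T R) (X : {RV Pr >-> U})
    (A : {fset U}) : Prop :=
  A != fset0 /\
  forall x : U, x \in A ->
    distribution Pr X [set x] = ((#|` A|%:R : R)^-1)%:E.

(* The law B(H, p) of the library lives on [nat]; it is transported to [int]. *)
Definition binomial_law d (T : measurableType d) (R : realType)
    (Pr : probability T R) (X : {RV Pr >-> int}) (H : nat) (p : R) : Prop :=
  forall B : set int, distribution Pr X B = binomial_prob H p (Posz @^-1` B).

(* Substitution of the constant [c] for the variable of index [k]; the result
   is kept in the same polynomial ring, where that variable no longer occurs. *)
Definition subst_const (n : nat) (R : realType) (k : 'I_n) (c : R)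
    (p : mpoly.mpoly n R) : mpoly.mpoly n R :=
  mpoly.comp_mpoly
    [tuple if j == k then mpoly.mpolyC n c
           else mpoly.mpolyX R (mpoly.mnm1 j) | j < n] p.

Definition degree_in (n : nat) (R : realType) (k : 'I_n)
    (p : mpoly.mpoly n R) : nat :=
  \max_(m <- mpoly.msupp p) mpoly.fun_of_multinom m k.

Definition total_degree (n : nat) (R : realType) (p : mpoly.mpoly n R) : nat :=
  \max_(m <- mpoly.msupp p) mpoly.mdeg m.

(* For [Q] in [i + 1] variables, the value Q(a_{i-1}, ..., a_0, t): the
   variable of index [k < i] stands for a_k, and the last one for t. *)
Definition eval_step (R : realType) (d : nat) (i : 'I_d)
    (Q : mpoly.mpoly i.+1 R) (a : 'I_d -> int) (t : R) : R :=
  mpoly.meval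
    (fun k : 'I_i.+1 => if k == ord_max then t
                        else (a (widen_ord (ltn_ord i) k))%:~R) Q.

(* Main.v *)
(* A reducible monic f = g h of degree d with f(0) = a_0 <> 0 has a factor g of some
   degree k whose constant term divides a_0, so the product of some k of the roots of
   f is one of finitely many integers w. The product over all k-subsets I of the roots
   of w - prod_I is a polynomial in the coefficients; as a polynomial in a_(d-1) alone
   it has degree at most k C(d, k), and it is not zero because for large |a_(d-1)| all
   roots of f but one are close to 0. Hence, given the other coefficients, at most
   2 tau(a_0) d 2^d values of a_(d-1) make f reducible, and it remains to bound divisor
   functions.

   For a_0 = P(n), with P monic after scaling, Landreau's inequality bounds tau(m) by
   a sum of powers of tau(e) over the divisors e <= m^(1/k) of m, and the n with
   e | P(n) lie in few residue classes modulo some D with D | e | D^(deg P). This gives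
   an average bound by a power of log H. For dependent coefficients one also discards
   the event that some Q_i becomes constant in t_i.

   In the binomial case each value has mass O(min(Hp, H(1-p))^(-1/2)) and
   tau(m) = O(m^(1/6)), which is enough unless p > 1/2 and H is large compared with a
   power of M = H(1-p). In that case f = x^d + H Phi - b with Phi = 1 + ... + x^(d-1)
   and b small; all roots of f but one are bounded, so a factor g without the large
   root has |Res(g, Phi)| < 1. Thus f and Phi have a common root zeta, and
   b(zeta) = 1 determines b_0 from the other b_j. *)
Require Import Defs.
From HB Require Import structures.
From mathcomp Require Import all_boot all_order all_fingroup all_algebra all_field finmap.
From mathcomp Require Import zify ring lra.
From mathcomp Require Import boolp.
From mathcomp Require mpoly.
Set Implicit Arguments.
Unset Strict Implicit.
Unset Printing Implicit Defensive.
Import Order.TTheory GRing.Theory Num.Theory.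

(** * The divisor function at polynomial values *)

(** In the sparse case [C(P)] must not depend on [d] or on the sets of the other coefficients, so
    the two sources of randomness stay separate: conditionally on everything else, [a_(d-1)]
    contributes a number of bad values times its largest point mass, and only then is the divisor
    function averaged over [a_0] alone.

    The coarser modulus [D] is needed because a polynomial can have many roots modulo an integer
    that is not squarefree. The price is that several [e] share one [D]; since they all divide
    [D ^ deg P], this costs only a power of [tau D].

    In the binomial case let [N] be about [sqrt M / 2], so that point masses are at most [2 / N]. A
    cut at height about [N ^ 3] balances the errors: Markov's inequality leaves [O(1 / N)] above the
    cut, and below it the exponent 1/6 gives [O(sqrt N)] divisors against the mass [2 / N]. The
    obstacle for [p > 1/2] is that [a_0] concentrates near [H * p], which may exceed every power of
    [M]; only the differences [H - a_j] are then below the cut. *)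

Definition tau (m : nat) : nat := size (divisors m).

Lemma tau_dvd (a b : nat) : (0 < b)%N -> (a %| b)%N -> (tau a <= tau b)%N.
Proof.
move=> b0 ab; apply: uniq_leq_size; first exact: divisors_uniq.
have a0 : (0 < a)%N by apply: dvdn_gt0 ab.
by move=> x; rewrite -!dvdn_divisors // => /dvdn_trans; apply.
Qed.

Lemma tauM (a b : nat) : (0 < a)%N -> (0 < b)%N -> (tau (a * b) <= tau a * tau b)%N.
Proof.
move=> a0 b0; have ab0 : (0 < a * b)%N by rewrite muln_gt0 a0.
pose f x := (gcdn x a, x %/ gcdn x a).
rewrite /tau -(size_map f) -(size_allpairs pair).
apply: uniq_leq_size.
  rewrite map_inj_in_uniq ?divisors_uniq // => x y _ _ [e1 e2].
  by rewrite -(divnK (dvdn_gcdl x a)) e2 e1 divnK // dvdn_gcdl.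
move=> z /mapP[x]; rewrite -dvdn_divisors // => xab ->.
apply/allpairsP; exists (f x); split => //; rewrite /f /= -dvdn_divisors //.
  exact: dvdn_gcdr.
have g0 : (0 < gcdn x a)%N by rewrite gcdn_gt0 a0 orbT.
rewrite -(dvdn_pmul2r g0) divnK ?dvdn_gcdl //.
by rewrite mulnC muln_gcdl dvdn_gcd dvdn_mulr.
Qed.

Lemma tauX (a n : nat) : (0 < a)%N -> (tau (a ^ n) <= tau a ^ n)%N.
Proof.
move=> a0; elim: n => [|n IH]; first by rewrite expn0 /tau.
by rewrite !expnS (leq_trans (tauM _ _)) ?expn_gt0 ?a0 // leq_mul2l IH orbT.
Qed.

Lemma tau_prime (p : nat) : prime p -> tau p = 2.
Proof.
move=> pp; rewrite /tau.
have p1 := prime_gt1 pp.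
have: perm_eq (divisors p) [:: 1; p].
  apply: uniq_perm; first exact: divisors_uniq.
    by rewrite /= inE andbT neq_ltn p1.
  move=> x; rewrite -dvdn_divisors ?prime_gt0 // !inE.
  apply/idP/idP; first by move/primeP: pp => [_ h] /h.
  by case/orP=> /eqP->.
by move/perm_size.
Qed.

(* [y |-> y] and [y |-> p^e y] inject the divisors of [D] into those of [p^e D]. *)
Lemma tau_prime_pow_mul (p e D : nat) : prime p -> (0 < e)%N -> (0 < D)%N ->
  ~~ (p %| D)%N -> (2 * tau D <= tau (p ^ e * D))%N.
Proof.
move=> pp e0 D0 pD; have p0 := prime_gt0 pp.
have pe0 : (0 < p ^ e)%N by rewrite expn_gt0 p0.
rewrite mul2n -addnn /tau -{2}(size_map (muln (p ^ e))) -size_cat.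
apply: uniq_leq_size.
  rewrite cat_uniq divisors_uniq /= map_inj_in_uniq ?divisors_uniq ?andbT; last first.
    by move=> x y _ _ /eqP; rewrite eqn_pmul2l // => /eqP.
  apply/hasPn => _ /mapP[x xD ->] /=; rewrite -dvdn_divisors //.
  apply: contra pD => /(dvdn_trans _); apply.
  by rewrite dvdn_mulr // dvdn_exp.
move=> x; rewrite mem_cat -!dvdn_divisors // ?muln_gt0 ?pe0 //.
case/orP => [xD|/mapP[z]]; first by rewrite dvdn_mull.
by rewrite -dvdn_divisors // => zD ->; rewrite dvdn_pmul2l.
Qed.

Lemma dvd_tau_sum (m : nat) (F : nat -> nat) (X : nat) : (0 < m)%N -> (m <= X)%N ->
  (\sum_(1 <= d < X.+1 | d %| m) F d = \sum_(d <- divisors m) F d)%N.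
Proof.
move=> m0 mX; rewrite -[LHS]big_filter; apply: perm_big; apply: uniq_perm.
- by rewrite filter_uniq // iota_uniq.
- exact: divisors_uniq.
- move=> x; rewrite mem_filter mem_index_iota -dvdn_divisors //.
  case xm: (x %| m)%N => //=; rewrite (dvdn_gt0 m0 xm) ltnS.
  by rewrite (leq_trans (dvdn_leq m0 xm)).
Qed.

Lemma tau_sum (m X : nat) : (0 < m)%N -> (m <= X)%N ->
  tau m = (\sum_(1 <= d < X.+1 | d %| m) 1)%N.
Proof. by move=> m0 mX; rewrite (dvd_tau_sum _ m0 mX) sum1_size. Qed.

(* Multiply the primes of [m] into an accumulator [b] as long as it stays below
   [y]; every block that is pushed out then has its square above [y]. *)
Lemma block_factorization (y m : nat) : (0 < y)%N -> (0 < m)%N ->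
  exists b : nat, exists s : seq nat,
    [/\ m = (b * \prod_(e <- s) e)%N, (b <= y)%N &
        all (fun e => ((e <= y) || prime e) && (y < e * e))%N s].
Proof.
move=> y0; elim/ltn_ind: m => m IH m0.
have [m1|m1] := leqP m 1.
  by exists 1%N, [::]; rewrite big_nil; split => //; apply/eqP; rewrite eqn_leq m1.
set p := pdiv m; have pp : prime p by rewrite pdiv_prime.
have [b [s [mE by_ sP]]] : exists b : nat, exists s : seq nat,
    [/\ (m %/ p = b * \prod_(e <- s) e)%N, (b <= y)%N &
        all (fun e => ((e <= y) || prime e) && (y < e * e))%N s].
  apply: IH; first by rewrite ltn_Pdiv // prime_gt1.
  by rewrite divn_gt0 ?prime_gt0 // dvdn_leq // pdiv_dvd.
have {}mE : m = (p * (b * \prod_(e <- s) e))%N.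
  by rewrite -mE mulnC divnK // pdiv_dvd.
have [ppy|ppy] := ltnP y (p * p).
  exists b, (p :: s); rewrite big_cons /= pp orbT ppy sP; split => //.
  by rewrite mulnCA.
have [bp|bp] := leqP (b * p) y.
  by exists (b * p)%N, s; split => //; rewrite mE mulnA [(p * b)%N]mulnC.
exists p, (b :: s); rewrite big_cons /= sP by_; split => //.
  by rewrite (leq_trans _ ppy) // -{1}(muln1 p) leq_mul2l prime_gt0 ?orbT.
have pb : (p <= b)%N.
  by rewrite leqNgt; apply/negP => h; have := leq_mul (ltnW h) (leqnn p); lia.
by rewrite andbT (leq_trans bp) // leq_mul2l pb orbT.
Qed.

Lemma prod_sqr_gt (y : nat) (s : seq nat) : (0 < y)%N -> (0 < size s)%N ->
  all (fun e => y < e * e)%N s -> (y ^ size s < (\prod_(e <- s) e) ^ 2)%N.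
Proof.
move=> y0; elim: s => // e s IH _ /= /andP[ye ys]; rewrite big_cons expnMn expnS.
have e0 : (0 < e ^ 2)%N by rewrite -mulnn; lia.
case: s IH ys => [_ _|e' s IH ys]; first by rewrite big_nil exp1n /= !muln1 -mulnn.
by apply: ltn_mul; [rewrite -mulnn | apply: IH].
Qed.

Lemma tau_prod_le (s : seq nat) (T : nat) :
  (forall e, e \in s -> (0 < e)%N /\ (tau e <= T)%N) ->
  (0 < \prod_(e <- s) e)%N /\ (tau (\prod_(e <- s) e) <= T ^ size s)%N.
Proof.
elim: s => [|e s IH] h; first by rewrite big_nil.
have [e0 eT] := h e (mem_head _ _).
have [p0 pT] := IH (fun x xs => h x (mem_behead (s := e :: s) xs)).
rewrite big_cons muln_gt0 e0 p0; split => //.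
by rewrite (leq_trans (tauM _ _)) // expnS leq_mul.
Qed.

(** Landreau's inequality. Fewer than [2 * k] blocks occur besides [b], and submultiplicativity of
    [tau] leaves the largest factor to the power [2 * k]. The factor 2 covers blocks that are primes
    above [y]: they have two divisors, which is what the term [d = 1] allows for. *)
Lemma tau_le_sum_small_divisors (m y k : nat) :
  (0 < y)%N -> (0 < m)%N -> (0 < k)%N -> (m <= y ^ k)%N ->
  (tau m <= \sum_(1 <= d < y.+1 | d %| m) (2 * tau d) ^ (2 * k))%N.
Proof.
move=> y0 m0 k0 my.
have [b [s [mE by_ sP]]] := block_factorization y0 m0.
have [b0 P0] : (0 < b)%N /\ (0 < \prod_(e <- s) e)%N.
  by apply/andP; rewrite -muln_gt0 -mE.
pose T := (\max_(1 <= d < y.+1 | d %| m) (2 * tau d))%N.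
have TP d : (d %| m)%N -> (d <= y)%N -> (2 * tau d <= T)%N.
  move=> dm dy; apply: (@leq_bigmax_seq _ _ _ (fun d => 2 * tau d)%N) => //.
  by rewrite mem_index_iota (dvdn_gt0 m0 dm).
have T2 : (2 <= T)%N by apply: (TP 1%N).
(* [y ^ size s < (\prod_(e <- s) e) ^ 2 <= m ^ 2 <= y ^ (2 * k)]; the strict inequality leaves room
   for the extra factor [b]. *)
have szs : ((size s).+1 <= 2 * k)%N.
  case: s mE sP P0 => [|e s] mE sP P0; first by rewrite muln_gt0 k0.
  have y1 : (1 < y)%N.
    case: y y0 my sP {by_ T TP T2} => // -[|//] _; rewrite exp1n => m1.
    have /eqP/esym : m == 1%N by rewrite eqn_leq m1.
    rewrite mE => /eqP; rewrite eq_sym muln_eq1 => /andP[_].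
    by rewrite big_cons muln_eq1 => /andP[/eqP -> _].
  have: (y ^ size (e :: s) < y ^ (2 * k))%N.
    apply: (@leq_trans ((\prod_(e <- e :: s) e) ^ 2)%N).
      by apply: prod_sqr_gt => //; apply: sub_all sP => x /andP[].
    rewrite mulnC expnM leq_exp2r // (leq_trans _ my) // mE.
    by rewrite leq_pmull.
  by rewrite ltn_exp2l.
have tauT : (tau m <= T ^ (size s).+1)%N.
  rewrite expnS mE (leq_trans (tauM _ _)) // leq_mul //.
    apply: leq_trans (TP b _ by_); last by rewrite mE dvdn_mulr.
    by rewrite leq_pmull.
  apply: (proj2 (@tau_prod_le s T _)) => e es.
  have em : (e %| m)%N.
    by rewrite mE dvdn_mull // (perm_big _ (perm_to_rem es)) /= big_cons dvdn_mulr.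
  split; first exact: dvdn_gt0 em.
  have /allP/(_ _ es)/andP[/orP[ey|pe] _] := sP; last by rewrite tau_prime.
  by apply: leq_trans (TP e em ey); rewrite leq_pmull.
apply: (leq_trans tauT); apply: (@leq_trans (T ^ (2 * k))%N).
  by rewrite leq_pexp2l // ltnW.
rewrite /T; elim/big_rec2: _ => [|d S t _ IH]; first by rewrite exp0n // muln_gt0 k0.
case: (leqP (2 * tau d) t) => _; first by rewrite (leq_trans IH) // leq_addl.
by rewrite leq_addr.
Qed.

Lemma prime_pow_dvd_cofactor (p k e a b : nat) : prime p ->
  (p ^ k %| a * b)%N -> ~~ (p ^ e.+1 %| a)%N -> (p ^ (k - e) %| b)%N.
Proof.
move=> pp; case: (posnP a) => [->|a0]; first by rewrite dvdn0.
case: (posnP b) => [->|b0]; first by rewrite dvdn0.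
rewrite !pfactor_dvdn ?muln_gt0 ?a0 // lognM // -ltnNge ltnS => h1 h2.
by rewrite leq_subLR (leq_trans h1) // leq_add2r.
Qed.

(* Divide out one root [n0]: either [N] is close to [n0], or a large power of [p]
   divides the cofactor, of lower degree, at [N]. *)
Lemma roots_mod_prime_pow (g e p k : nat) (P : {poly int}) : prime p ->
  (P \is monic)%R -> size P = g.+1 -> (g * e < k)%N ->
  exists s : seq int, (size s <= g)%N /\
    forall N : int, ((p ^ k)%:Z %| P.[N]%R)%Z ->
      exists2 r, r \in s & ((p ^ e.+1)%:Z %| (N - r)%R)%Z.
Proof.
move=> pp; elim: g k P => [|g IH] k P Pm Ps kg.
  exists [::]; split=> // N; have -> : P = 1%R.
    have /size_poly1P[c c0 Pc] : size P == 1%N by rewrite Ps.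
    by move: Pm; rewrite Pc monicE lead_coefC => /eqP ->.
  rewrite hornerC dvdzE absz_nat /= dvdn1.
  by move=> /eqP pk1; have := ltn_expl k (prime_gt1 pp); rewrite pk1; lia.
have [[n0 Pn0]|noroot] := EM (exists n0 : int, ((p ^ k)%:Z %| P.[n0]%R)%Z); last first.
  by exists [::]; split => // N PN; case: noroot; exists N.
have /factor_theorem[Q PQ] : root (P - (P.[n0])%:P)%R n0.
  by rewrite /root !hornerE subrr.
have PE : (P = Q * ('X - n0%:P) + (P.[n0])%:P)%R by rewrite -PQ subrK.
have sPc : size (P - (P.[n0])%:P)%R = g.+2.
  by rewrite size_polyDl Ps // size_polyN; apply: (leq_ltn_trans (size_polyC_leq1 _)).
have Qm : (Q \is monic)%R.
  rewrite -(monicMr _ (monicXsubC n0)) -PQ monicE lead_coefDl; first by rewrite -monicE.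
  by rewrite size_polyN Ps (leq_ltn_trans (size_polyC_leq1 _)).
have sQ : size Q = g.+1.
  by move: sPc; rewrite PQ size_Mmonic ?monicXsubC ?monic_neq0 // size_XsubC => h; move: h;
      rewrite addn2 /= => -[].
have [|s [ss sP]] := IH (k - e)%N Q Qm sQ; first by move: kg; rewrite mulSn; lia.
exists (n0 :: s); split => // N PN.
have [h|h] := boolP ((p ^ e.+1)%:Z %| (N - n0)%R)%Z; first by exists n0; rewrite ?mem_head.
have [r rs hr] : exists2 r, r \in s & ((p ^ e.+1)%:Z %| (N - r)%R)%Z.
  apply: sP; have : ((p ^ k)%:Z %| (Q.[N] * (N - n0))%R)%Z.
    have -> : (Q.[N] * (N - n0) = P.[N] - P.[n0])%R.
      by rewrite {1}PE !hornerE addrK.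
    by rewrite rpredB.
  rewrite !dvdzE !absz_nat abszM mulnC => h1.
  by apply: (prime_pow_dvd_cofactor pp h1); move: h; rewrite dvdzE absz_nat.
by exists r => //; rewrite inE rs orbT.
Qed.

(** Modulo [p ^ g] the polynomial [x ^ g] has [p ^ (g - 1)] roots, but they form a single class
    modulo [p]. In general, dividing the exponents of [d] by [g] and rounding up gives a modulus [D]
    for which few classes suffice. *)
Lemma roots_mod_few (g d : nat) (P : {poly int}) :
  (P \is monic)%R -> size P = g.+1 -> (0 < g)%N -> (0 < d)%N ->
  exists D : nat, [/\ (D %| d)%N, (d %| D ^ g)%N &
    exists s : seq int, (size s <= tau D ^ g)%N /\
      forall N : int, (d%:Z %| P.[N]%R)%Z -> exists2 r, r \in s & (D%:Z %| (N - r)%R)%Z].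
Proof.
move=> Pm Ps g0; elim/ltn_ind: d => d IH d0.
have [d1|d1] := leqP d 1.
  have -> : d = 1%N by lia.
  exists 1%N; split; rewrite ?exp1n //; exists [:: 0%R]; split=> //.
  by move=> N _; exists 0%R; rewrite ?mem_head // dvd1z.
have pp : prime (pdiv d) by rewrite pdiv_prime.
set p := pdiv d in pp; have p0 := prime_gt0 pp.
have [m [cpm dE]] := pfactor_coprime pp d0; set k := logn p d in dE.
have k0 : (0 < k)%N by rewrite logn_gt0 mem_primes pp d0 pdiv_dvd.
have m0 : (0 < m)%N by move: d0; rewrite dE muln_gt0 => /andP[].
have [|D [Dm mD [s [ss sP]]]] := IH m _ m0.
  by rewrite dE -{1}(muln1 m) ltn_pmul2l // -(exp1n k) ltn_exp2r ?prime_gt1.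
have D0 : (0 < D)%N by apply: dvdn_gt0 Dm.
(* [e + 1] is [k / g] rounded up: [g * e < k] is what the prime power case asks, and
   [k <= g * (e + 1)] makes [p ^ k] divide [(p ^ (e + 1)) ^ g]. *)
pose e := (k.-1 %/ g)%N.
have ge : (g * e < k)%N by rewrite mulnC (leq_ltn_trans (leq_trunc_div _ _)) // prednK.
have kge : (k <= e.+1 * g)%N.
  by have := ltn_ceil k.-1 g0; rewrite -/e; lia.
have ek : (e.+1 <= k)%N by rewrite (leq_ltn_trans _ ge) // leq_pmull.
have [s1 [ss1 s1P]] := roots_mod_prime_pow pp Pm Ps ge.
have cpD : coprime p D by apply: coprime_dvdr Dm cpm.
exists (p ^ e.+1 * D)%N; split.
- by rewrite dE mulnC dvdn_mul // dvdn_exp2l.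
- by rewrite dE expnMn mulnC dvdn_mul // -expnM dvdn_exp2l.
exists [seq zchinese (p ^ e.+1)%:Z D%:Z r1 r2 | r1 <- s1, r2 <- s]; split.
  rewrite size_allpairs (leq_trans (leq_mul ss1 ss)) //.
  (* The prime [p] brings at most [g < 2 ^ g] classes; this factor is paid for by the new prime
     power in the modulus, which at least doubles [tau]. *)
  apply: (@leq_trans ((2 * tau D) ^ g)); last first.
    by rewrite leq_exp2r // tau_prime_pow_mul // -prime_coprime.
  by rewrite expnMn leq_mul2r ltnW ?orbT // ltn_expl.
move=> N dN.
have [r1 r1s h1] : exists2 r, r \in s1 & ((p ^ e.+1)%:Z %| (N - r)%R)%Z.
  by apply: s1P; apply: dvdz_trans dN; rewrite dvdzE !absz_nat dE dvdn_mull.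
have [r2 r2s h2] : exists2 r, r \in s & (D%:Z %| (N - r)%R)%Z.
  by apply: sP; apply: dvdz_trans dN; rewrite dvdzE !absz_nat dE dvdn_mulr.
exists (zchinese (p ^ e.+1)%:Z D%:Z r1 r2); first by apply/allpairsP; exists (r1, r2).
have cop : coprimez (p ^ e.+1)%:Z D%:Z by rewrite coprimezE !absz_nat coprimeXl.
rewrite PoszM Gauss_dvdz //; apply/andP; split; rewrite -eqz_mod_dvd.
  by rewrite zchinese_modl // eqz_mod_dvd.
by rewrite zchinese_modr // eqz_mod_dvd.
Qed.

(** * Moments of the divisor function *)

Lemma ler_sum_uniq_sub (R : numDomainType) (T : eqType) (r s : seq T) (F : T -> R) :
  uniq r -> uniq s -> {subset r <= s} -> (forall x, 0 <= F x)%R ->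
  (\sum_(x <- r) F x <= \sum_(x <- s) F x)%R.
Proof.
move=> ur us rs F0; rewrite [leRHS](bigID (mem r)) /=.
rewrite -[X in (_ <= X + _)%R]big_filter.
rewrite [X in (_ <= X + _)%R](perm_big r) /=.
  by rewrite lerDl sumr_ge0.
apply: uniq_perm; rewrite ?filter_uniq // => x; rewrite mem_filter.
by apply: andb_idr; apply: rs.
Qed.

Definition harm (R : numFieldType) (X : nat) : R := (\sum_(1 <= a < X.+1) a%:R^-1)%R.

Section TauMoments.
Variable R : realFieldType.
Implicit Types (X K : nat).
Local Open Scope ring_scope.

Lemma sum_multiples_le (a X : nat) (F : nat -> R) : (0 < a)%N -> (forall m, 0 <= F m) ->
  \sum_(1 <= m < X.+1 | (a %| m)%N) F m <= \sum_(1 <= b < X.+1) F (a * b)%N.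
Proof.
move=> a0 F0; rewrite -(big_map (muln a) xpredT F) -[leLHS]big_filter.
have inj : injective (muln a) by move=> x y /eqP; rewrite eqn_pmul2l // => /eqP.
apply: ler_sum_uniq_sub => //; first by rewrite filter_uniq // iota_uniq.
  by rewrite map_inj_uniq // iota_uniq.
move=> m; rewrite mem_filter mem_index_iota => /andP[/dvdnP[b ->] /andP[m0 mX]].
rewrite mulnC map_f // mem_index_iota.
move: m0; rewrite muln_gt0 => /andP[-> _] /=.
by rewrite (leq_ltn_trans _ mX) // leq_pmulr.
Qed.

(** One factor [tau m] is a sum over [a %| m]; writing [m = a * b] with
    [tau (a * b) <= tau a * tau b] bounds the next moment by the square of the current one. Hence
    the doubling exponent. *)
Lemma tau_moment X K :
  \sum_(1 <= m < X.+1) (tau m)%:R ^+ K / m%:R <= harm R X ^+ (2 ^ K).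
Proof.
elim: K => [|K IH].
  rewrite expn0 expr1 /harm.
  by rewrite le_eqVlt; apply/orP; left; apply/eqP/eq_bigr => m _; rewrite expr0 mul1r.
have F0 m : 0 <= (tau m)%:R ^+ K / m%:R :> R by rewrite divr_ge0 // exprn_ge0.
apply: (@le_trans _ _ (\sum_(1 <= m < X.+1) \sum_(1 <= a < X.+1 | (a %| m)%N)
    ((tau m)%:R ^+ K / m%:R))).
  rewrite big_nat [leRHS]big_nat; apply: ler_sum => m /andP[m0 mX].
  rewrite exprS -mulrA (tau_sum m0 (mX : m <= X)%N) natr_sum mulr_suml.
  by apply: ler_sum => a _; rewrite mul1r.
rewrite (eq_bigr (fun m => \sum_(1 <= a < X.+1) if (a %| m)%N then
   (tau m)%:R ^+ K / m%:R else 0)); last by move=> m _; rewrite big_mkcond.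
rewrite exchange_big /=.
apply: (@le_trans _ _ (\sum_(1 <= a < X.+1) \sum_(1 <= b < X.+1)
    ((tau a)%:R ^+ K / a%:R) * ((tau b)%:R ^+ K / b%:R))); last first.
  rewrite expnSr exprM expr2.
  have S0 : 0 <= \sum_(1 <= m < X.+1) (tau m)%:R ^+ K / m%:R :> R by rewrite sumr_ge0.
  apply: le_trans (ler_pM S0 S0 IH IH); rewrite mulr_suml le_eqVlt; apply/orP; left.
  by apply/eqP/eq_bigr => a _; rewrite mulr_sumr.
rewrite big_nat [leRHS]big_nat; apply: ler_sum => a /andP[a0 _].
rewrite -big_mkcond; apply: (le_trans (sum_multiples_le _ a0 F0)).
rewrite big_nat [leRHS]big_nat; apply: ler_sum => b /andP[b0 _].
rewrite natrM invfM mulrACA ler_wpM2r ?mulr_ge0 ?invr_ge0 // -exprMn.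
by rewrite lerXn2r ?nnegrE ?mulr_ge0 // -natrM ler_nat tauM.
Qed.
End TauMoments.

(** * Average of the divisor function over values of a polynomial *)

Lemma count_residue_class (D M : nat) (r : int) : (0 < D)%N ->
  (count (fun n : nat => (D%:Z %| (n%:Z - r)%R)%Z) (iota 0 M) * D <= M + D)%N.
Proof.
move=> D0; rewrite -size_filter; set s := filter _ _.
have inj : {in s &, injective (divn^~ D)}.
  move=> x y; rewrite !mem_filter => /andP[xr _] /andP[yr _] /= e.
  rewrite (divn_eq x D) (divn_eq y D) e; congr (_ + _)%N.
  have : (x = y %[mod D%:Z])%Z.
    by apply/eqP; rewrite eqz_mod_dvd -[X in (_ %| X)%Z](subrKA r) rpredD // -opprB rpredN.
  by rewrite !modz_nat => -[].
have us : uniq s by rewrite filter_uniq // iota_uniq.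
have : (size s <= (M %/ D).+1)%N.
  rewrite -(size_map (divn^~ D)) -(size_iota 0 (M %/ D).+1).
  apply: uniq_leq_size; first by rewrite map_inj_in_uniq.
  move=> _ /mapP[x xs ->]; rewrite mem_iota /= add0n ltnS.
  move: xs; rewrite mem_filter mem_iota => /andP[_ /andP[_ xM]].
  by rewrite leq_div2r // ltnW.
move=> h; apply: (leq_trans (leq_mul h (leqnn D))).
by rewrite mulSn addnC leq_add2r leq_trunc_div.
Qed.

Lemma count_residue_classes (D M : nat) (s : seq int) (Q : pred nat) : (0 < D)%N ->
  (forall n : nat, Q n -> exists2 r, r \in s & (D%:Z %| (n%:Z - r)%R)%Z) ->
  (count Q (iota 0 M) * D <= size s * (M + D))%N.
Proof.
move=> D0; elim: s Q => [|r s IH] Q QP.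
  by rewrite (eq_count (a2 := pred0)) ?count_pred0 // => n; apply/negP => /QP[].
pose Q1 n := Q n && (D%:Z %| (n%:Z - r)%R)%Z.
pose Q2 n := Q n && ~~ (D%:Z %| (n%:Z - r)%R)%Z.
have -> : count Q (iota 0 M) = (count Q1 (iota 0 M) + count Q2 (iota 0 M))%N.
  rewrite -count_predUI (eq_count (a1 := predI _ _) (a2 := pred0)); last first.
    by move=> n; rewrite /= /Q1 /Q2; case: (Q n); case: (_ %| _)%Z.
  rewrite count_pred0 addn0; apply: eq_count => n; rewrite /= /Q1 /Q2.
  by case: (Q n); case: (_ %| _)%Z.
rewrite mulnDl /= mulSn leq_add //.
  apply: leq_trans (count_residue_class M r D0); rewrite leq_mul2r.
  by rewrite sub_count ?orbT // => n /andP[].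
apply: IH => n /andP[/QP[r' rs h] h']; exists r' => //.
by move: rs; rewrite inE => /predU1P[e|//]; rewrite -e h in h'.
Qed.

Lemma horner_norm_le (P : {poly int}) : exists A : nat, forall (X : nat) (N : int),
  (0 < X)%N -> (`|N|%N <= X)%N -> (`|P.[N]%R|%N <= A * X ^ (size P).-1)%N.
Proof.
exists (\sum_(i < size P) absz (P`_i)%R)%N => X N X0 NX.
rewrite -lez_nat PoszM abszE horner_coef (le_trans (ler_norm_sum _ _ _)) //.
rewrite (big_morph Posz PoszD (erefl _)) mulr_suml ler_sum // => i _.
rewrite normrM abszE ler_wpM2l // normrX -abszE.
have -> : ((absz N)%:Z ^+ i = (absz N ^ i)%N%:Z)%R by rewrite -[RHS]natz natrX natz.
rewrite lez_nat (@leq_trans (X ^ i)) //.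
  by case: (nat_of_ord i) => // j; rewrite leq_exp2r.
by rewrite leq_pexp2l // -ltnS (ltn_predK (ltn_ord i)).
Qed.

(** Landreau's inequality with [y = X] involves only divisors [d <= X]. Their moduli are at most
    [X], so a residue class meets the [2X + 1] arguments in [O(X / D)] points and the rounding error
    is harmless. *)
Lemma sum_tau_monic (R : realFieldType) (P : {poly int}) (g : nat) :
  (P \is monic)%R -> size P = g.+1 -> (0 < g)%N ->
  exists A K : nat, forall X : nat, (1 < X)%N ->
  ((\sum_(0 <= n < (2 * X).+1 | P.[n%:Z - X%:Z] != 0) tau `|P.[n%:Z - X%:Z]%R|%N)%N%:R
    <= A%:R * X%:R * harm R X ^+ (2 ^ K) :> R)%R.
Proof.
move=> Pm Ps g0; have [A AP] := horner_norm_le P.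
(* As [X >= 2], the constant [A] is below [X ^ A.+1], so all values are at most [X ^ k]. In the
   exponent below, [g * (2 * k)] comes from [tau d <= tau (D d) ^ g], one [g] from the number of
   classes, and one from the number of [d] sharing the same [D d]. *)
pose k := (g + A.+1)%N; have k0 : (0 < k)%N by rewrite /k addnS.
exists (4 ^ k.+1)%N, (g * (2 * k) + g + g)%N => X X1; have X0 := ltnW X1.
pose v n : int := (P.[n%:Z - X%:Z])%R.
have vX n : (n <= 2 * X)%N -> (`|v n|%N <= X ^ k)%N.
  move=> nX; apply: (leq_trans (AP X _ X0 _)); first by lia.
  rewrite Ps /= /k expnD mulnC leq_mul2l; apply/orP; right.
  by rewrite (leq_trans _ (ltnW (ltn_expl _ X1))).
have [D DP] : exists D : nat -> nat, forall d, (0 < d)%N ->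
    [/\ (D d %| d)%N, (d %| D d ^ g)%N &
    exists s : seq int, (size s <= tau (D d) ^ g)%N /\
      forall N : int, (d%:Z %| P.[N]%R)%Z -> exists2 r, r \in s & ((D d)%:Z %| (N - r)%R)%Z].
  have /choice[D DP] : forall d, exists D : nat, (0 < d)%N ->
    [/\ (D %| d)%N, (d %| D ^ g)%N &
    exists s : seq int, (size s <= tau D ^ g)%N /\
      forall N : int, (d%:Z %| P.[N]%R)%Z -> exists2 r, r \in s & (D%:Z %| (N - r)%R)%Z].
    move=> d; case: (posnP d) => [->|d0]; first by exists 0%N.
    by have [D hD] := roots_mod_few Pm Ps g0 d0; exists D.
  by exists D.
have D_gt0 d : (0 < d)%N -> (0 < D d)%N.
  by move=> d0; have [Dd _ _] := DP d d0; apply: dvdn_gt0 Dd.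
have D_le d : (0 < d)%N -> (D d <= d)%N.
  by move=> d0; have [Dd _ _] := DP d d0; apply: dvdn_leq.
have tauD d : (0 < d)%N -> (tau d <= tau (D d) ^ g)%N.
  move=> d0; have [_ dD _] := DP d d0; apply: leq_trans (tauX _ (D_gt0 _ d0)).
  by rewrite tau_dvd // expn_gt0 D_gt0.
have cnt d : (0 < d)%N -> (d <= X)%N ->
    (count (fun n => (d %| `|v n|)%N) (iota 0 (2 * X).+1) * D d <= tau (D d) ^ g * (4 * X))%N.
  move=> d0 dX; have [_ _ [s [ss sP]]] := DP d d0.
  pose s' := [seq (r + X%:Z)%R | r <- s].
  apply: (@leq_trans (size s' * ((2 * X).+1 + D d))).
    apply: count_residue_classes; first exact: D_gt0.
    move=> n dv; have [|r rs h] := sP (n%:Z - X%:Z)%R; first by rewrite dvdzE absz_nat.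
    exists (r + X%:Z)%R; first exact: (map_f (fun r => r + X%:Z)%R).
    by have -> : (n%:Z - (r + X%:Z) = n%:Z - X%:Z - r)%R by ring.
  by rewrite size_map leq_mul //; have := D_le d d0; lia.
have main : (\sum_(0 <= n < (2 * X).+1 | v n != 0%R) tau `|v n| <=
   \sum_(1 <= d < X.+1) (2 * tau d) ^ (2 * k) *
       count (fun n => (d %| `|v n|)%N) (iota 0 (2 * X).+1))%N.
  apply: (@leq_trans (\sum_(0 <= n < (2 * X).+1)
     \sum_(1 <= d < X.+1 | (d %| `|v n|)%N) (2 * tau d) ^ (2 * k))).
    rewrite big_mkcond big_nat [leqRHS]big_nat; apply: leq_sum => n /andP[_ nX].
    case: ifP => // vn; apply: tau_le_sum_small_divisors => //.
      by rewrite absz_gt0.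
    exact: vX.
  under eq_bigr do rewrite big_mkcond; rewrite exchange_big; apply: leq_sum => d _.
  rewrite -big_mkcond -sum1_count big_distrr /index_iota subn0.
  by apply: leq_sum => i _ /=; rewrite muln1.
apply: (@le_trans _ _ (\sum_(1 <= d < X.+1) (4 ^ k.+1 * X)%:R *
    ((tau (D d))%:R ^+ (g * (2 * k) + g) / (D d)%:R))%R).
  apply: (le_trans (y := (_ %:R)%R)); first by rewrite ler_nat; exact: main.
  rewrite natr_sum big_nat [leRHS]big_nat; apply: ler_sum => d /andP[d0 dX].
  rewrite mulrA ler_pdivlMr ?ltr0n ?D_gt0 // -natrX -!natrM ler_nat.
  rewrite -mulnA (leq_trans (leq_mul (leqnn _) (cnt d d0 _))) //.
  have e1 : ((2 * tau d) ^ (2 * k) = 4 ^ k * tau d ^ (2 * k))%N by rewrite expnMn expnM.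
  have e2 : (4 ^ k.+1 * X * tau (D d) ^ (g * (2 * k) + g) =
      4 ^ k * tau (D d) ^ (g * (2 * k)) * (tau (D d) ^ g * (4 * X)))%N.
    by rewrite expnSr expnD; ring.
  rewrite e1 e2 leq_mul // leq_mul // (expnM _ g) leq_exp2r ?muln_gt0 ?k0 //.
  exact: tauD.
rewrite -mulr_sumr natrM ler_wpM2l ?mulr_ge0 //.
apply: le_trans (tau_moment R X _).
pose F e : R := ((tau e)%:R ^+ (g * (2 * k) + g) / e%:R)%R.
have F0 e : (0 <= F e)%R by rewrite /F divr_ge0 // exprn_ge0.
(* Enlarging the single index [D d] to all [e] with [d %| e ^ g] allows the sums to be exchanged;
   each [e] is then counted at most [tau (e ^ g)] times. *)
apply: (@le_trans _ _ (\sum_(1 <= d < X.+1) \sum_(1 <= e < X.+1 | (d %| e ^ g)%N) F e)%R).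
  rewrite big_nat [leRHS]big_nat; apply: ler_sum => d /andP[d0 dX].
  rewrite -[leRHS]big_filter -/(F (D d)) -(big_seq1 +%R (D d) F).
  apply: ler_sum_uniq_sub => //; first by rewrite filter_uniq // iota_uniq.
  move=> x; rewrite inE => /eqP ->; have [_ dD _] := DP d d0.
  by rewrite mem_filter dD mem_index_iota D_gt0 // ltnS (leq_trans (D_le d d0)).
under eq_bigr do rewrite big_mkcond; rewrite exchange_big.
rewrite big_nat [leRHS]big_nat; apply: ler_sum => e /andP[e0 eX].
rewrite -big_mkcond -(big_filter _ (fun d => d %| e ^ g)%N) big_const_seq iter_addr_0 count_predT.
set s := filter _ _; have ss : (size s <= tau e ^ g)%N.
  apply: leq_trans (tauX g e0); apply: uniq_leq_size; first by rewrite filter_uniq // iota_uniq.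
  by move=> d; rewrite mem_filter => /andP[h _]; rewrite -dvdn_divisors // expn_gt0 e0.
have -> : ((tau e)%:R ^+ (g * (2 * k) + g + g) / e%:R = F e * (tau e)%:R ^+ g)%R.
  by rewrite /F exprD mulrAC.
rewrite -[leLHS]mulr_natr ler_wpM2l //.
by rewrite -natrX ler_nat.
Qed.
(** For degree [g > 0] and leading coefficient [c] this is [c ^ (g - 1) * P(x / c)], written so that
    its coefficients are visibly integers. *)
Definition monicized (P : {poly int}) : {poly int} :=
  let g := (size P).-1 in
  ('X^g + \poly_(i < g) (P`_i * lead_coef P ^+ (g.-1 - i)))%R.

Lemma size_monicized (P : {poly int}) : size (monicized P) = (size P).-1.+1.
Proof.
by rewrite /monicized size_polyDl size_polyXn // ltnS (leq_trans (size_poly _ _)).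
Qed.

Lemma monic_monicized (P : {poly int}) : (monicized P \is monic)%R.
Proof.
rewrite monicE /monicized lead_coefDl ?lead_coefXn //.
by rewrite size_polyXn ltnS size_poly.
Qed.

Lemma horner_monicized (P : {poly int}) (x : int) : (1 < size P)%N ->
  ((monicized P).[lead_coef P * x] = lead_coef P ^+ (size P).-2 * P.[x])%R.
Proof.
move=> P1; rewrite /monicized hornerD hornerXn horner_poly.
set c := lead_coef P.
have [g sP] : exists g, size P = g.+2 by exists (size P).-2; lia.
have cE : (c = P`_g.+1)%R by rewrite /c lead_coefE sP.
rewrite sP /= (horner_coef_wide _ (eq_leq sP)) [in RHS]big_ord_recr /= -cE mulrDr addrC.
congr (_ + _)%R; last by rewrite exprMn exprS; ring.
rewrite mulr_sumr; apply: eq_bigr => i _; rewrite exprMn.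
have ig : (i <= g)%N by rewrite -ltnS.
have -> : (c ^+ g = c ^+ (g - i) * c ^+ i)%R by rewrite -exprD subnK.
ring.
Qed.

(** With [c] the leading coefficient, [P(n)] divides the monic polynomial at [c * n], and
    [n |-> c * n] embeds [[-H, H]] into [[-|c|H, |c|H]]; the monic average over the larger interval
    dominates. *)
Lemma sum_tau_values (R : realFieldType) (P : {poly int}) : (1 < size P)%N ->
  exists A K c : nat, (0 < c)%N /\ forall H : nat, (1 < H)%N ->
  ((\sum_(0 <= n < (2 * H).+1 | P.[n%:Z - H%:Z] != 0) tau `|P.[n%:Z - H%:Z]%R|%N)%N%:R
    <= A%:R * H%:R * harm R (c * H) ^+ (2 ^ K) :> R)%R.
Proof.
move=> P1; set c := lead_coef P.
have c_neq0 : c != 0%R by rewrite lead_coef_eq0 -size_poly_gt0; lia.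
have c0 : (0 < `|c|)%N by rewrite absz_gt0.
have g0 : (0 < (size P).-1)%N by lia.
have [A [K AK]] := sum_tau_monic R (monic_monicized P) (size_monicized P) g0.
exists (A * `|c|)%N, K, `|c|%N; split=> // H H1; set X := (`|c| * H)%N.
have X1 : (1 < X)%N by rewrite (leq_trans H1) // leq_pmull.
have := AK X X1.
rewrite (_ : A%:R * X%:R = (A * `|c|)%N%:R * H%:R)%R; last by rewrite -!natrM mulnA.
apply: le_trans.
pose F (m : nat) : R := if ((monicized P).[m%:Z - X%:Z] != 0)%R then
  (tau `|(monicized P).[m%:Z - X%:Z]%R|%N)%:R%R else 0%R.
pose f (n : nat) : nat := `|(c * (n%:Z - H%:Z) + X%:Z)%R|%N.
have fE n : (n < (2 * H).+1)%N -> ((f n)%:Z - X%:Z = c * (n%:Z - H%:Z))%R.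
  move=> nH; rewrite /f gez0_abs ?addrK // -lerBlDr sub0r.
  have : (`|c * (n%:Z - H%:Z)| <= X%:Z)%R.
    rewrite normrM /X PoszM -abszE ler_wpM2l //; lia.
  by rewrite ler_norml => /andP[].
rewrite big_mkcond [X in (_ <= X%:R)%R]big_mkcond !natr_sum.
apply: (@le_trans _ _ (\sum_(0 <= n < (2 * H).+1) F (f n))%R).
  rewrite big_nat [leRHS]big_nat; apply: ler_sum => n /andP[_ nH].
  rewrite /F fE // horner_monicized // mulf_eq0 expf_eq0 (negPf c_neq0) andbF /=.
  case: ifPn => // Pn0; rewrite ler_nat tau_dvd // ?absz_gt0.
    by rewrite mulf_neq0 // expf_neq0.
  by rewrite abszM dvdn_mull.
rewrite -(big_map f xpredT F).
apply: (@le_trans _ _ (\sum_(0 <= m < (2 * X).+1) F m)%R); last first.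
  by apply: ler_sum => m _; rewrite /F; case: ifP.
apply: ler_sum_uniq_sub; last by move=> m; rewrite /F; case: ifP.
- rewrite map_inj_in_uniq ?iota_uniq // => x y.
  rewrite !mem_index_iota => /andP[_ xH] /andP[_ yH] e.
  have := fE _ xH; rewrite e fE // => /(mulfI c_neq0); lia.
- exact: iota_uniq.
move=> m /mapP[n]; rewrite !mem_index_iota => /andP[_ nH] -> /=.
have h := fE n nH; have : (`|c * (n%:Z - H%:Z)| <= X%:Z)%R.
  by rewrite normrM /X PoszM -abszE ler_wpM2l //; lia.
rewrite -h; lia.
Qed.

(** * Reducible polynomials with prescribed coefficients *)

Module SymmetricFunctions.
Import mpoly.
Local Open Scope ring_scope.

Lemma mmap_comp (n k : nat) (S : comNzRingType) (v : 'I_k -> S)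
    (t : {mpoly int[n]}) (lq : n.-tuple {mpoly int[k]}) :
  mmap intr v (t \mPo lq) = mmap intr (fun i => mmap intr v (tnth lq i)) t.
Proof.
rewrite comp_mpolyEX raddf_sum /= [RHS]/mmap; apply: eq_bigr => m _.
rewrite mmapZ comp_mpolyX rmorph_prod /=; congr (_ * _).
by apply: eq_bigr => i _; rewrite rmorphXn.
Qed.

Lemma mmap_mesym (K : idomainType) (n k : nat) (v : 'I_n -> K) :
  mmap intr v (mesym n int k) = (mesym n K k).@[v].
Proof.
rewrite /mesym !raddf_sum /=; apply: eq_bigr => h _.
by rewrite !rmorph_prod /=; apply: eq_bigr => i _; rewrite mmapX mmap1U mevalXU.
Qed.

(** The fundamental theorem on symmetric polynomials, kept with its weight bound: the elementary
    function of degree [i + 1] has weight [i + 1], so the weight controls the degree in any single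
    coefficient. *)
Lemma sym_in_coefs (K : idomainType) (n : nat) (q : {mpoly int[n]}) : q \is symmetric ->
  exists t : {mpoly int[n]}, (mweight t <= msize q)%N /\
  forall alpha : n.-tuple K, mmap intr (tnth alpha) q =
    mmap intr (fun i : 'I_n => (-1) ^+ i.+1 *
      (\prod_(c <- alpha) ('X - c%:P))`_(n - i.+1)) t.
Proof.
move=> /sym_fundamental[t [tE wt]]; exists t; split=> // alpha.
rewrite -tE mmap_comp; apply: eq_bigr => m _; congr (_ * _).
apply: eq_bigr => i _; congr (_ ^+ _).
have /= := mroots_coeff alpha (Ordinal (ltn_ord i : (i.+1 < n.+1)%N)) => ->.
rewrite mulrA -exprMn mulrNN mulr1 expr1n mul1r.
by rewrite tnth_mktuple mmap_mesym.
Qed.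

Lemma sym_value_int (K : idomainType) (n : nat) (q : {mpoly int[n]})
    (g : {poly int}) (alpha : n.-tuple K) : q \is symmetric ->
  \prod_(c <- alpha) ('X - c%:P) = map_poly intr g ->
  exists z : int, mmap intr (tnth alpha) q = z%:~R.
Proof.
move=> /(sym_in_coefs K)[t [_ tP]] alphaE.
exists (mmap idfun (fun i : 'I_n => (-1) ^+ i.+1 * g`_(n - i.+1)) t).
rewrite tP alphaE [in RHS]/mmap rmorph_sum; apply: eq_bigr => m _.
rewrite rmorphM rmorph_prod; congr (_ * _); apply: eq_bigr => i _.
by rewrite rmorphXn rmorphM rmorphXn rmorphN rmorph1 coef_map.
Qed.

Lemma msym_var (n : nat) (s : 'S_n) (i : 'I_n) : msym s 'X_i = 'X_(s i) :> {mpoly int[n]}.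
Proof.
rewrite msymX; congr 'X_[_]; apply/mnmP => j.
by rewrite mnmE !mnm1E -(inj_eq (@perm_inj _ s)) permKV.
Qed.

Definition subset_prods (n k : nat) (w : int) : {mpoly int[n]} :=
  \prod_(I : {set 'I_n} | #|I| == k) (w%:MP - \prod_(i in I) 'X_i).

Lemma subset_prods_sym (n k : nat) (w : int) : subset_prods n k w \is symmetric.
Proof.
apply/issymP => s; rewrite /subset_prods rmorph_prod /=.
rewrite [RHS](reindex_inj (imset_inj (@perm_inj _ s))) /=.
apply: eq_big => [I|I _]; first by rewrite card_imset //; exact: perm_inj.
rewrite rmorphB /= rmorph_prod /=; congr (_ - _).
  by rewrite -[w%:MP]mulr1 mul_mpolyC msymZ msym1.
rewrite big_imset /=; last by move=> x y _ _; apply: perm_inj.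
by apply: eq_bigr => i _; rewrite msym_var.
Qed.

Lemma mmap_subset_prods (K : comNzRingType) (n k : nat) (w : int) (v : 'I_n -> K) :
  mmap intr v (subset_prods n k w) =
    \prod_(I : {set 'I_n} | #|I| == k) (w%:~R - \prod_(i in I) v i).
Proof.
rewrite /subset_prods rmorph_prod /=; apply: eq_bigr => I _.
rewrite rmorphB /= mmapC rmorph_prod /=; congr (_ - _).
by apply: eq_bigr => i _; rewrite mmapX mmap1U.
Qed.

Lemma msize_prod_le (I : finType) (P : pred I) (n : nat) (F : I -> {mpoly int[n]}) (b : nat) :
  (forall i, P i -> (msize (F i) <= b.+1)%N) ->
  (msize (\prod_(i | P i) F i) <= (#|P| * b).+1)%N.
Proof.
move=> Fb; rewrite -sum1_card big_distrl /=.
elim/big_rec2: _ => [|i s p Pi IH]; first by rewrite -mpolyC1 mmeasureC.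
have [->|F0] := eqVneq (F i) 0; first by rewrite mul0r mmeasure0.
have [->|p0] := eqVneq p 0; first by rewrite mulr0 mmeasure0.
rewrite msizeM // mul1n; have := Fb i Pi; move: IH.
by move: (msize (F i)) (msize p) => x y; lia.
Qed.

Lemma msize_subset_prods (n k : nat) (w : int) :
  (msize (subset_prods n k w) <= ('C(n, k) * k).+1)%N.
Proof.
have -> : 'C(n, k) = #|[pred I : {set 'I_n} | #|I| == k]|.
  by rewrite -[in LHS](card_ord n) -card_draws; apply: eq_card => I; rewrite inE.
apply: msize_prod_le => I /eqP Ik.
rewrite (leq_trans (mmeasureD_le _ _ _)) // geq_max mmeasureN mmeasureC.
have {1}-> : (((w != 0)%R : nat) <= k.+1)%N by case: (w != 0).
rewrite -Ik (leq_trans (msize_prod_le (b := 1) _)) ?muln1 // => i _.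
by rewrite msizeX mdeg1.
Qed.

Lemma mmap_polyC_horner (n : nat) (v : 'I_n -> {poly int}) (t : {mpoly int[n]}) (z : int)
    (K : comNzRingType) :
  (mmap polyC v t).[z]%:~R = mmap intr (fun i => (v i).[z]%:~R : K) t.
Proof.
rewrite /mmap horner_sum rmorph_sum; apply: eq_bigr => m _.
rewrite hornerM hornerC rmorphM; congr (_ * _).
rewrite /mmap1 horner_prod rmorph_prod; apply: eq_bigr => i _.
by rewrite horner_exp rmorphXn.
Qed.

(** Only the variable of index 0 can become a polynomial of degree one, and its weight is 1. *)
Lemma size_mmap_polyC (n : nat) (v : 'I_n -> {poly int}) (t : {mpoly int[n]}) :
  (forall i : 'I_n, (size (v i) <= (i == 0%N :> nat).+1)%N) ->
  (size (mmap polyC v t) <= mweight t)%N.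
Proof.
move=> vs; rewrite /mmap; apply: (leq_trans (size_sum _ _ _)).
rewrite mmeasureE; apply/bigmax_leqP_seq => m mt _.
apply: leq_trans (leq_bigmax_seq _ mt _) => //.
rewrite mul_polyC (leq_trans (size_scale_leq _ _)) // /mmap1 /mnmwgt /=.
elim/big_rec2: _ => [|i s p _ IH]; first by rewrite size_poly1.
rewrite (leq_trans (size_polyMleq _ _)) //.
have h : (size (v i ^+ m i)%R <= (m i * i.+1).+1)%N.
  rewrite (leq_trans (size_poly_exp_leq _ _)) // ltnS mulnC leq_mul2l.
  by apply/orP; right; move: (vs i); case: (size (v i)) => [|[|[|?]]]; case: (nat_of_ord i).
by move: h IH; move: (size p) (size _) => x y; lia.
Qed.

(** Index 0 in the fundamental theorem stands for the coefficient of [X ^ (n - 1)], which remains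
    free while the others are frozen. The degree of the symmetric product bounds the weight, and so
    the degree of [T]. *)
Lemma subset_prods_poly (K : idomainType) (n k : nat) (w : int) (a : nat -> int) :
  exists T : {poly int}, (size T <= ('C(n, k) * k).+1)%N /\
  forall (f : {poly int}) (alpha : n.-tuple K),
    (forall i, (i < n.-1)%N -> f`_i = a i) ->
    \prod_(c <- alpha) ('X - c%:P) = map_poly intr f ->
    T.[f`_n.-1]%:~R =
      \prod_(I : {set 'I_n} | #|I| == k) (w%:~R - \prod_(i in I) tnth alpha i) :> K.
Proof.
have [t [wt tP]] := sym_in_coefs K (subset_prods_sym n k w).
pose v (i : 'I_n) : {poly int} :=
  (-1) ^+ i.+1 *: (if i == 0%N :> nat then 'X else (a (n - i.+1)%N)%:P).
exists (mmap polyC v t); split.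
  apply: leq_trans (msize_subset_prods n k w); apply: leq_trans wt.
  apply: size_mmap_polyC => i; rewrite (leq_trans (size_scale_leq _ _)) //.
  by case: eqP => _; rewrite ?size_polyX // size_polyC_leq1.
move=> f alpha fa alphaE; rewrite -mmap_subset_prods tP mmap_polyC_horner alphaE.
apply: eq_bigr => m _; congr (_ * _); apply: eq_bigr => i _; congr (_ ^+ _).
rewrite /v hornerZ rmorphM rmorphXn rmorphN rmorph1 coef_map; congr (_ * _).
case: eqP => [->|/eqP i0]; first by rewrite hornerX subn1.
by rewrite hornerC -fa //; have := ltn_ord i; lia.
Qed.

(** The product is the resultant of [g] and [p]. Symmetry in the roots makes it an integer, without
    recourse to a determinant. *)
Lemma prod_horner_int (K : idomainType) (n : nat) (g p : {poly int}) (alpha : n.-tuple K) :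
  \prod_(c <- alpha) ('X - c%:P) = map_poly intr g ->
  exists z : int, \prod_i (map_poly intr p).[tnth alpha i] = z%:~R.
Proof.
pose q : {mpoly int[n]} := \prod_(i < n) \sum_(j < size p) p`_j *: 'X_i ^+ j.
have qsym : q \is symmetric.
  apply/issymP => s; rewrite /q rmorph_prod /=.
  rewrite [RHS](reindex_inj (@perm_inj _ s)) /=; apply: eq_bigr => i _.
  rewrite raddf_sum /=; apply: eq_bigr => j _.
  by rewrite msymZ rmorphXn /= msym_var.
move=> /(sym_value_int qsym)[z zE]; exists z; rewrite -zE /q rmorph_prod.
apply: eq_bigr => i _; rewrite raddf_sum /= (@horner_coef_wide _ (size p)) ?size_poly //.
by apply: eq_bigr => j _; rewrite coef_map mmapZ rmorphXn /= mmapX mmap1U.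
Qed.

End SymmetricFunctions.

(** * Location of the roots of a monic polynomial *)

Section Roots.
Local Open Scope ring_scope.

Lemma roots_seq (R : idomainType) (p : {poly R}) : p != 0 ->
  exists s : seq R, (size s < size p)%N /\ forall x, root p x -> x \in s.
Proof.
move sp : (size p) => n; elim: n p sp => [|n IH] p sp p0.
  by move/eqP: sp; rewrite size_poly_eq0 (negPf p0).
have [[x rx]|noroot] := EM (exists x, root p x); last first.
  by exists [::]; split=> // x rx; case: noroot; exists x.
have [q pq] := factor_theorem _ _ rx.
have q0 : q != 0 by apply: contraNneq p0 => q0; rewrite pq q0 mul0r.
have sq : size q = n.
  by apply/eqP; rewrite -eqSS -sp pq size_Mmonic ?monicXsubC // size_XsubC addn2.
have [s [ss sP]] := IH q sq q0; exists (x :: s); split=> // y.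
rewrite pq rootM root_XsubC inE => /orP[/sP ->|->]; by rewrite ?orbT.
Qed.

(** Let [B] be the set of big roots. Comparing with the sum [- z] of all roots, [(#|B| - 1) * z] is
    a sum of [#|B|] terms of size at most [c] and of the small roots. For [#|B| >= 2] this is too
    little for the assumed size of [z]. *)
Lemma at_most_one_big_root (K : numClosedFieldType) (n : nat) (alpha : 'I_n -> K) (z c r : K) :
  0 <= c -> 0 <= r -> \sum_i alpha i = - z ->
  (forall i, r <= `|alpha i| -> `|alpha i + z| <= c) ->
  2 * c + n%:R * r < `|z| ->
  forall i j, r <= `|alpha i| -> r <= `|alpha j| -> i = j.
Proof.
move=> c0 r0 sumz big zbig i j ri rj; apply/eqP; apply: contraT => ij.
pose B := [set i | r <= `|alpha i|].
have B2 : (2 <= #|B|)%N.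
  have -> : 2%N = #|[set i; j]| by rewrite cards2 ij.
  by apply: subset_leq_card; apply/subsetP => x; rewrite !inE => /orP[]/eqP->.
have E : (#|B|.-1)%:R * z = \sum_(i in B) (alpha i + z) + \sum_(i in ~: B) alpha i.
  rewrite big_split /= sumr_const addrAC.
  have -> : \sum_(i in B) alpha i + \sum_(i in ~: B) alpha i = - z.
    rewrite -sumz [RHS](bigID (mem B)) /=; congr (_ + _).
    by apply: eq_bigl => x; rewrite inE.
  by rewrite -(ltn_predK B2) mulrS mulr_natl addrA addNr add0r.
have {}E : (#|B|.-1)%:R * `|z| <= #|B|%:R * c + n%:R * r.
  rewrite -[X in X * _]normr_nat -normrM E (le_trans (ler_normD _ _)) // lerD //.
    rewrite (le_trans (ler_norm_sum _ _ _)) //.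
    rewrite (@le_trans _ _ (\sum_(i in B) c)) //; last by rewrite sumr_const mulr_natl.
    by apply: ler_sum => x; rewrite inE => /big.
  rewrite (le_trans (ler_norm_sum _ _ _)) //.
  apply: (@le_trans _ _ (\sum_(i in ~: B) r)).
    apply: ler_sum => x; rewrite !inE => h.
    by have /orP[//|h'] := ger_leVge (normr_ge0 (alpha x)) r0; rewrite h' in h.
  rewrite sumr_const -[leLHS]mulr_natl ler_wpM2r // ler_nat.
  by rewrite -[leqRHS](card_ord n) max_card.
have m1 : (1 <= #|B|.-1)%N by lia.
have : (#|B|.-1)%:R * (2 * c + n%:R * r) < #|B|%:R * c + n%:R * r.
  by apply: lt_le_trans E; rewrite ltr_pM2l // ltr0n.
apply: contraTT => _; rewrite -real_leNgt ?realD ?realM ?realn ?ger0_real //.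
rewrite mulrDr; apply: lerD; last by rewrite ler_peMl ?mulr_ge0 // ler1n.
by rewrite mulrA ler_wpM2r // -natrM ler_nat; lia.
by rewrite addr_ge0 ?mulr_ge0.
Qed.

Lemma monic_prod_roots (K : numClosedFieldType) (n : nat) (f : {poly int}) :
  f \is monic -> size f = n.+1 ->
  exists alpha : n.-tuple K, \prod_(c <- alpha) ('X - c%:P) = map_poly intr f.
Proof.
move=> fm fs; have [r rE] := closed_field_poly_normal (map_poly intr f : {poly K}).
have fm2 : map_poly intr f \is @monic K by exact: monic_map.
move: rE; rewrite (monicP fm2) scale1r => rE.
have sr : size r == n.
  have := size_prod_XsubC r id; rewrite -rE size_map_poly_id0 ?fs; first by case=> ->.
  by rewrite (monicP fm) oner_neq0.
by exists (Tuple sr).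
Qed.

Lemma sum_roots (K : idomainType) (n : nat) (g : {poly K}) (alpha : n.+1.-tuple K) :
  \prod_(c <- alpha) ('X - c%:P) = g -> \sum_i tnth alpha i = - g`_n.
Proof. by move=> <-; rewrite -mpoly.mroots_sum big_tuple. Qed.

Lemma prod_roots (K : idomainType) (n : nat) (g : {poly K}) (alpha : n.-tuple K) :
  \prod_(c <- alpha) ('X - c%:P) = g -> \prod_(c <- alpha) c = (-1) ^+ n * g.[0].
Proof.
move=> <-; rewrite horner_prod [in RHS](eq_bigr (fun c => (-1) * c)); last first.
  by move=> c _; rewrite hornerXsubC sub0r mulN1r.
rewrite big_split /= big_const_seq count_predT size_tuple iter_mulr_1.
by rewrite mulrA -exprMn mulrNN mulr1 expr1n mul1r.
Qed.

Lemma root_next_to_leading (K : numClosedFieldType) (n : nat) (a : nat -> int) (f : {poly int})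
    (x : K) :
  f \is monic -> size f = n.+2 -> (forall i, (i < n)%N -> f`_i = a i) ->
  (map_poly intr f).[x] = 0 ->
  x ^+ n * (x + (f`_n)%:~R) = - \sum_(i < n) (a i)%:~R * x ^+ i.
Proof.
move=> fm fs fa fx.
have fE : map_poly intr f = ('X^(n.+1) + ((f`_n)%:~R : K) *: 'X^n + \sum_(i < n) ((a i)%:~R :
    K) *: 'X^i)%R.
  apply/polyP => j; rewrite coef_map !coefD coefXn coefZ coefXn coef_sum.
  under eq_bigr do rewrite coefZ coefXn.
  have [jn|nj] := ltnP j n.
    rewrite (bigD1 (Ordinal jn)) //= eqxx mulr1 big1 ?addr0 => [|i]; last first.
      by rewrite -val_eqE /= eq_sym => /negPf ->; rewrite mulr0.
    by rewrite fa // !ltn_eqF ?mulr0 ?add0r // ltnW.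
  rewrite big1 ?addr0 => [|i _]; last by rewrite gtn_eqF ?mulr0 // (leq_trans _ nj).
  have [->|jn] := eqVneq j n; first by rewrite mulr1 ltn_eqF ?add0r.
  rewrite mulr0 addr0; have [->|jn1] := eqVneq j n.+1.
    by have := monicP fm; rewrite lead_coefE fs => ->.
  by rewrite nth_default // fs; lia.
apply/eqP; rewrite -addr_eq0; apply/eqP; rewrite -[RHS]fx fE !hornerD hornerZ !hornerXn horner_sum.
rewrite [X in _ = _ + X](eq_bigr (fun i : 'I_n => (a i)%:~R * x ^+ i)).
  by rewrite exprS; ring.
by move=> i _; rewrite hornerZ hornerXn.
Qed.

(** Dividing the root equation by [x ^ n] leaves terms [a_i * x ^ (i - n)], each at most
    [|a_i| * R ^ n]. The bound does not involve the next-to-leading coefficient, which can therefore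
    be taken large afterwards. *)
Lemma big_root_near (K : numClosedFieldType) (n : nat) (a : nat -> int) (R : nat) (f : {poly
    int}) (x : K) :
  (0 < R)%N -> f \is monic -> size f = n.+2 -> (forall i, (i < n)%N -> f`_i = a i) ->
  (map_poly intr f).[x] = 0 -> R%:R^-1 <= `|x| ->
  `|x + (f`_n)%:~R| <= (\sum_(i < n) `|a i|%N * R ^ n)%N%:R.
Proof.
move=> R0 fm fs fa fx xR.
have Rp : 0 < R%:R :> K by rewrite ltr0n.
have x0 : 0 < `|x| by rewrite (lt_le_trans _ xR) // invr_gt0.
have {}fx := root_next_to_leading fm fs fa fx.
rewrite -(ler_pM2l (exprn_gt0 n x0)) -normrX -normrM fx normrN.
rewrite (le_trans (ler_norm_sum _ _ _)) // natr_sum mulr_sumr ler_sum // => i _.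
rewrite normrM natrM mulrCA natr_absz intr_norm ler_wpM2l // natrX normrX.
have xR1 : 1 <= `|x| * R%:R by rewrite -ler_pdivrMr // mul1r.
have -> : `|x| ^+ n * R%:R ^+ n = `|x| ^+ i * ((`|x| * R%:R) ^+ (n - i) * R%:R ^+ i).
  by rewrite exprMn -{1 2}(subnK (ltnW (ltn_ord i))) !exprD; ring.
by rewrite normrX ler_peMr ?exprn_ge0 // mulr_ege1 ?exprn_ege1 // ler1n.
Qed.

Lemma norm_prod_small (K : numDomainType) (I : finType) (A : {set I}) (x : I -> K) (r : K) :
  A != set0 -> 0 <= r <= 1 -> (forall i, i \in A -> `|x i| <= r) ->
  `|\prod_(i in A) x i| <= r.
Proof.
case/set0Pn => i iA /andP[r0 r1] xr.
rewrite (bigD1 i) //= normrM -[leRHS]mulr1 ler_pM ?xr // normr_prod.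
apply: prodr_ile1 => j /andP[jA _]; by rewrite normr_ge0 (le_trans (xr j jA)).
Qed.

(** All roots but at most one have modulus at most [1 / (|w| + 1)]. If [I] avoids the big root, its
    product is too small to equal [w]. If [I] contains it, the complement is nonempty because
    [k <= n], its product is at most [1 / (|w| + 1)], and multiplying by [w] does not reach
    [|a 0| >= 1]. *)
Lemma subset_prod_neq (K : numClosedFieldType) (n k : nat) (w : int) (a : nat -> int) :
  (0 < n)%N -> (0 < k <= n)%N -> w != 0 -> a 0%N != 0 ->
  exists Z : nat, forall (f : {poly int}) (alpha : n.+1.-tuple K),
    f \is monic -> size f = n.+2 -> (forall i, (i < n)%N -> f`_i = a i) ->
    (Z < absz (f`_n)%R)%N -> \prod_(c <- alpha) ('X - c%:P) = map_poly intr f ->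
    forall I : {set 'I_n.+1}, #|I| = k -> w%:~R != \prod_(i in I) tnth alpha i.
Proof.
move=> n0 /andP[k0 kn] w0 a0; pose R := `|w|.+1; pose C := (\sum_(i < n) `|a i| * R ^ n)%N.
(* The threshold beyond which at most one root is big: errors [C], and [n + 1] roots with radius
   [r <= 1]. *)
exists (2 * C + n.+1)%N => f alpha fm fs fa zbig alphaE I Ik.
pose r : K := R%:R^-1; have Rp : 0 < R%:R :> K by rewrite ltr0n.
have r01 : 0 <= r <= 1 by rewrite /r invr_ge0 ltW //= invf_le1 // ler1n.
have rp : 0 < r by rewrite invr_gt0.
have aroot i : (map_poly intr f).[tnth alpha i] = 0.
  by apply/eqP; rewrite -alphaE -[_ == 0]/(root _ _) root_prod_XsubC mem_tnth.
have sumE : \sum_i tnth alpha i = - (f`_n)%:~R :> K by rewrite (sum_roots alphaE) coef_map.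
have zbigK : 2 * C%:R + n.+1%:R * r < `|(f`_n)%:~R| :> K.
  rewrite -intr_norm -natr_absz; apply: (@le_lt_trans _ _ (2 * C + n.+1)%N%:R).
    rewrite natrD natrM lerD // ler_piMr //; by case/andP: r01.
  by rewrite ltr_nat.
have near i : r <= `|tnth alpha i| -> `|tnth alpha i + (f`_n)%:~R| <= C%:R.
  by apply: big_root_near.
have one := at_most_one_big_root (ler0n _ C) (ltW rp) sumE near zbigK.
have small i : ~~ (r <= `|tnth alpha i|) -> `|tnth alpha i| <= r.
  by have /orP[->//|] := ger_leVge (ltW rp) (normr_ge0 (tnth alpha i)).
have wR : `|w%:~R| + 1 = R%:R :> K by rewrite -intr_norm -natr_absz natr1.
apply/eqP => wE.
have [/existsP[i /andP[iI bi]]|/existsPn smallI] :=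
    boolP [exists i, (i \in I) && (r <= `|tnth alpha i|)].
  have h : `|\prod_(i in ~: I) tnth alpha i| <= r.
    apply: norm_prod_small => // [|j].
      by rewrite -card_gt0 cardsCs setCK card_ord Ik; lia.
    rewrite inE => jI; apply: small; apply: contraNN jI => bj.
    by rewrite (one j i).
  have p0 := prod_roots alphaE.
  have : 1 <= `|w%:~R| * r :> K.
    apply: (@le_trans _ _ `|\prod_(c <- alpha) c|).
      rewrite p0 horner_coef0 coef_map normrM normrX normrN1 expr1n mul1r fa //.
      by rewrite -intr_norm -natr_absz /= ler1n absz_gt0.
    rewrite big_tuple (bigID (mem I)) /= -wE normrM ler_wpM2l //.
    by rewrite (eq_bigl (mem (~: I))) // => j; rewrite -topredE /= in_setC.
  rewrite ler_pdivlMr // mul1r -wR -subr_ge0 opprD addrA subrr add0r.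
  by rewrite oppr_ge0 ler10.
have h : `|\prod_(i in I) tnth alpha i| <= r.
  apply: norm_prod_small => // [|j jI]; first by rewrite -card_gt0 Ik.
  by apply: small; have := smallI j; rewrite jI.
move: h; rewrite -wE /r -[leRHS]mul1r ler_pdivlMr // -wR => h.
have w1 : 1 <= `|w%:~R| :> K by rewrite -intr_norm -natr_absz ler1n absz_gt0.
have : 1 + 1 <= 1 :> K.
  apply: le_trans h; rewrite mulrDr mulr1 lerD //.
  by rewrite -[leLHS]mulr1 ler_pM.
by rewrite -subr_ge0 opprD addrA subrr add0r oppr_ge0 ler10.
Qed.

End Roots.

(** * Values of one coefficient that allow a factorization *)

Section Reducible.
Local Open Scope ring_scope.

Lemma reducible_monic_factors (f : {poly int}) : f \is monic -> ~ irreducible_overZ f ->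
  exists g h : {poly int}, [/\ g \is monic, h \is monic, (1 < size g)%N,
      (1 < size h)%N & f = g * h].
Proof.
move=> fm /contrapT[g [h [sg sh fE]]].
have gh : lead_coef g * lead_coef h = 1 by rewrite -lead_coefM -fE (monicP fm).
have gu : lead_coef g \is a GRing.unit by apply/unitrP; exists (lead_coef h); rewrite mulrC gh.
have hu : lead_coef h \is a GRing.unit by apply/unitrP; exists (lead_coef g); rewrite gh mulrC gh.
have sq (x : int) : x \is a GRing.unit -> x * x = 1.
  by rewrite qualifE /= => /orP[]/eqP->.
exists (lead_coef g *: g), (lead_coef h *: h); split.
- by rewrite monicE lead_coefZ sq.
- by rewrite monicE lead_coefZ sq.
- by rewrite size_scale //; apply: contraTneq gu => ->.
- by rewrite size_scale //; apply: contraTneq hu => ->.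
- by rewrite -scalerAl -scalerAr scalerA gh scale1r.
Qed.

Lemma reducible_coef_finite (n : nat) (a : nat -> int) : (0 < n)%N -> a 0%N != 0 ->
  exists s : seq int, (size s <= 2 * tau `|a 0%N| * (n.+1 * 2 ^ n.+1))%N /\
    forall f : {poly int}, f \is monic -> size f = n.+2 ->
      (forall i, (i < n)%N -> f`_i = a i) -> ~ irreducible_overZ f -> f`_n \in s.
Proof.
move=> n0 a0; pose K : numClosedFieldType := algC.
(* One list for each cardinal [k] and subset product [w], fixed before [f] is known; outside the
   useful range the empty list serves. *)
have /choice[L LP] : forall kw : nat * int, exists s : seq int,
    (0 < kw.1 <= n)%N -> kw.2 != 0 -> (size s <= 'C(n.+1, kw.1) * n.+1)%N /\
    forall (f : {poly int}) (alpha : n.+1.-tuple K),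
      f \is monic -> size f = n.+2 -> (forall i, (i < n)%N -> f`_i = a i) ->
      \prod_(c <- alpha) ('X - c%:P) = map_poly intr f ->
      (exists I : {set 'I_n.+1}, #|I| = kw.1 /\ \prod_(i in I) tnth alpha i = kw.2%:~R) ->
      f`_n \in s.
  move=> [k w] /=; have [kn|_] := boolP (0 < k <= n)%N; last by exists [::].
  have [->|w0] := eqVneq w 0; first by exists [::].
  have [T [sT TP]] := SymmetricFunctions.subset_prods_poly K n.+1 k w a.
  have [Z ZP] := subset_prod_neq K n0 kn w0 a0.
  (* [T] is tested at [Z + 1]: beyond [Z] no [k]-subset of roots has product [w], so no factor
     vanishes. *)
  have T0 : T != 0.
    pose f : {poly int} := 'X^(n.+1) + \poly_(i < n.+1) (if i == n then Z.+1%:Z else a i).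
    have sf : size f = n.+2 by rewrite size_polyDl size_polyXn // ltnS size_poly.
    have fm : f \is monic.
      by rewrite monicE lead_coefDl ?lead_coefXn // size_polyXn ltnS size_poly.
    have fi i : (i < n.+1)%N -> f`_i = if i == n then Z.+1%:Z else a i.
      by move=> ii; rewrite coefD coefXn coef_poly ii ltn_eqF ?add0r.
    have fa i : (i < n)%N -> f`_i = a i by move=> ii; rewrite fi ?ltn_eqF // ltnW.
    have [alpha alphaE] := monic_prod_roots K fm sf.
    have := TP f alpha fa alphaE; rewrite /= fi // eqxx => TE.
    apply: contraTneq isT => T0; suff : (0 : K) != 0 by rewrite eqxx.
    rewrite -[X in X != _](_ : T.[Z.+1%:Z]%:~R = 0); last by rewrite T0 horner0.
    rewrite TE; apply/prodf_neq0 => I /eqP Ik; rewrite subr_eq0.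
    by apply: (ZP f) => //; rewrite fi // eqxx.
  have [s [ss sP]] := roots_seq T0; exists s => _ _; split.
    rewrite -ltnS (leq_trans ss) // (leq_trans sT) // ltnS leq_mul2l.
    by case/andP: kn => _ kn; rewrite (leqW kn) orbT.
  move=> f alpha fm fs fa alphaE [I [Ik IE]]; apply: sP; rewrite /root.
  rewrite -(intr_eq0 K) (TP f alpha) //; apply/eqP.
  by rewrite (bigD1 I) ?Ik ?eqxx //= IE subrr mul0r.
pose ws : seq int := [seq e%:Z | e <- divisors `|a 0%N|] ++ [seq - e%:Z | e <- divisors `|a 0%N|].
have wsP w : (w %| a 0%N)%Z -> w \in ws.
  move=> wa; rewrite mem_cat; have wd : `|w|%N \in divisors `|a 0%N|.
    by rewrite -dvdn_divisors ?absz_gt0.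
  have [w0|w0] := ler0P w; apply/orP; [right|left]; apply/mapP; exists `|w|%N => //.
    by rewrite abszE ler0_norm // opprK.
  by rewrite abszE gtr0_norm.
have sws : size ws = (2 * tau `|a 0%N|)%N by rewrite size_cat !size_map addnn mul2n.
have ws0 w : w \in ws -> w != 0.
  have e0 e : e \in divisors `|a 0%N| -> e != 0%N.
    by rewrite -dvdn_divisors ?absz_gt0 // => /dvdn_gt0; rewrite absz_gt0 lt0n => ->.
  by rewrite mem_cat => /orP[]/mapP[e /e0 h ->]; rewrite ?oppr_eq0.
exists (flatten [seq flatten [seq L (k, w) | w <- ws] | k <- iota 1 n]); split.
  rewrite size_flatten /shape -map_comp sumnE big_map.
  (* Having bounded each degree by [(n + 1) * 'C(n + 1, k)], one sums the binomial coefficients over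
     [k] to at most [2 ^ (n + 1)]. *)
  apply: (@leq_trans (\sum_(k <- iota 1 n) size ws * ('C(n.+1, k) * n.+1))).
    rewrite !big_seq; apply: leq_sum => k; rewrite mem_iota => kn.
    rewrite /= size_flatten /shape -map_comp sumnE big_map.
    rewrite -sum1_size big_distrl /=.
    rewrite !big_seq; apply: leq_sum => w /ws0 w0; rewrite ?mul1n.
    by apply: (proj1 (LP (k, w) _ w0)); rewrite /=; lia.
  rewrite -big_distrr /= sws leq_mul2l; apply/orP; right.
  rewrite -big_distrl /= mulnC leq_mul2l /=.
  have -> : (2 ^ n.+1 = \sum_(0 <= i < n.+2) 'C(n.+1, i))%N.
    rewrite big_mkord -[2%N]/(1 + 1)%N expnDn; apply: eq_bigr => i _.
    by rewrite !exp1n !muln1.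
  rewrite big_ltn // big_nat_recr //= addnCA.
  by rewrite /index_iota subn1 leq_addr.
move=> f fm fs fa /(reducible_monic_factors fm)[g [h [gm hm sg sh fE]]].
pose k := (size g).-1; pose l := (size h).-1.
have kl : (k + l = n.+1)%N.
  by have := fs; rewrite fE size_Mmonic ?monic_neq0 // /k /l; move: sg sh => /=; lia.
have [ag agE] := monic_prod_roots K gm (esym (prednK (ltnW sg)) : size g = k.+1).
have [ah ahE] := monic_prod_roots K hm (esym (prednK (ltnW sh)) : size h = l.+1).
pose alpha : n.+1.-tuple K := tcast kl [tuple of ag ++ ah].
have alphaE : \prod_(c <- alpha) ('X - c%:P) = map_poly intr f.
  by rewrite val_tcast /= big_cat /= agE ahE fE rmorphM.
pose w := (-1) ^+ k * g.[0].
apply/flatten_mapP; exists k; first by rewrite mem_iota; move: (kl) sg sh; rewrite /k /l; lia.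
apply/flatten_mapP; exists w.
  apply: wsP; rewrite -fa // fE -horner_coef0 hornerM /w dvdzE !abszM abszX.
  by rewrite exp1n mul1n dvdn_mulr.
have /(LP (k, w)) : (0 < (k, w).1 <= n)%N by rewrite /=; move: sg sh (kl); rewrite /k /l; lia.
case=> [|_ LkP].
  apply: ws0; apply: wsP; rewrite -fa // fE -horner_coef0 hornerM /w dvdzE !abszM abszX.
  by rewrite exp1n mul1n dvdn_mulr.
apply: (LkP f alpha fm fs fa alphaE).
have kn : (k <= n.+1)%N by rewrite -kl leq_addr.
exists [set i : 'I_n.+1 | (i < k)%N]; split.
  rewrite -sum1_card (eq_bigl (fun i : 'I_n.+1 => (i < k)%N)); last by move=> i; rewrite inE.
  by rewrite -(big_ord_widen _ (fun=> 1%N) kn) sum1_card card_ord.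
rewrite (eq_bigl (fun i : 'I_n.+1 => (i < k)%N)); last by move=> i; rewrite inE.
rewrite (eq_bigr (fun i : 'I_n.+1 => (ag ++ ah)`_i)); last first.
  by move=> i _; rewrite (tnth_nth 0) val_tcast.
rewrite -(big_ord_widen _ (fun i => (ag ++ ah)`_i) kn).
have := prod_roots agE; rewrite horner_coef0 coef_map -horner_coef0 => E.
rewrite /w rmorphM rmorphXn rmorphN rmorph1 -E (big_nth 0) size_tuple big_mkord.
by apply: eq_bigr => i _; rewrite nth_cat size_tuple ltn_ord.
Qed.
End Reducible.

(** * Coefficients close to a large integer *)

Section LargeShift.
Local Open Scope ring_scope.
Variables (K : numClosedFieldType) (n H B : nat) (b : nat -> nat) (f : {poly int}).
Hypothesis n0 : (0 < n)%N.
Hypothesis bB : forall j, (j < n.+1)%N -> (b j <= B)%N.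
Hypothesis bH : forall j, (j < n.+1)%N -> (b j <= H)%N.
Hypothesis HB : (2 * (B.+1 * 8 ^ n.+1) < H)%N.
Hypothesis fm : f \is monic.
Hypothesis fs : size f = n.+2.
Hypothesis fb : forall j, (j < n.+1)%N -> f`_j = H%:Z - (b j)%:Z.

Let Phi : {poly int} := \poly_(j < n.+1) 1.

Let phi (x : K) := (map_poly intr Phi).[x].

Let phiE x : phi x = \sum_(j < n.+1) x ^+ j.
Proof.
rewrite /phi (@horner_coef_wide _ n.+1) ?size_poly //.
  by apply: eq_bigr => j _; rewrite coef_map coef_poly ltn_ord mul1r.
by rewrite (leq_trans (size_poly _ _)) // size_poly.
Qed.

Let geometric (x : K) m : (x - 1) * \sum_(j < m) x ^+ j = x ^+ m - 1.
Proof. by rewrite subrX1. Qed.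

Let root_phi (x : K) : root (map_poly intr f) x ->
  H%:R * phi x = \sum_(j < n.+1) (b j)%:R * x ^+ j - x ^+ n.+1.
Proof.
move=> /rootP fx; have := root_next_to_leading fm fs (fun i ii => fb (ltnW ii)) fx.
rewrite fb // phiE => E.
have {}E : x ^+ n.+1 + \sum_(j < n.+1) (H%:Z - (b j)%:Z)%:~R * x ^+ j = 0.
  rewrite big_ord_recr /= addrA; apply/eqP; rewrite addrAC addr_eq0 -E.
  by apply/eqP; rewrite exprS; ring.
apply/eqP; rewrite -subr_eq0 -[X in _ == X]E; apply/eqP; rewrite mulr_sumr opprB addrCA.
congr (_ + _); rewrite -sumrB; apply: eq_bigr => j _.
by rewrite rmorphB mulrBl.
Qed.

(** For [|x| >= 8] the lower terms form a geometric sum of size at most [H * |x| ^ n / (|x| - 1)].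
    Twice the resulting error [H / 7] stays well below the next-to-leading coefficient, which is
    close to [H]. *)
Let root_near (x : K) : root (map_poly intr f) x -> 8 <= `|x| ->
  `|x + (f`_n)%:~R| <= H%:R / 7.
Proof.
move=> /rootP fx x8; have := root_next_to_leading fm fs (fun i ii => fb (ltnW ii)) fx.
move=> /(congr1 Num.norm); rewrite normrM normrN normrX => E.
have x0 : 0 < `|x| by apply: lt_le_trans x8; rewrite ltr0n.
rewrite -(ler_pM2l (exprn_gt0 n x0)) E (le_trans (ler_norm_sum _ _ _)) //.
apply: (@le_trans _ _ (\sum_(i < n) H%:R * `|x| ^+ i)).
  apply: ler_sum => i _; rewrite normrM normrX ler_wpM2r ?exprn_ge0 //.
  have iH := bH (leqW (ltn_ord i)).
  by rewrite subzn // -[X in `|X|]/((H - b i)%:R) normr_nat ler_nat leq_subr.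
rewrite -mulr_sumr mulrCA ler_wpM2l // ler_pdivlMr ?ltr0n // mulrC.
apply: (@le_trans _ _ ((`|x| - 1) * \sum_(i < n) `|x| ^+ i)).
  rewrite ler_wpM2r ?sumr_ge0 // => [i _|]; first exact: exprn_ge0.
  by rewrite lerBrDr natr1.
by rewrite geometric lerBlDr lerDl ler01.
Qed.

Let one_big (alpha : n.+1.-tuple K) : \prod_(c <- alpha) ('X - c%:P) = map_poly intr f ->
  forall i j, 8 <= `|tnth alpha i| -> 8 <= `|tnth alpha j| -> i = j.
Proof.
move=> alphaE; apply: (@at_most_one_big_root _ _ _ (f`_n)%:~R (H%:R / 7)) => //.
- by rewrite divr_ge0.
- by rewrite (sum_roots alphaE) coef_map.
- by move=> i; apply: root_near; rewrite -alphaE root_prod_XsubC mem_tnth.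
rewrite fb // subzn ?bH // -[X in `|X|]/((H - b n)%:R) normr_nat.
have e : 2 * (H%:R / 7) + n.+1%:R * 8 = (2 * H + 56 * n.+1)%N%:R / 7 :> K.
  by rewrite natrD !natrM; field.
rewrite e ltr_pdivrMr ?ltr0n // -natrM ltr_nat.
have h8 : (8 * n.+1 <= 8 ^ n.+1)%N.
  by elim: (n) => // m IH; rewrite expnS; lia.
have h1 := bB (ltnSn n); have h2 : (B + 8 ^ n.+1 <= B.+1 * 8 ^ n.+1)%N.
  by have := ltn_expl n.+1 (isT : (1 < 8)%N); nia.
lia.
Qed.

(** For a root [c] of modulus at most 8, [H * phi c = b(c) - c ^ (n + 1)] is smaller than [H], so
    [|phi c| < 1]. The product of these numbers is an integer, so some [phi c] vanishes; then
    [c ^ (n + 1) = 1], and the same equation becomes [b(c) = 1]. *)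
Let small_factor (g h : {poly int}) (k : nat) (ag : k.+1.-tuple K) : f = g * h ->
  \prod_(c <- ag) ('X - c%:P) = map_poly intr g ->
  (forall c, c \in ag -> ~~ (8 <= `|c|)) ->
  exists zeta : K, [/\ zeta ^+ n.+1 = 1, zeta != 1 &
    \sum_(j < n.+1) (b j)%:R * zeta ^+ j = 1].
Proof.
move=> fE agE small; have [z zE] := SymmetricFunctions.prod_horner_int Phi agE.
have rootf c : c \in ag -> root (map_poly intr f) c.
  by move=> cag; rewrite fE rmorphM rootM /= -agE root_prod_XsubC cag.
have H0 : 0 < H%:R :> K by rewrite ltr0n; lia.
have phi1 c : c \in ag -> `|phi c| < 1.
  move=> cag; have c8 : `|c| <= 8.
    have /orP[h'|//] := ger_leVge (ler0n K 8) (normr_ge0 c).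
    by have := small c cag; rewrite h'.
  rewrite -(ltr_pM2l H0) mulr1 -[X in X * _]normr_nat -normrM root_phi ?rootf //.
  apply: (@le_lt_trans _ _ (B.+1 * 8 ^ n.+1 * 2)%N%:R); last by rewrite ltr_nat mulnC.
  have cj j : `|c ^+ j| <= (8 ^ j)%N%:R.
    by rewrite normrX natrX lerXn2r ?nnegrE.
  rewrite (le_trans (ler_normB _ _)) // muln2 -addnn natrD lerD //; last first.
    by rewrite (le_trans (cj _)) // ler_nat leq_pmull.
  rewrite (le_trans (ler_norm_sum _ _ _)) //.
  apply: (@le_trans _ _ (\sum_(j < n.+1) (B * 8 ^ j)%N%:R)).
    apply: ler_sum => j _; rewrite normrM natrM ler_pM // normr_nat ler_nat.
    exact: bB.
  rewrite -natr_sum ler_nat -big_distrr /= leq_mul // .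
  by have := predn_exp 8 n.+1; have := expn_gt0 8 n.+1; rewrite /=; lia.
have [/existsP[i /eqP phi0]|/existsPn phin0] := boolP [exists i, phi (tnth ag i) == 0].
  set c := tnth ag i in phi0; have cag : c \in ag := mem_tnth i ag.
  have cn : c ^+ n.+1 = 1.
    by apply/eqP; rewrite -subr_eq0 -geometric -phiE phi0 mulr0.
  exists c; split => //.
    apply: contra_eqN phi0 => /eqP ->; rewrite phiE.
    by under eq_bigr do rewrite expr1n; rewrite sumr_const card_ord pnatr_eq0.
  have := root_phi (rootf c cag); rewrite phi0 mulr0 cn => /esym/eqP.
  by rewrite subr_eq0 => /eqP.
have z0 : z != 0.
  by rewrite -(intr_eq0 K) -zE; apply/prodf_neq0 => i _; apply: phin0.
have : 1 <= `|z%:~R| :> K by rewrite -intr_norm -natr_absz ler1n absz_gt0.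
rewrite -zE normr_prod big_ord_recl => hz.
suff : `|phi (tnth ag ord0)| * \prod_(i < k) `|phi (tnth ag (lift ord0 i))| < 1.
  by move=> h'; have := le_lt_trans hz h'; rewrite ltxx.
rewrite (le_lt_trans _ (phi1 _ (mem_tnth ord0 ag))) // ler_piMr //.
by apply: prodr_ile1 => i _; rewrite normr_ge0 ltW // phi1 // mem_tnth.
Qed.

(* At most one root of [f] lies outside the disc of radius 8, so one of the two
   factors has all its roots there. For this factor [g], the integer
   [Res(g, 1 + X + ... + X^n)] has absolute value less than 1. *)
Lemma reducible_large_shift : ~ irreducible_overZ f ->
  exists zeta : K, [/\ zeta ^+ n.+1 = 1, zeta != 1 &
    \sum_(j < n.+1) (b j)%:R * zeta ^+ j = 1].
Proof.
move=> /(reducible_monic_factors fm)[g [h [gm hm sg sh fE]]].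
pose k := (size g).-2; pose l := (size h).-2.
have kl : (k.+1 + l.+1 = n.+1)%N.
  by have := fs; rewrite fE size_Mmonic ?monic_neq0 // /k /l; move: sg sh => /=; lia.
have [|ag agE] := monic_prod_roots K gm (_ : size g = k.+2); first by rewrite /k; lia.
have [|ah ahE] := monic_prod_roots K hm (_ : size h = l.+2); first by rewrite /l; lia.
pose alpha : n.+1.-tuple K := tcast kl [tuple of ag ++ ah].
have alphaE : \prod_(c <- alpha) ('X - c%:P) = map_poly intr f.
  by rewrite val_tcast /= big_cat /= agE ahE fE rmorphM.
have [/hasP[c cag c8]|/hasPn smallg] := boolP (has (fun c => 8 <= `|c|) ag); last first.
  exact: (small_factor fE agE).
apply: (small_factor (etrans fE (mulrC g h)) ahE) => c' c'ah; apply/negP => c'8.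
have i1 : (index c ag < n.+1)%N.
  by rewrite -kl (leq_trans (n := k.+1)) ?leq_addr // -[X in (_ < X)%N](size_tuple ag) index_mem.
have i2 : (k.+1 + index c' ah < n.+1)%N.
  by rewrite -kl ltn_add2l -[X in (_ < X)%N](size_tuple ah) index_mem.
(* Big roots of the two factors occupy different positions of [ag ++ ah], even if they are equal as
   numbers. *)
have := @one_big alpha alphaE (Ordinal i1) (Ordinal i2).
rewrite !(tnth_nth 0) val_tcast /= !nth_cat size_tuple.
have i3 : (index c ag < k.+1)%N by rewrite -[X in (_ < X)%N](size_tuple ag) index_mem.
rewrite i3 nth_index // ltnNge leq_addr /= addKn nth_index //.
move=> /(_ c8 c'8) /(congr1 val) /= e.
by move: i3; rewrite e ltnNge leq_addr.
Qed.
End LargeShift.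

(** * Polynomials in several variables as functions *)

Module PolynomialMaps.
Import mpoly.
Local Open Scope ring_scope.

Lemma exists_nonroot (R : numFieldType) (p : {poly R}) : p != 0 -> exists x, p.[x] != 0.
Proof.
move=> p0; have [s [_ sP]] := roots_seq p0; apply: contrapT => h.
pose r := [seq (k%:R : R) | k <- iota 0 (size s).+1].
have ur : uniq r by rewrite map_inj_uniq ?iota_uniq // => x y /eqP; rewrite eqr_nat => /eqP.
have rs : {subset r <= s}.
  by move=> x _; apply: sP; apply: contra_notT h => hx; exists x.
by have := uniq_leq_size ur rs; rewrite size_map size_iota ltnn.
Qed.

Lemma line_restriction (R : comNzRingType) (n : nat) (p : {mpoly R[n]}) (k : 'I_n)
    (v : 'I_n -> R) : exists q : {poly R},
  (size q <= (\max_(m <- msupp p) mdeg m).+1)%N /\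
  forall z, q.[z] = p.@[fun i => if i == k then z else v i].
Proof.
exists (\sum_(m <- msupp p) (p@_m * \prod_(i | i != k) v i ^+ m i) *: 'X^(m k)); split.
  apply: (leq_trans (size_sum _ _ _)); apply/bigmax_leqP_seq => m mp _.
  rewrite (leq_trans (size_scale_leq _ _)) // size_polyXn ltnS.
  apply: leq_trans (leq_bigmax_seq _ mp _) => //.
  by rewrite mdegE (bigD1 k) //= leq_addr.
move=> z; rewrite horner_sum mevalE; apply: eq_bigr => m _.
rewrite hornerZ hornerXn -mulrA; congr (_ * _).
rewrite [RHS](bigD1 k) //= eqxx mulrC; congr (_ * _).
by apply: eq_bigr => i /negPf ->.
Qed.

(** Monomials with the same last exponent and the same truncation coincide, so nothing cancels when
    terms are collected by powers of the last variable. *)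
Lemma muni_coef (R : nzRingType) (n : nat) (p : {mpoly R[n.+1]}) (m : 'X_{1..n.+1}) :
  m \in msupp p -> (muni p)`_(m ord_max) != 0.
Proof.
pose r (m : 'X_{1..n.+1}) := [multinom m (widen_ord (leqnSn n) i) | i < n].
move=> mp; suff : ((muni p)`_(m ord_max))@_(r m) = p@_m.
  by move=> E; apply: contraTneq mp => m0; rewrite mcoeff_msupp -E m0 mcoeff0 eqxx.
rewrite muniE coef_sum raddf_sum /= (bigD1_seq m) //=.
rewrite coefZ coefXn eqxx mulr1 mcoeffZ mcoeffX eqxx mulr1 big1 ?addr0 // => m' m'm.
rewrite coefZ coefXn; case: eqP => [e|_]; last by rewrite mulr0 mcoeff0.
rewrite mulr1 mcoeffZ mcoeffX; case: eqP => [e'|_]; last by rewrite mulr0.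
case/eqP: m'm; apply/mnmP => i; case: (unliftP ord_max i) => [j|] -> //.
have := congr1 (fun u : 'X_{1..n} => u j) e'; rewrite !mnmE.
by rewrite (_ : widen_ord _ j = lift ord_max j) //; apply: val_inj; rewrite /= /bump leqNgt ltn_ord.
Qed.

Lemma meval_muni (R : comNzRingType) (n : nat) (p : {mpoly R[n.+1]}) (v : 'I_n.+1 -> R) :
  p.@[v] = (map_poly (meval (fun i => v (widen_ord (leqnSn n) i))) (muni p)).[v ord_max].
Proof.
rewrite muniE rmorph_sum horner_sum mevalE; apply: eq_bigr => m _ /=.
rewrite map_polyZ map_polyXn hornerZ hornerXn /= mevalZ mevalX big_ord_recr /= mulrA.
by congr (_ * _ * _); apply: eq_bigr => i _; rewrite mnmE.
Qed.

Definition extend (R : Type) (n : nat) (v : 'I_n -> R) (z : R) (k : 'I_n.+1) : R :=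
  if unlift ord_max k is Some i then v i else z.

Lemma extend_max (R : Type) (n : nat) (v : 'I_n -> R) (z : R) : extend v z ord_max = z.
Proof. by rewrite /extend unlift_none. Qed.

Lemma extend_widen (R : Type) (n : nat) (v : 'I_n -> R) (z : R) (i : 'I_n) :
  extend v z (widen_ord (leqnSn n) i) = v i.
Proof.
rewrite (_ : widen_ord _ i = lift ord_max i) /extend ?liftK //.
by apply: val_inj; rewrite /= /bump leqNgt ltn_ord.
Qed.

Lemma meval_extend (R : comNzRingType) (n : nat) (p : {mpoly R[n.+1]}) (v : 'I_n -> R) z :
  p.@[extend v z] = (map_poly (meval v) (muni p)).[z].
Proof.
rewrite meval_muni extend_max; congr (_.[_]); apply: eq_map_poly => q /=.
by apply: meval_eq => i; rewrite extend_widen.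
Qed.

Lemma exists_nonzero (R : numFieldType) (n : nat) (p : {mpoly R[n]}) :
  p != 0 -> exists v, p.@[v] != 0.
Proof.
elim: n p => [|n IH] p p0.
  exists (fun=> 0); apply: contraNneq p0 => p00.
  have [c pc] : exists c, p = c%:MP.
    by exists p@_0%MM; apply/mpolyP => m; rewrite mcoeffC (_ : m = 0%MM) ?eqxx ?mulr1 //;
      apply/mnmP => -[].
  by move: p00; rewrite pc mevalC => ->; rewrite mpolyC0.
have [m mp] : exists m, m \in msupp p.
  case E : (msupp p) => [|m s]; last by exists m; rewrite mem_head.
  by move/eqP: E; rewrite msupp_eq0 (negPf p0).
have [v v0] := IH _ (muni_coef mp).
have q0 : map_poly (meval v) (muni p) != 0.
  apply: contraNneq v0 => q0; have := congr1 (fun q : {poly R} => q`_(m ord_max)) q0.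
  by rewrite coef_map coef0 => ->.
by have [z] := exists_nonroot q0; rewrite -meval_extend; exists (extend v z).
Qed.

(** At a suitable point the coefficient of some positive power of the last variable survives, so the
    restriction to the last axis differs from its value at 0. This turns the formal degree
    hypothesis into a statement about values. *)
Lemma exists_nonconstant (R : numFieldType) (n : nat) (p : {mpoly R[n.+1]}) :
  (0 < \max_(m <- msupp p) m ord_max)%N ->
  exists v t t', p.@[extend v t] != p.@[extend v t'].
Proof.
have [[m mp m0]|h] := EM (exists2 m, m \in msupp p & (0 < m ord_max)%N); last first.
  rewrite big_seq big1 // => m mp; apply/eqP; rewrite -leqn0 leqNgt; apply/negP => m0.
  by apply: h; exists m.
move=> _; have [v v0] := exists_nonzero (muni_coef mp).
pose q := map_poly (meval v) (muni p).
have q0 : q - (q.[0])%:P != 0.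
  apply: contraNneq v0 => q0; have := congr1 (fun q : {poly R} => q`_(m ord_max)) q0.
  by rewrite coefB coefC gtn_eqF // subr0 coef_map coef0 => ->.
have [t ht] := exists_nonroot q0; exists v, t, 0; rewrite !meval_extend.
by move: ht; rewrite !hornerE subr_eq0.
Qed.

Lemma meval_subst (R : comNzRingType) (n : nat) (k : 'I_n) (c : R) (p : {mpoly R[n]})
    (v : 'I_n -> R) :
  (p \mPo [tuple if j == k then mpolyC n c else mpolyX R (mnm1 j) | j < n]).@[v] =
  p.@[fun j => if j == k then c else v j].
Proof.
rewrite comp_mpoly_meval; apply: meval_eq => j; rewrite tnth_mktuple.
by case: eqP => _; rewrite ?mevalC ?mevalXU.
Qed.

End PolynomialMaps.

From mathcomp Require Import all_classical all_reals all_analysis.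
Import Order.TTheory GRing.Theory Num.Theory.
Import numFieldNormedType.Exports.
Local Open Scope classical_set_scope.
Local Open Scope ring_scope.

(** * Real bounds for the divisor sums *)

Section RealEstimates.
Variable R : realType.
Implicit Types (x : R) (H : nat).

Lemma ln_le_sub1 x : 0 < x -> ln x <= x - 1.
Proof.
move=> x0; have := @le_ln1Dx R (x - 1).
by rewrite (_ : 1 + (x - 1) = x); [apply; lra | ring].
Qed.

Lemma harm_le_ln (X : nat) : (0 < X)%N -> harm R X <= 1 + ln X%:R.
Proof.
rewrite /harm; elim: X => // -[|X] IH _; first by rewrite big_nat1 ln1 addr0 invr1.
rewrite big_nat_recr //=; apply: le_trans (lerD (IH isT) (lexx _)) _.
rewrite -addrA lerD2l -lerBrDl.
have p1 : 0 < X.+1%:R :> R by rewrite ltr0n.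
have p2 : 0 < X.+2%:R :> R by rewrite ltr0n.
rewrite -[leRHS]opprB -ln_div ?posrE // lerNr.
apply: (le_trans (ln_le_sub1 (divr_gt0 p1 p2))).
rewrite le_eqVlt; apply/orP; left; apply/eqP.
have e : X.+2%:R = X.+1%:R + 1 :> R by rewrite natr1.
by rewrite e in p2 *; move: X.+1%:R p1 p2 {IH e} => y p1 p2; field; rewrite gt_eqF.
Qed.

(** This is where [H >= 3] enters: powers of [ln H] then grow with the exponent. *)
Lemma ln3_gt1 : 1 < ln (3 : R).
Proof.
(* [(109 / 125) ^ 8] is just above [1 / 3], and [ln x <= x - 1] then yields
   [ln 3 >= 8 * 16 / 125 = 128 / 125]. *)
have h : ln (3^-1 : R) <= 8 * ln (109 / 125 : R).
  have b : 0 < (109 / 125 : R) by lra.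
  have b8 : 0 < (109 / 125 : R) ^+ 8 by rewrite exprn_gt0.
  rewrite mulrC mulr_natr -lnXn // ler_ln ?posrE ?invr_gt0 //.
  by rewrite !exprS expr0; lra.
have h2 : ln (109 / 125 : R) <= 109 / 125 - 1 by apply: ln_le_sub1; lra.
rewrite lnV ?posrE // in h; lra.
Qed.

Lemma ln_ge_ln3 H : (3 <= H)%N -> ln (3 : R) <= ln H%:R.
Proof. by move=> H3; rewrite ler_ln ?posrE ?ltr0n ?(ler_nat R 3 H) //; lia. Qed.

Lemma ln_gt1 H : (3 <= H)%N -> 1 < ln (H%:R : R).
Proof. by move=> /ln_ge_ln3; apply: lt_le_trans ln3_gt1. Qed.

(** Since [ln H >= ln 3 > 1], a constant [B >= 1] is at most [ln H] to the power [ln B / ln (ln 3)].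
    All constants depending on [P] thus disappear into the exponent. *)
Lemma powR_absorb (A : R) (K c : nat) : (0 < c)%N -> exists C : R, forall H, (3 <= H)%N ->
  A * (1 + ln (c * H)%N%:R) ^+ K <= (ln (H%:R : R)) `^ C.
Proof.
move=> c0; pose B := 1 + (`|A| * (2 + ln c%:R) ^+ K).
have lc : 0 <= ln (c%:R : R) by rewrite ln_ge0 // ler1n.
have Ap : 0 <= `|A| * (2 + ln c%:R) ^+ K by rewrite mulr_ge0 // exprn_ge0 // addr_ge0.
have B0 : 0 < B by rewrite /B ltr_pwDl.
have l3 := ln3_gt1; have ll3 : 0 < ln (ln (3 : R)) by rewrite ln_gt0.
exists (ln B / ln (ln 3) + K%:R) => H H3; have lH := ln_gt1 H3.
have lH0 : 0 < ln (H%:R : R) by rewrite (lt_trans ltr01).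
rewrite powRD ?(lt0r_neq0 lH0) ?implybT // powR_mulrn; last exact: ltW.
apply: (@le_trans _ _ (B * ln H%:R ^+ K)); last first.
  rewrite ler_wpM2r ?exprn_ge0 ?(ltW lH0) // -ler_ln ?posrE ?powR_gt0 // ln_powR.
  rewrite -[leLHS](divfK (lt0r_neq0 ll3)) ler_wpM2l //.
    by rewrite divr_ge0 ?(ltW ll3) // ln_ge0 // /B lerDl.
  by rewrite ler_ln ?posrE ?ln_ge_ln3 // (lt_trans ltr01).
apply: (@le_trans _ _ (`|A| * (1 + ln (c * H)%N%:R) ^+ K)).
  rewrite ler_wpM2r ?ler_norm // exprn_ge0 // addr_ge0 // ln_ge0 // ler1n.
  by rewrite muln_gt0 c0; lia.
apply: (@le_trans _ _ (`|A| * ((2 + ln c%:R) ^+ K) * ln H%:R ^+ K)); last first.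
  by rewrite ler_wpM2r ?exprn_ge0 ?(ltW lH0) // /B lerDr.
have cH0 : (0 < c * H)%N by rewrite muln_gt0 c0; lia.
rewrite -mulrA ler_wpM2l // -exprMn; apply: lerXn2r; rewrite ?nnegrE.
- by rewrite addr_ge0 // ln_ge0 // ler1n.
- by rewrite mulr_ge0 ?addr_ge0 ?(ltW lH0).
- by rewrite natrM lnM ?posrE ?ltr0n //; [nra|lia].
Qed.

Lemma ln_pow_le (N : nat) x : 1 <= x -> (1 + ln x) ^+ N <= (1 + N%:R) ^+ N * x.
Proof.
move=> x1; have x0 : 0 < x by rewrite (lt_le_trans ltr01).
case: N => [|N]; first by rewrite !expr0 mul1r.
pose y := x `^ (N.+1%:R^-1); have y0 : 0 < y by rewrite powR_gt0.
have yx : y ^+ N.+1 = x.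
  by rewrite -powR_mulrn ?(ltW y0) // /y -powRrM mulVf ?pnatr_eq0 // powRr1 ?(ltW x0).
have y1 : 1 <= y.
  by rewrite -(@ler_pXn2r _ N.+1) ?nnegrE ?(ltW y0) // expr1n yx.
rewrite -{2}yx -exprMn; apply: lerXn2r; rewrite ?nnegrE.
- by rewrite addr_ge0 // ln_ge0.
- by rewrite mulr_ge0 ?addr_ge0 ?(ltW y0).
rewrite -yx lnXn // -[ln y *+ _]mulr_natr mulrDl mul1r lerD // mulrC.
by rewrite ler_wpM2l // ltW // ln_sublinear.
Qed.

(** A single term of the moment sum is at most the whole, and a power of the logarithm is at most
    linear. So [tau m] is [O(m ^ (2 / K))]; exponent 1/6 corresponds to [K = 12]. *)
Lemma tau_pow_le (K : nat) : exists A : R, 0 < A /\ forall m : nat, (0 < m)%N ->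
  (tau m)%:R ^+ K <= A * m%:R ^+ 2.
Proof.
exists ((1 + (2 ^ K)%:R) ^+ (2 ^ K)); split; first by rewrite exprn_gt0 // ltr_pwDl.
move=> m m0; have m1 : 1 <= m%:R :> R by rewrite ler1n.
have mp : 0 < m%:R :> R by rewrite ltr0n.
rewrite expr2 mulrA -ler_pdivrMr //; apply: le_trans (ln_pow_le _ m1).
have h0 : 0 <= harm R m by rewrite /harm sumr_ge0.
apply: (@le_trans _ _ (harm R m ^+ (2 ^ K))); last first.
  by rewrite lerXn2r ?nnegrE ?addr_ge0 ?ln_ge0 // harm_le_ln.
apply: le_trans (tau_moment R m K).
rewrite -(big_seq1 +%R m (fun m => (tau m)%:R ^+ K / m%:R)).
apply: ler_sum_uniq_sub; rewrite ?iota_uniq //.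
by move=> x; rewrite inE => /eqP ->; rewrite mem_index_iota m0 ltnS leqnn.
Qed.

Lemma sum_tau_values_ln (P : {poly int}) (B : R) : (1 < size P)%N ->
  exists C : R, forall H, (3 <= H)%N ->
  B * (\sum_(0 <= n < (2 * H).+1 | P.[n%:Z - H%:Z] != 0) tau `|P.[n%:Z - H%:Z]|)%N%:R
    <= H%:R * (ln (H%:R : R)) `^ C.
Proof.
move=> P1; have [A [K [c [c0 AP]]]] := sum_tau_values R P1.
have [C CP] := powR_absorb (`|B| * A%:R) (2 ^ K) c0.
exists C => H H3.
apply: (@le_trans _ _ (`|B| * (A%:R * H%:R * harm R (c * H) ^+ (2 ^ K)))).
  have H1 : (1 < H)%N by lia.
  apply: le_trans (ler_wpM2l (normr_ge0 B) (AP H H1)).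
  by rewrite ler_wpM2r ?ler_norm.
apply: le_trans (ler_wpM2l (ler0n R H) (CP H H3)).
rewrite [leLHS](_ : _ = H%:R * (`|B| * A%:R * harm R (c * H) ^+ (2 ^ K))); last by ring.
have cH0 : (0 < c * H)%N by rewrite muln_gt0 c0; lia.
rewrite ler_wpM2l // ler_wpM2l ?mulr_ge0 //; apply: lerXn2r; rewrite ?nnegrE.
- by rewrite /harm sumr_ge0.
- by rewrite addr_ge0 // ln_ge0 // ler1n.
- exact: harm_le_ln.
Qed.
End RealEstimates.

(** * Independent choices from finite sets *)

Section FiniteProduct.
Variables (R : realFieldType) (I V : finType) (mu : I -> V -> R).
Hypothesis mu_ge0 : forall i v, 0 <= mu i v.
Hypothesis mu1 : forall i, \sum_v mu i v = 1.

Definition prodmass (x : {ffun I -> V}) : R := \prod_i mu i (x i).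

Definition ffupd (x : {ffun I -> V}) (j : I) (v : V) : {ffun I -> V} :=
  [ffun i => if i == j then v else x i].

Lemma prodmass_ge0 x : 0 <= prodmass x. Proof. exact: prodr_ge0. Qed.

Lemma sum_prodmass : \sum_x prodmass x = 1.
Proof. by rewrite -bigA_distr_bigA big1. Qed.

Lemma sum_prodmass_coord (j : I) (phi : V -> R) :
  \sum_x prodmass x * phi (x j) = \sum_v mu j v * phi v.
Proof.
pose F i v := mu i v * (if i == j then phi v else 1).
transitivity (\sum_(x : {ffun I -> V}) \prod_i F i (x i)).
  apply: eq_bigr => x _; rewrite /F big_split /=; congr (_ * _).
  by rewrite -big_mkcond big_pred1_eq.
rewrite -bigA_distr_bigA (bigD1 j) //= /F eqxx [X in _ * X]big1 ?mulr1 // => i /negPf ->.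
by under eq_bigr do rewrite mulr1.
Qed.

(* Resampling one coordinate: the swap of [x j] with an independent copy is an
   involution that preserves the mass. *)
Lemma sum_prodmass_resample (j : I) (g : {ffun I -> V} -> R) :
  \sum_x prodmass x * g x = \sum_x prodmass x * \sum_v mu j v * g (ffupd x j v).
Proof.
pose h (p : {ffun I -> V} * V) := (ffupd p.1 j p.2, p.1 j).
have hK : involutive h.
  move=> [x v]; rewrite /h /=; congr (_, _); last by rewrite ffunE eqxx.
  by apply/ffunP => i; rewrite !ffunE; case: eqP => // ->.
transitivity (\sum_x \sum_v prodmass x * mu j v * g x).
  apply: eq_bigr => x _; rewrite -mulr_suml -mulr_sumr mu1 mulr1 //.
rewrite pair_bigA /= (reindex_inj (inv_inj hK)) /=.
transitivity (\sum_x \sum_v prodmass x * (mu j v * g (ffupd x j v))); last first.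
  by apply: eq_bigr => x _; rewrite mulr_sumr.
rewrite pair_bigA /=; apply: eq_bigr => -[x v] _ /=; rewrite mulrA; congr (_ * _).
rewrite /prodmass (bigD1 j) //= [in RHS](bigD1 j) //= ffunE eqxx.
rewrite mulrAC [RHS]mulrC mulrA; congr (_ * _); last first.
  by apply: eq_bigr => i /negPf ij; rewrite ffunE ij.
Qed.

(** Conditioning on all coordinates but [j]: [beta x] bounds the conditional probability of [B], and
    the bounds are averaged. *)
Lemma sum_prodmass_fibre (j : I) (B : pred {ffun I -> V}) (beta : {ffun I -> V} -> R) :
  (forall x, \sum_(v | B (ffupd x j v)) mu j v <= beta x) ->
  \sum_(x | B x) prodmass x <= \sum_x prodmass x * beta x.
Proof.
move=> Bb; rewrite big_mkcond.
rewrite (eq_bigr (fun x => prodmass x * (B x)%:R)); last first.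
  by move=> x _; case: (B x); rewrite ?mulr1 ?mulr0.
rewrite (sum_prodmass_resample j (fun x => (B x)%:R)); apply: ler_sum => x _.
apply: (ler_wpM2l (prodmass_ge0 x)); apply: le_trans (Bb x).
rewrite [leRHS]big_mkcond /=.
by apply: ler_sum => v _; case: (B _); rewrite ?mulr1 ?mulr0.
Qed.

Lemma sum_prodmass_const (c : R) : \sum_x prodmass x * c = c.
Proof. by rewrite -mulr_suml sum_prodmass mul1r. Qed.

End FiniteProduct.

(** * From random variables to finite sums *)

Section Cylinders.
Context (d d' : measure_display) (T : measurableType d) (U : measurableType d')
  (R : realType) (Pr : probability T R) (I : finType) (X : I -> T -> U).
Hypothesis indep : mutually_independent Pr X.
Hypothesis mX : forall i, measurable_fun setT (X i).
Hypothesis mset1 : forall u : U, measurable [set u].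

Definition cyl (V : choiceType) (val : V -> U) (x : {ffun I -> V}) : set T :=
  \bigcap_(i in [set: I]) (X i @^-1` [set val (x i)]).

Definition point_mass (i : I) (u : U) : R := fine (Pr (X i @^-1` [set u])).

Lemma measurable_preimage1 i u : measurable (X i @^-1` [set u]).
Proof. by rewrite -[X in measurable X]setTI; apply: mX. Qed.

Lemma point_massE i u : Pr (X i @^-1` [set u]) = (point_mass i u)%:E.
Proof. by rewrite fineK // fin_num_measure //; apply: measurable_preimage1. Qed.

Lemma measurable_cyl (V : choiceType) (val : V -> U) x : measurable (cyl val x).
Proof.
apply: fin_bigcap_measurable; first exact: finite_finset.
by move=> i _; apply: measurable_preimage1.
Qed.

Lemma probability_cyl (V : finType) (val : V -> U) x :
  Pr (cyl val x) = (prodmass (fun i v => point_mass i (val v)) x)%:E.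
Proof.
rewrite indep // /prodmass -prodEFin; apply: eq_bigr => i _.
exact: point_massE.
Qed.

Lemma probability_big_disjoint (J : choiceType) (s : seq J) (F : J -> set T) : uniq s ->
  (forall x, measurable (F x)) -> (forall x y w, F x w -> F y w -> x = y) ->
  Pr (\big[setU/set0]_(x <- s) F x) = (\sum_(x <- s) Pr (F x))%E.
Proof.
move=> + mF dF; elim: s => [|x s IH] /=; first by rewrite !big_nil measure0.
move=> /andP[xs us]; rewrite !big_cons.
have mG : measurable (\big[setU/set0]_(y <- s) F y) by apply: bigsetU_measurable.
rewrite -IH //; apply: measureU => //.
rewrite -subset0 => w [xw]; rewrite -bigcup_seq => -[y /= ys yw].
by rewrite (dF _ _ _ xw yw) ys in xs.
Qed.

(** Cylinders over good vectors of values are disjoint and lie in [E] up to the null set [N]. The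
    variables are almost surely in [F], so the masses of these cylinders add up to 1 minus the bad
    mass. *)
Lemma probability_ge_good (F : {fset U}) (bad : pred {ffun I -> F}) (E : set T) (N : set T) :
  (forall i, \sum_(v : F) point_mass i (val v) = 1) ->
  measurable E -> Pr.-negligible N ->
  (forall (x : {ffun I -> F}) w, ~~ bad x -> (forall i, X i w = val (x i)) -> ~ N w -> E w) ->
  ((1 - \sum_(x | bad x) prodmass (fun i (v : F) => point_mass i (val v)) x)%:E <= Pr E)%E.
Proof.
move=> mu1 mE [N' [mN' N'0 NN']] good.
set m := prodmass _; have sm : \sum_x m x = 1 by apply: sum_prodmass.
have -> : 1 - \sum_(x | bad x) m x = \sum_(x | ~~ bad x) m x.
  by rewrite -sm (bigID bad) /= addrAC subrr add0r.
pose s := [seq x <- index_enum {ffun I -> F} | ~~ bad x].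
have us : uniq s by rewrite filter_uniq // index_enum_uniq.
have disj (x y : {ffun I -> F}) w : cyl val x w -> cyl val y w -> x = y.
  move=> xw yw; apply/ffunP => i; apply: val_inj => /=.
  by rewrite -(xw i Logic.I) -(yw i Logic.I).
pose G := \big[setU/set0]_(x <- s) cyl val x.
have PG : Pr G = (\sum_(x | ~~ bad x) m x)%:E.
  rewrite /G probability_big_disjoint //; last by move=> x; apply: measurable_cyl.
  by rewrite big_filter -sumEFin; apply: eq_bigr => x _; rewrite probability_cyl.
rewrite -PG; have mG : measurable G.
  by apply: bigsetU_measurable => x _; apply: measurable_cyl.
apply: (@le_trans _ _ (Pr (E `|` N'))).
  apply: le_measure; rewrite ?inE //; first exact: measurableU.
  move=> w; rewrite /G -bigcup_seq => -[x /=]; rewrite mem_filter => /andP[gx _] xw.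
  have [Nw|Nw] := EM (N w); first by right; apply: NN'.
  by left; apply: (good x w gx) => // i; apply: xw.
apply: (le_trans (measureU2 _ _ _)) => //.
by rewrite [X in (_ + X)%E]N'0 adde0.
Qed.

End Cylinders.

Lemma sum_seq_le (R : numDomainType) (U : choiceType) (F : {fset U}) (P : pred F)
    (s : seq U) (mu : U -> R) (m : R) : 0 <= m ->
  (forall v : F, P v -> val v \in s) -> (forall u, mu u <= m) ->
  \sum_(v : F | P v) mu (val v) <= (size s)%:R * m.
Proof.
move=> m0 Ps mum; apply: (@le_trans _ _ (\sum_(v : F | P v) m)).
  by apply: ler_sum => v _; apply: mum.
rewrite sumr_const -[leLHS]mulr_natl ler_wpM2r // ler_nat cardE -(size_map val).
apply: uniq_leq_size; first by rewrite map_inj_uniq ?enum_uniq //; apply: val_inj.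
by move=> _ /mapP[v + ->]; rewrite mem_enum => /Ps.
Qed.

Section PointMasses.
Context (d d' : measure_display) (T : measurableType d) (U : measurableType d')
  (R : realType) (Pr : probability T R).
Hypothesis mset1 : forall u : U, measurable [set u].

Lemma sum_probability_le1 (X : T -> U) (s : seq U) : measurable_fun setT X -> uniq s ->
  \sum_(u <- s) fine (Pr (X @^-1` [set u])) <= 1.
Proof.
move=> mX us; have m1 u : measurable (X @^-1` [set u]).
  by rewrite -[Y in measurable Y]setTI; apply: mX.
rewrite -lee_fin -sumEFin.
rewrite (eq_bigr (fun u => Pr (X @^-1` [set u]))); last first.
  by move=> u _; rewrite fineK // fin_num_measure.
rewrite -(@probability_big_disjoint _ T R Pr U s (fun u => X @^-1` [set u])) //.
  by apply: probability_le1; apply: bigsetU_measurable.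
by move=> x y w /= -> ->.
Qed.

(** The points of [A] already carry total mass 1, so none is left for a point outside. *)
Lemma uniform_point_mass (X : T -> U) (A : {fset U}) : measurable_fun setT X -> A != fset0 ->
  (forall u, u \in A -> Pr (X @^-1` [set u]) = ((#|` A|%:R : R)^-1)%:E) ->
  forall u, fine (Pr (X @^-1` [set u])) = if u \in A then (#|` A|%:R)^-1 else 0.
Proof.
move=> mX A0 XA u; case: ifPn => uA; first by rewrite XA.
have := @sum_probability_le1 X (u :: A) mX; rewrite /= uA fset_uniq => /(_ isT).
rewrite big_cons big_seq (eq_bigr (fun=> (#|` A|%:R)^-1)); last by move=> v vA; rewrite XA.
rewrite -big_seq big_const_seq iter_addr_0 count_predT -[_^-1 *+ _]mulr_natl mulfV; last first.
  by rewrite pnatr_eq0 -lt0n cardfs_gt0.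
rewrite -lerBrDr subrr => h; apply/eqP; rewrite eq_le h fine_ge0 //.
Qed.

Lemma sum_uniform (A F : {fset U}) (phi : U -> R) : (A `<=` F)%fset ->
  \sum_(v : F) (if val v \in A then (#|` A|%:R)^-1 else 0) * phi (val v) =
  (#|` A|%:R)^-1 * \sum_(u <- A) phi u.
Proof.
move=> AF; rewrite -(big_seq_fsetE _ _ xpredT
  (fun u => (if u \in A then (#|` A|%:R)^-1 else 0) * phi u)) /=.
rewrite -(big_fset_incl _ AF) /=; last by move=> u _ /negPf ->; rewrite mul0r.
by rewrite mulr_sumr big_seq [RHS]big_seq; apply: eq_bigr => u ->.
Qed.

Lemma sum_uniform1 (A F : {fset U}) : (A `<=` F)%fset -> A != fset0 ->
  \sum_(v : F) (if val v \in A then (#|` A|%:R)^-1 else 0) = 1 :> R.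
Proof.
move=> AF A0; transitivity (\sum_(v : F) (if val v \in A then (#|` A|%:R)^-1 else 0) * 1 : R).
  by apply: eq_bigr => v _; rewrite mulr1.
rewrite (sum_uniform (fun=> 1) AF) big_const_seq iter_addr_0 count_predT mulVf //.
by rewrite pnatr_eq0 -lt0n cardfs_gt0.
Qed.

End PointMasses.

Lemma measurable_int_set1 (u : int) : measurable [set u].
Proof. by []. Qed.

(** Integer vectors are countable, so the event is a countable union of cylinders. This makes
    irreducibility a measurable event. *)
Lemma measurable_countable_event (disp : measure_display) (T : measurableType disp)
    (I : finType) (X : I -> T -> int) (Q : (I -> int) -> Prop) :
  (forall i, measurable_fun setT (X i)) -> measurable [set w | Q (X ^~ w)].
Proof.
move=> mX.
have -> : [set w | Q (X ^~ w)] =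
    \bigcup_(x : {ffun I -> int}) (if `[< Q x >] then cyl X id x else set0).
  apply/seteqP; split => [w Qw|w [x _]].
    exists [ffun i => X i w] => //; rewrite ifT; first by move=> i _ /=; rewrite ffunE.
    by apply/asboolP; rewrite (_ : [ffun i => X i w] = X ^~ w :> (I -> int)) //;
      apply/funext => i; rewrite ffunE.
  case: asboolP => // Qx xw /=; rewrite (_ : X ^~ w = x) //.
  by apply/funext => i; apply: xw.
apply: countable_bigcupT_measurable => [|x]; first exact: countableP.
by case: ifP => _ //; apply: measurable_cyl.
Qed.

(** * Reducibility of a random polynomial with independent coefficients *)

Section MonicPoly.
Variables (n : nat) (a : 'I_n -> int).

Lemma monic_poly_ofE : monic_poly_of a = 'X^n + \poly_(i < n) (if insub i is Some j then a j
    else 0).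
Proof.
by rewrite /monic_poly_of poly_def; congr (_ + _); apply: eq_bigr => i _; rewrite valK.
Qed.

Lemma size_monic_poly_of : size (monic_poly_of a) = n.+1.
Proof. by rewrite monic_poly_ofE size_polyDl size_polyXn // ltnS size_poly. Qed.

Lemma monic_monic_poly_of : monic_poly_of a \is monic.
Proof. by rewrite monic_poly_ofE monicE lead_coefDl ?lead_coefXn // size_polyXn ltnS size_poly. Qed.

Lemma coef_monic_poly_of (j : 'I_n) : (monic_poly_of a)`_j = a j.
Proof. by rewrite monic_poly_ofE coefD coefXn coef_poly ltn_ord valK ltn_eqF ?add0r. Qed.

Lemma irreducible_deg1 : n = 1%N -> irreducible_overZ (monic_poly_of a).
Proof.
move=> n1 [g [h [sg sh fE]]]; have := size_monic_poly_of; rewrite fE size_mul.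
- by move: sg sh; rewrite n1; move: (size g) (size h) => x y; lia.
- by rewrite -size_poly_gt0 ltnW.
- by rewrite -size_poly_gt0 ltnW.
Qed.

End MonicPoly.

Definition divisor_bound (n : nat) (u : int) : nat := (2 * tau `|u| * (n.+1 * 2 ^ n.+1))%N.

Lemma reducible_last_coef (n : nat) (a : 'I_n.+1 -> int) : (0 < n)%N -> a ord0 != 0 ->
  exists s : seq int, (size s <= divisor_bound n (a ord0))%N /\
    forall a' : 'I_n.+1 -> int, (forall i, i != ord_max -> a' i = a i) ->
      ~ irreducible_overZ (monic_poly_of a') -> a' ord_max \in s.
Proof.
move=> n0 a0; pose b (i : nat) := a (inord i).
have b0 : b 0%N = a ord0 by congr a; apply: val_inj; rewrite /= inordK.
have [|s [ss sP]] := @reducible_coef_finite n b n0; first by rewrite b0.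
exists s; split=> [|a' a'a red]; first by rewrite /divisor_bound -b0.
have -> : a' ord_max = (monic_poly_of a')`_n by rewrite -(coef_monic_poly_of a' ord_max).
apply: sP => //; [exact: monic_monic_poly_of|exact: size_monic_poly_of|] => i ii.
rewrite -[i in LHS](@inordK n i) ?ltnS ?(ltnW ii) // coef_monic_poly_of a'a //.
by rewrite -val_eqE /= inordK ?ltn_eqF // ltnS ltnW.
Qed.

Section IndependentCoefficients.
Context (R : realType) (disp : measure_display) (T : measurableType disp)
  (Pr : probability T R) (n : nat) (a : 'I_n.+1 -> {RV Pr >-> int}).
Hypothesis n0 : (0 < n)%N.
Hypothesis indep : mutually_independent Pr (fun j : 'I_n.+1 => (a j : T -> int)).

Let pm j u : R := fine (Pr (a j @^-1` [set u])).

(** [Z] collects the constant coefficients that are given up entirely, 0 among them. For any other,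
    the last coefficient must hit one of at most [divisor_bound] values, each of mass at most [m].
    [F] is a common finite support. *)
Lemma prob_irreducible_ge (Z : pred int) (F : {fset int}) (m : R) : Z 0 -> 0 <= m ->
  (forall j, \sum_(v : F) pm j (val v) = 1) -> (forall u, pm ord_max u <= m) ->
  ((1 - \sum_(v : F) pm ord0 (val v) *
      (if Z (val v) then 1 else (divisor_bound n (val v))%:R * m))%:E
   <= Pr [set w : T | irreducible_overZ (monic_poly_of (fun j => a j w))])%E.
Proof.
move=> Z0 m0 pm1 pmm; pose bad (x : {ffun 'I_n.+1 -> F}) : bool :=
  `[< ~ irreducible_overZ (monic_poly_of (fun j => val (x j))) >].
have mX j : measurable_fun setT (a j : T -> int) by [].
apply: le_trans (@probability_ge_good _ _ T int R Pr _ _ indep mX measurable_int_set1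
   F bad _ set0 pm1 _ _ _); first last.
- move=> x w; rewrite /bad asbool_neg negbK => /asboolP irr aw _ /=.
  by rewrite (_ : (fun j => a j w) = fun j => val (x j)) //; apply/funext.
- exact: negligible_set0.
- exact: (@measurable_countable_event _ T _ (fun j => a j : T -> int)
    (fun x => irreducible_overZ (monic_poly_of x))).
rewrite lee_fin lerD2l lerN2.
pose phi (v : F) := if Z (val v) then 1 else (divisor_bound n (val v))%:R * m.
rewrite -(sum_prodmass_coord pm1 ord0 phi).
apply: sum_prodmass_fibre => [|//|x]; first by move=> i v; apply: fine_ge0.
rewrite /phi; case: ifPn => [_|Zx].
  rewrite -(pm1 ord_max) [leLHS]big_mkcond; apply: ler_sum => v _.
  by case: ifP => // _; apply: fine_ge0.
have x0 : val (x ord0) != 0 by apply: contraNneq Zx => ->.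
have [s [ss sP]] := @reducible_last_coef n (fun j => val (x j)) n0 x0.
apply: (@le_trans _ _ ((size s)%:R * m)); last by rewrite ler_wpM2r // ler_nat.
apply: (sum_seq_le m0 _ pmm) => v /asboolP /sP h.
move: h; rewrite ffunE eqxx; apply=> i /negPf im.
by rewrite ffunE im.
Qed.

End IndependentCoefficients.

(** * Sparse coefficients *)

Lemma sum_image (R : pzSemiRingType) (I U : choiceType) (r : seq I) (f : I -> U) (A : {fset U})
    (F : U -> R) :
  (forall i, i \in r -> f i \in A) ->
  \sum_(i <- r) F (f i) = \sum_(u <- A) F u *+ count (fun i => f i == u) r.
Proof.
move=> fA; transitivity (\sum_(i <- r) \sum_(u <- A) F u *+ (f i == u)).
  rewrite big_seq [RHS]big_seq; apply: eq_bigr => i ir.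
  rewrite (bigD1_seq (f i)) ?fset_uniq ?fA //= eqxx big1 ?addr0 // => u.
  by rewrite eq_sym => /negPf ->.
rewrite exchange_big /=; apply: eq_bigr => u _.
rewrite -sum1_count [X in _ = _ *+ X]big_mkcond -sumrMnr.
by apply: eq_bigr => i _; case: eqP.
Qed.

Section PolyValues.
Variables (R : realType) (P : {poly int}).
Hypothesis P0 : P != 0.

Let f (H n : nat) : int := P.[n%:Z - H%:Z].

Let mem_values H n : (n \in iota 0 (2 * H).+1) -> f H n \in poly_values P H.
Proof. by move=> nH; apply/imfsetP; exists n. Qed.

Let fibre_le H u : (1 < size P)%N ->
  (count (fun n => f H n == u) (iota 0 (2 * H).+1) <= (size P).-1)%N.
Proof.
move=> P1; have sP : size (P - u%:P) = size P.
  by rewrite size_polyDl // size_polyN (leq_ltn_trans (size_polyC_leq1 _)).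
have Pu0 : P - u%:P != 0 by rewrite -size_poly_gt0 sP ltnW.
rewrite -size_filter -(size_map (fun n : nat => n%:Z - H%:Z)) -ltnS prednK ?(ltnW P1) // -sP.
apply: max_poly_roots => //.
  apply/allP => _ /mapP[n + ->]; rewrite mem_filter => /andP[/eqP fn _].
  by rewrite /root !hornerE subr_eq0; apply/eqP.
by rewrite map_inj_uniq ?filter_uniq ?iota_uniq // => x y /addIr [].
Qed.

Lemma poly_values_neq0 H : poly_values P H != fset0.
Proof. by apply/fset0Pn; exists (f H 0); apply: mem_values; rewrite mem_iota. Qed.

Lemma card_poly_values H : (1 < size P)%N ->
  (2 * H + 1)%:R <= (size P).-1%:R * (#|` poly_values P H|)%:R :> R.
Proof.
move=> P1; have := @sum_image R _ _ (iota 0 (2 * H).+1) (f H) (poly_values P H) (fun=> 1)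
    (@mem_values H).
rewrite big_const_seq iter_addr_0 count_predT size_iota addn1 => ->.
apply: (@le_trans _ _ (\sum_(u <- poly_values P H) (size P).-1%:R)).
  by apply: ler_sum => u _; rewrite ler_nat fibre_le.
by rewrite big_const_seq iter_addr_0 count_predT mulr_natr.
Qed.

(** The law is uniform on values, not on arguments. For nonconstant [P] a value has at most [deg P]
    preimages, so its mass is at most [deg P / (2H + 1)], while a sum of nonnegative terms over
    values is at most the sum over arguments. *)
Lemma poly_values_mass : exists C : R, forall H, (3 <= H)%N ->
  (if 0 \in poly_values P H then (#|` poly_values P H|%:R)^-1 else 0 : R)
    <= (size P).-1%:R / (2 * H + 1)%:R /\
  (#|` poly_values P H|%:R)^-1 *
    \sum_(u <- poly_values P H) (if u == 0 then 0 else (tau `|u|)%:R) <= (ln (H%:R : R)) `^ C.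
Proof.
have [P1|P1] := leqP (size P) 1.
  have /size_poly1P[c c0 Pc] : size P == 1%N by rewrite eqn_leq P1 size_poly_gt0.
  have [C CP] := @powR_absorb R (tau `|c|)%:R 0 1 isT.
  exists C => H H3; have := CP H H3; rewrite expr0 mulr1 => {}CP.
  have -> : poly_values P H = [fset c]%fset.
    apply/fsetP => u; rewrite inE; apply/imfsetP/eqP => [[n _ ->]|->].
      by rewrite Pc hornerC.
    by exists 0%N; rewrite ?Pc ?hornerC //= mem_iota.
  by rewrite inE eq_sym (negPf c0) cardfs1 invr1 mul1r big_seq_fset1 (negPf c0); split=> //.
have [C CP] := @sum_tau_values_ln R P (size P).-1%:R P1.
exists C => H H3; set A := poly_values P H.
have A0 : 0 < #|` A|%:R :> R by rewrite ltr0n cardfs_gt0 poly_values_neq0.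
have H0 : 0 < (2 * H + 1)%:R :> R by rewrite ltr0n addn1.
have Ainv : (#|` A|%:R)^-1 <= (size P).-1%:R / (2 * H + 1)%:R :> R.
  by rewrite ler_pdivlMr // mulrC ler_pdivrMr // card_poly_values.
split; first by case: ifP => // _; rewrite divr_ge0.
pose F (u : int) : R := if u == 0 then 0 else (tau `|u|)%:R.
have F0 u : 0 <= F u by rewrite /F; case: ifP.
have S0 : 0 <= \sum_(n <- iota 0 (2 * H).+1) F (f H n) by apply: sumr_ge0.
have lC0 : 0 <= (ln (H%:R : R)) `^ C by rewrite powR_ge0.
apply: (@le_trans _ _ ((size P).-1%:R / (2 * H + 1)%:R * \sum_(n <- iota 0 (2 * H).+1) F (f H n))).
  apply: ler_pM => //; first by apply: sumr_ge0 => u _; apply: F0.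
  rewrite (@sum_image R _ _ (iota 0 (2 * H).+1) (f H) A F (@mem_values H)) !big_seq.
  apply: ler_sum => u /imfsetP[n nH uE]; rewrite -[leLHS]mulr1n.
  apply: (ler_wpMn2l (F0 u)); rewrite -has_count; apply/hasP.
  by exists n => //; apply/eqP.
rewrite mulrAC ler_pdivrMr //.
apply: (@le_trans _ _ (H%:R * ln H%:R `^ C)).
  apply: le_trans (CP H H3); rewrite ler_wpM2l // [X in _ <= X%:R]big_mkcond natr_sum.
  rewrite /index_iota subn0; apply: ler_sum => n _; rewrite /F /f.
  by case: (P.[_] == 0).
rewrite mulrC ler_wpM2l // ler_nat; lia.
Qed.
End PolyValues.

Lemma natr_divisor_bound (R : pzSemiRingType) (n : nat) (u : int) :
  (divisor_bound n u)%:R = 2 * (tau `|u|)%:R * (n.+1%:R * 2 ^+ n.+1) :> R.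
Proof. by rewrite /divisor_bound !natrM natrX. Qed.

Lemma sparse_irreducible (R : realType) (P : {poly int}) : P != 0 ->
      exists C : R,
      forall (d : nat) (d_gt0 : (0 < d)%N) (H : nat) (H_ge3 : (3 <= H)%N)
        (disp : measure_display) (T : measurableType disp)
        (Pr : probability T R) (a : 'I_d -> {RV Pr >-> int})
        (S : 'I_d -> {fset int}),
      (forall i : 'I_d, i = 0%N :> nat -> uniform_on (a i) (poly_values P H)) ->
      (forall j : 'I_d, (0 < j)%N -> #|` S j| = H /\ uniform_on (a j) (S j)) ->
      mutually_independent Pr (fun j : 'I_d => (a j : T -> int)) ->
      ((1 - (size P).-1%:R / (2 * H + 1)%:R
          - 2 * d%:R * 2 ^+ d * ((ln (H%:R : R)) `^ C) / H%:R)%:E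
        <= Pr [set w : T |
                irreducible_overZ (monic_poly_of (fun j => a j w))])%E.
Proof.
move=> P0; have [C CP] := poly_values_mass R P0; exists C.
(* For [d = 1] there is no last coefficient distinct from [a_0], but every polynomial of degree 1 is
   irreducible. *)
case=> // -[|n'] _ H H3 disp T Pr a S a0U aU indep.
  rewrite [X in Pr X](_ : _ = setT); last first.
    by apply/seteqP; split => // w _; apply: irreducible_deg1.
  rewrite probability_setT lee_fin -addrA -opprD lerBlDr lerDl.
  by rewrite addr_ge0 // divr_ge0 // mulr_ge0 // powR_ge0.
set n := n'.+1 in a S a0U aU indep *; have n0 : (0 < n)%N by [].
have [HA HB] := CP H H3; set A := poly_values P H in a0U HA HB.
pose S' (j : 'I_n.+1) := if j == ord0 then A else S j.
pose F := (\bigcup_(j <- enum 'I_n.+1) S' j)%fset.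
have SF j : (S' j `<=` F)%fset by apply: bigfcup_sup; rewrite ?mem_enum.
have S'U j : S' j != fset0 /\ forall u, u \in S' j ->
    Pr (a j @^-1` [set u]) = ((#|` S' j|%:R : R)^-1)%:E.
  have [->|j0] := eqVneq j ord0; first by rewrite /S' eqxx; exact: (a0U ord0 erefl).
  rewrite /S' (negPf j0); have [|_ //] := aU j; rewrite lt0n.
  by apply: contraNneq j0 => j0; apply/eqP/val_inj.
have mX j : measurable_fun setT (a j : T -> int) by [].
have pmE j := uniform_point_mass measurable_int_set1 (mX j) (proj1 (S'U j)) (proj2 (S'U j)).
have H0 : 0 < H%:R :> R by rewrite ltr0n; lia.
apply: le_trans (@prob_irreducible_ge R disp T Pr n a n0 indep (fun u =>
    u == 0) F (H%:R)^-1 _ _ _ _); first last.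
- move=> u; rewrite pmE; have [SH _] : #|` S ord_max| = H /\ uniform_on (a ord_max) (S ord_max)
    by apply: aU.
  by rewrite {1}/S' /= SH; case: ifP => // _; rewrite invr_ge0 ltW.
- move=> j; rewrite -[RHS](sum_uniform1 R (SF j) (proj1 (S'U j))).
  by apply: eq_bigr => v _; rewrite pmE.
- by rewrite invr_ge0 ltW.
- by rewrite eqxx.
rewrite lee_fin -addrA -opprD lerD2l lerN2.
under eq_bigr do rewrite pmE.
rewrite (sum_uniform (fun u : int => if u == 0 then 1 else (divisor_bound n u)%:R / H%:R) (SF
    ord0)).
have -> : S' ord0 = A by rewrite /S' eqxx.
rewrite (eq_bigr (fun u => (u == 0)%:R + (2 * n.+1%:R * 2 ^+ n.+1 / H%:R) *
   (if u == 0 then 0 else (tau `|u|)%:R))); last first.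
  move=> u _; case: eqP => _; first by rewrite mulr0 addr0.
  by rewrite natr_divisor_bound add0r; field; apply: lt0r_neq0.
rewrite big_split /= mulrDr lerD //.
  apply: le_trans HA; case: ifPn => zA.
    rewrite (bigD1_seq 0) ?fset_uniq //= big1 ?addr0 ?mulr1 // => u /negPf ->.
    by [].
  rewrite big_seq big1 ?mulr0 // => u uA; rewrite (_ : u == 0 = false) //.
  by apply: contraNF zA => /eqP <-.
rewrite -mulr_sumr mulrCA.
rewrite [leRHS](_ : _ = 2 * n.+1%:R * 2 ^+ n.+1 / H%:R * ln H%:R `^ C); last by ring.
by rewrite ler_wpM2l // divr_ge0 // mulr_ge0.
Qed.

(** * Dependent coefficients *)

Section DependentCoefficients.
Variables (R : realType) (n L : nat) (Q : forall i : 'I_n.+1, mpoly.mpoly i.+1 R).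
Hypothesis n0 : (0 < n)%N.
Hypothesis QL : forall i : 'I_n.+1, (0 < i)%N -> (total_degree (Q i) <= L)%N.
Hypothesis Qdeg : forall i : 'I_n.+1, (0 < i)%N -> forall c : int, c != 0 ->
  (0 < degree_in ord_max (subst_const ord0 c%:~R (Q i)))%N.
Implicit Types (i j k l : 'I_n.+1) (y : 'I_n.+1 -> R) (a : 'I_n.+1 -> int).

(** [eval_step] with real values in place of the earlier coefficients, so that a partial vector can
    be completed by arbitrary reals. *)
Definition step i y (t : R) : R :=
  mpoly.meval (fun k : 'I_i.+1 => if k == ord_max then t else y (widen_ord (ltn_ord i) k)) (Q i).

Lemma step_ext i y y' t : (forall l, (l < i)%N -> y l = y' l) -> step i y t = step i y' t.
Proof.
move=> yy'; apply: mpoly.meval_eq => k; case: eqP => // /eqP kmax; apply: yy' => /=.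
by rewrite ltn_neqAle -ltnS ltn_ord andbT; apply: contraNneq kmax => e; apply/eqP/val_inj.
Qed.

Lemma step_poly_last i y : (0 < i)%N ->
  exists q : {poly R}, (size q <= L.+1)%N /\ forall t, q.[t] = step i y t.
Proof.
move=> i0; have [q [sq qE]] := PolynomialMaps.line_restriction (Q i) ord_max
  (fun s => y (widen_ord (ltn_ord i) s)).
by exists q; split=> [|t]; [apply: leq_trans sq _; apply: QL|rewrite qE].
Qed.

Lemma step_poly_var i l y t : (0 < i)%N -> (l < i)%N ->
  exists q : {poly R}, (size q <= L.+1)%N /\
    forall z, q.[z] = step i (fun j => if j == l then z else y j) t.
Proof.
move=> i0 li; have li' : (l < i.+1)%N by apply: leqW.
have [q [sq qE]] := PolynomialMaps.line_restriction (Q i) (Ordinal li')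
  (fun s => if s == ord_max then t else y (widen_ord (ltn_ord i) s)).
exists q; split=> [|z]; first by apply: leq_trans sq _; apply: QL.
rewrite qE; apply: mpoly.meval_eq => s.
have [->|kl] := eqVneq s (Ordinal li'); last first.
  by case: eqP => // _; rewrite -val_eqE /= -val_eqE /= in kl *; rewrite (negPf kl).
by rewrite -val_eqE /= ltn_eqF // -val_eqE /= eqxx.
Qed.

Definition nonconstant i y := exists t t', step i y t <> step i y t'.

Lemma nonconstant_ext i y y' : (forall l, (l < i)%N -> y l = y' l) ->
  nonconstant i y -> nonconstant i y'.
Proof.
by move=> yy' [t [t' h]]; exists t, t'; rewrite -!(step_ext _ yy').
Qed.

Lemma exists_nonconstant i (c : int) : (0 < i)%N -> c != 0 ->
  exists y, y ord0 = c%:~R /\ nonconstant i y.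
Proof.
move=> i0 c0; have [v [t [t' tt']]] := PolynomialMaps.exists_nonconstant (Qdeg i0 c0).
pose y l : R := if l == ord0 then c%:~R else if insub (nat_of_ord l) is Some s then v s else 0.
exists y; split; first by rewrite /y eqxx.
exists t, t'; apply/eqP; move: tt'; rewrite !PolynomialMaps.meval_subst.
have E u : mpoly.meval (fun j : 'I_i.+1 => if j == ord0 then c%:~R else
    PolynomialMaps.extend v u j) (Q i) = step i y u.
  apply: mpoly.meval_eq => s; case: (unliftP ord_max s) => [s'|] ->.
    rewrite [_ == ord_max]eq_sym (negPf (neq_lift _ _)) /y -!val_eqE /=.
    rewrite (_ : bump i s' = s') ?valK /PolynomialMaps.extend ?liftK //.
    by rewrite /bump leqNgt ltn_ord.
  by rewrite eqxx PolynomialMaps.extend_max -val_eqE /= gtn_eqF.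
by rewrite !E.
Qed.

(** The draws are [x ord0 = a_0] and [x i = t_i]. This is a relation because for an arbitrary [x]
    the polynomials need not take integer values. *)
Definition compat (x : 'I_n.+1 -> R) a :=
  (a ord0)%:~R = x ord0 /\ forall i, (0 < i)%N -> (a i)%:~R = step i (fun l => (a l)%:~R) (x i).

Lemma compat_agree x x' a a' j : compat x a -> compat x' a' ->
  (forall l, (l < j)%N -> x l = x' l) -> (forall l, (l < j)%N -> a l = a' l).
Proof.
move=> [a0 aS] [a'0 a'S] xx' l; move: {2}(nat_of_ord l) (erefl (nat_of_ord l)) => m.
elim/ltn_ind: m l => m IH l lm lj; apply: (@intr_inj R).
have [l0|l0] := posnP l.
  have -> : l = ord0 by apply: val_inj.
  by rewrite a0 a'0 xx' //; rewrite l0 in lj.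
rewrite aS // a'S // xx' //; apply: step_ext => l' l'l; congr _%:~R.
by apply: (IH l') => //; [rewrite -lm|apply: ltn_trans lj].
Qed.

Section Fibre.
Variables (F : {fset R}) (j : 'I_n.+1) (mu : R -> R) (m : R) (M : nat).
Hypotheses (j0 : (0 < j)%N) (m0 : 0 <= m) (mum : forall u, mu u <= m).
Variables (core : ('I_n.+1 -> int) -> Prop) (x : {ffun 'I_n.+1 -> F}).
Hypothesis core_nonconstant : forall a, core a -> nonconstant j (fun l => (a l)%:~R).
Hypothesis core_finite : forall a0, (a0 ord0)%:~R = val (x ord0) ->
  exists Z : seq R, (size Z <= M)%N /\
    forall a, (forall l, (l < j)%N -> a l = a0 l) -> core a -> (a j)%:~R \in Z.

(** The coefficients below [j] do not change with the draw of index [j]. The event confines [a_j] to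
    at most [M] values, and the nonconstant polynomial [Q j], of degree at most [L] in its last
    variable, takes each of them at no more than [L] draws. *)
Lemma fibre_bound :
  \sum_(v : F | `[< exists a, compat (fun l => val (ffupd x j v l)) a /\ core a >])
    mu (val v) <= (M * L)%:R * m.
Proof.
have [[v0 [a0 [ca0 core0]]]|none] := pselect (exists v : F, exists a,
    compat (fun l => val (ffupd x j v l)) a /\ core a); last first.
  by rewrite big1 ?mulr_ge0 // => v /asboolP h; case: none; exists v.
have [q [sq qE]] := step_poly_last (fun l => (a0 l)%:~R) j0.
have [t [t' tt']] := core_nonconstant core0.
have qz z : q - z%:P != 0.
  apply/eqP => qz; apply: tt'; rewrite -!qE.
  by rewrite (_ : q = z%:P) ?hornerC //; apply/eqP; rewrite -subr_eq0 qz.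
have sqz z : (size (q - z%:P)%R <= L.+1)%N.
  by rewrite (leq_trans (size_polyD _ _)) // geq_max sq size_polyN (leq_trans (size_polyC_leq1 _)).
have /choice[rt rtP] : forall z, exists s : seq R, (size s <= L)%N /\
    forall v, root (q - z%:P) v -> v \in s.
  move=> z; have [s [ss sP]] := roots_seq (qz z); exists s; split=> //.
  by rewrite -ltnS (leq_trans ss).
have a00 : (a0 ord0)%:~R = val (x ord0).
  by case: ca0 => -> _; rewrite ffunE; case: eqP => // e; move: j0; rewrite -e.
have [Z [sZ ZP]] := core_finite a00.
apply: (@le_trans _ _ ((size (flatten [seq rt z | z <- Z]))%:R * m)); last first.
  rewrite ler_wpM2r // ler_nat size_flatten /shape -map_comp sumnE big_map.
  apply: (@leq_trans (\sum_(z <- Z) L)); first by apply: leq_sum => z _; apply: (rtP z).1.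
  by rewrite big_const_seq iter_addn_0 count_predT mulnC leq_mul2r sZ orbT.
apply: (sum_seq_le m0 _ mum) => v /asboolP[a [ca corea]].
have aa0 l : (l < j)%N -> a l = a0 l.
  apply: (compat_agree ca ca0) => l' l'j; rewrite !ffunE.
  by case: eqP => // e; rewrite e ltnn in l'j.
have aj := ZP a aa0 corea.
apply/flatten_mapP; exists (a j)%:~R => //; apply: (rtP _).2.
rewrite /root !hornerE subr_eq0 qE (proj2 ca j j0) ffunE eqxx; apply/eqP.
by apply: step_ext => l lj; rewrite aa0.
Qed.
End Fibre.

(* The values [a_l] with [l < k] can still be completed so that [Q_i] is nonconstant
   in its last variable; [degenerate] is the event that fixing [a_k] destroys this. *)
Definition extends_nonconstant i (k : nat) a :=
  exists y, (forall l, (l < k)%N -> y l = (a l)%:~R) /\ nonconstant i y.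

Definition degenerate i k a := [/\ extends_nonconstant i k a, ~ extends_nonconstant i k.+1 a &
  nonconstant k (fun l => (a l)%:~R)].

(** Let [y] complete the values below [k] so that [Q i] separates [t] from [t']. As a function of
    [y k], the difference of the two values is a nonzero polynomial of degree at most [L]; unless
    [a_k] is one of its roots, [y] with [a_k] inserted is still a completion. *)
Lemma degenerate_finite i k (a0 : 'I_n.+1 -> int) : (0 < k < i)%N ->
  exists Z : seq R, (size Z <= L)%N /\
    forall a, (forall l, (l < k)%N -> a l = a0 l) -> degenerate i k a -> (a k)%:~R \in Z.
Proof.
move=> /andP[k0 ki]; have i0 : (0 < i)%N by apply: ltn_trans ki.
have [[y [ya [t [t' tt']]]]|none] := pselect (extends_nonconstant i k a0); last first.
  exists [::]; split=> // a aa0 [[y [ya ync]] _ _]; case: none; exists y; split=> // l lk.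
  by rewrite ya // aa0.
have [q [sq qE]] := step_poly_var y t i0 ki.
have [q' [sq' q'E]] := step_poly_var y t' i0 ki.
have p0 : q - q' != 0.
  apply/eqP => p0; apply: tt'; have := congr1 (horner^~ (y k)) p0.
  rewrite !hornerE qE q'E (_ : (fun j => if j == k then y k else y j) = y); last first.
    by apply/funext => j; case: eqP => // ->.
  by move/eqP; rewrite subr_eq0 => /eqP.
have [s [ss sP]] := roots_seq p0; exists s; split.
  rewrite -ltnS (leq_trans ss) // (leq_trans (size_polyD _ _)) // size_polyN geq_max.
  by rewrite sq.
move=> a aa0 [_ nex _]; apply: sP; rewrite /root !hornerE subr_eq0 qE q'E; apply/eqP.
apply: contrapT => h; apply: nex.
exists (fun j => if j == k then (a k)%:~R else y j); split; last by exists t, t'.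
move=> l; rewrite ltnS leq_eqVlt => /orP[/eqP lk|lk].
  by rewrite (val_inj lk : l = k) eqxx.
by case: eqP => [->//|_]; rewrite ya // aa0.
Qed.

(** Take the least [i > 0] for which [Q i] is constant at [a]. A completion exists when only [a_0]
    is fixed and none when all values below [i] are, so some [a_k] in between destroys it;
    minimality of [i] makes [Q k] nonconstant. *)
Lemma degenerate_or_nonconstant a : a ord0 != 0 ->
  nonconstant ord_max (fun l => (a l)%:~R) \/ exists i k, (0 < k < i)%N /\ degenerate i k a.
Proof.
move=> a0; have [nc|nnc] := pselect (nonconstant ord_max (fun l => (a l)%:~R)); first by left.
right; have [i [i0 inc imin]] : exists i, [/\ (0 < i)%N, ~ nonconstant i (fun l => (a l)%:~R) &
    forall k, (0 < k < i)%N -> nonconstant k (fun l => (a l)%:~R)].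
  pose B := fun i => (0 < i)%N && ~~ `[< nonconstant i (fun l => (a l)%:~R) >].
  have Bmax : B ord_max by rewrite /B /= n0; apply/asboolPn.
  case: (@arg_minnP _ ord_max B (fun i => nat_of_ord i) Bmax) => i /andP[i0 /asboolPn inc] imin.
  exists i; split=> // k /andP[k0 ki]; apply: contrapT => knc.
  have Bk : B k by rewrite /B k0; apply/asboolPn.
  by have := imin k Bk; rewrite leqNgt ki.
have ext1 : extends_nonconstant i 1 a.
  have [y [y0 ync]] := exists_nonconstant i0 a0; exists y; split=> // l l1.
  by rewrite (_ : l = ord0) ?y0 //; apply: val_inj; move: l1 => /=; case: (nat_of_ord l).
have next : ~ extends_nonconstant i i a.
  move=> [y [ya ync]]; apply: inc; apply: nonconstant_ext ync => l li.
  by rewrite ya.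
apply: contrapT => h; apply: next.
suff H m : (m.+1 <= i)%N -> extends_nonconstant i m.+1 a.
  by rewrite -(prednK i0); apply: H; rewrite prednK.
elim: m => [//|m IH] mi; apply: contrapT => nx; apply: h.
have mn : (m.+1 < n.+1)%N by apply: ltn_trans (ltn_ord i).
exists i, (Ordinal mn); split=> //; split=> //; first by apply: IH; apply: ltnW.
exact: imin.
Qed.

End DependentCoefficients.

Lemma sum_pred_le (R : realFieldType) (J : finType) (w : J -> R) (A : pred J) (g : J -> R) :
  (forall x, 0 <= w x) -> (forall x, (A x)%:R <= g x) ->
  \sum_(x | A x) w x <= \sum_x w x * g x.
Proof.
move=> w0 Ag; rewrite big_mkcond /=; apply: ler_sum => x _.
apply: le_trans (ler_wpM2l (w0 x) (Ag x)).
by case: (A x); rewrite ?mulr1 ?mulr0.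
Qed.

Lemma sum_prodmass_pred (R : realFieldType) (J : finType) (w : J -> R) (A : pred J) :
  \sum_x w x * (A x)%:R = \sum_(x | A x) w x.
Proof.
rewrite [RHS]big_mkcond /=; apply: eq_bigr => x _.
by case: (A x); rewrite ?mulr1 ?mulr0.
Qed.

Section DependentProbability.
Context (R : realType) (disp : measure_display) (T : measurableType disp)
  (Pr : probability T R) (n L : nat) (Q : forall i : 'I_n.+1, mpoly.mpoly i.+1 R)
  (a : 'I_n.+1 -> {RV Pr >-> int}) (X : 'I_n.+1 -> T -> R).
Hypothesis n0 : (0 < n)%N.
Hypothesis QL : forall i : 'I_n.+1, (0 < i)%N -> (total_degree (Q i) <= L)%N.
Hypothesis Qdeg : forall i : 'I_n.+1, (0 < i)%N -> forall c : int, c != 0 ->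
  (0 < degree_in ord_max (subst_const ord0 c%:~R (Q i)))%N.
Hypothesis mX : forall i, measurable_fun setT (X i).
Hypothesis indep : mutually_independent Pr X.
Hypothesis X0 : forall w, X ord0 w = (a ord0 w)%:~R.
Hypothesis aQ : forall i : 'I_n.+1, (0 < i)%N ->
  {ae Pr, forall w, (a i w)%:~R = eval_step (Q i) (fun j => a j w) (X i w)}.

Let pm j u : R := fine (Pr (X j @^-1` [set u])).

(** [Num.floor] recovers the integer [a_0] from its real copy; [L] counts the draws that can produce
    one value of the last coefficient. *)
Definition dependent_weight (m v : R) : R :=
  if v == 0 then 1 else (divisor_bound n (Num.floor v) * L)%:R * m.

Lemma prob_irreducible_dependent (F : {fset R}) (m : R) : 0 <= m ->
  (forall j : 'I_n.+1, \sum_(v : F) pm j (val v) = 1) ->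
  (forall j : 'I_n.+1, (0 < j)%N -> forall u, pm j u <= m) ->
  ((1 - \sum_(v : F) pm ord0 (val v) * dependent_weight m (val v)
     - (n.+1 ^ 2 * L ^ 2)%:R * m)%:E
   <= Pr [set w : T | irreducible_overZ (monic_poly_of (fun j => a j w))])%E.
Proof.
move=> m0 pm1 pmm.
have mset1 (u : R) : measurable [set u] by exact: measurable_set1.
pose xv (x : {ffun 'I_n.+1 -> F}) i := val (x i).
pose bad (x : {ffun 'I_n.+1 -> F}) : bool :=
  `[< exists b, compat Q (xv x) b /\ ~ irreducible_overZ (monic_poly_of b) >].
pose N := [set w | ~ forall i : 'I_n.+1, (0 < i)%N ->
  (a i w)%:~R = eval_step (Q i) (fun j => a j w) (X i w)].
have N0 : Pr.-negligible N.
  have : {ae Pr, forall w, forall i : 'I_n.+1, (0 < i)%N ->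
      (a i w)%:~R = eval_step (Q i) (fun j => a j w) (X i w)}.
    apply: filter_forall => i; have [i0|i0] := boolP (0 < i)%N; last exact: nearW.
    by apply: filterS (aQ i0).
  by [].
apply: le_trans (@probability_ge_good _ _ T R R Pr _ _ indep mX mset1 F bad _ N pm1 _ N0 _);
  first last.
- move=> x w /asboolPn nb Xw; rewrite /N /= notK => aw.
  apply: contrapT => red; apply: nb; exists (fun j => a j w); split=> //; split.
    by rewrite /xv -Xw X0.
  by move=> i i0; rewrite aw // Xw.
- exact: (@measurable_countable_event _ T _ (fun j => a j : T -> int)
    (fun x => irreducible_overZ (monic_poly_of x))).
rewrite lee_fin -addrA -opprD lerD2l lerN2.
have pm_ge0 j u : 0 <= pm j u by apply: fine_ge0.
have pmv_ge0 (j : 'I_n.+1) (v : F) : 0 <= pm j (val v) by apply: pm_ge0.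
set w := prodmass _; have w0 x : 0 <= w x by apply: prodmass_ge0.
pose E (i k : 'I_n.+1) (x : {ffun 'I_n.+1 -> F}) : bool := (0 < k < i)%N &&
  `[< exists b, compat Q (xv x) b /\ degenerate Q i k b >].
pose core_max (b : 'I_n.+1 -> int) := [/\ b ord0 != 0,
   nonconstant Q ord_max (fun l => (b l)%:~R) & ~ irreducible_overZ (monic_poly_of b)].
pose G (x : {ffun 'I_n.+1 -> F}) : bool := `[< exists b, compat Q (xv x) b /\ core_max b >].
pose Z (x : {ffun 'I_n.+1 -> F}) : bool := xv x ord0 == 0.
apply: (@le_trans _ _ (\sum_x w x * ((Z x)%:R + (G x)%:R + \sum_i \sum_k (E i k x)%:R))).
  apply: sum_pred_le => // x; case bx : (bad x);
      last by rewrite !addr_ge0 // sumr_ge0 // => i _; apply: sumr_ge0.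
  have /asboolP[b [cb rb]] := bx.
  have [b0|b0] := eqVneq (b ord0) 0.
    have -> : Z x by rewrite /Z -(proj1 cb) b0.
    by rewrite -addrA lerDl addr_ge0 // sumr_ge0 // => i _; apply: sumr_ge0.
  have [nc|[i [k [ki deg]]]] := degenerate_or_nonconstant n0 Qdeg b0.
    have -> : G x by apply/asboolP; exists b.
    by rewrite -addrA addrCA lerDl addr_ge0 // sumr_ge0 // => i _; apply: sumr_ge0.
  have Eik : E i k x by rewrite /E ki; apply/asboolP; exists b.
  rewrite (bigD1 i) //= (bigD1 k) //= Eik.
  rewrite addrCA -addrA lerDl !addr_ge0 // sumr_ge0 // => j _; last exact: sumr_ge0.
have -> : \sum_x w x * ((Z x)%:R + (G x)%:R + \sum_i \sum_k (E i k x)%:R) =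
    \sum_x w x * (Z x)%:R + \sum_x w x * (G x)%:R + \sum_i \sum_k \sum_x w x * (E i k x)%:R.
  under eq_bigr do rewrite 2!mulrDr; rewrite 2!big_split /=; congr (_ + _).
  under eq_bigr do rewrite mulr_sumr; rewrite exchange_big /=; apply: eq_bigr => i _.
  by under eq_bigr do rewrite mulr_sumr; rewrite exchange_big.
(* At most [L] values of [a_k] are degenerate, each reached by at most [L] draws; the pairs [(i, k)]
   are counted crudely. *)
have L1 : \sum_i \sum_k \sum_x w x * (E i k x)%:R <= (n.+1 ^ 2 * L ^ 2)%:R * m.
  apply: (@le_trans _ _ (\sum_(i < n.+1) \sum_(k < n.+1) (L * L)%:R * m)).
    apply: ler_sum => i _; apply: ler_sum => k _; rewrite sum_prodmass_pred.
    rewrite -[leRHS](sum_prodmass_const pm1).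
    apply: (@sum_prodmass_fibre _ _ _ _ pmv_ge0 pm1 k (E i k) (fun=> (L * L)%:R * m)) => x.
    have [ki|nki] := boolP (0 < k < i)%N; last first.
      by rewrite big1 ?mulr_ge0 // => v; rewrite /E (negPf nki).
    rewrite (eq_bigl (fun v => `[< exists b, compat Q (fun l =>
        val (ffupd x k v l)) b /\ degenerate Q i k b >])); last first.
      by move=> v; rewrite /E ki.
    apply: fibre_bound => //; [by case/andP: ki|by move=> u; apply: pmm; case/andP: ki| |].
      by move=> b [].
    by move=> b _; apply: degenerate_finite.
  by rewrite !sumr_const card_ord -mulrnA -[leLHS]mulr_natl mulrA -natrM -!mulnn.
rewrite lerD //.
rewrite -(sum_prodmass_coord pm1 ord0 (fun v : F => dependent_weight m (val v))) -/w.
pose beta (x : {ffun 'I_n.+1 -> F}) := if Z x then 0 else dependent_weight m (xv x ord0).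
have LG : \sum_x w x * (G x)%:R <= \sum_x w x * beta x.
  rewrite sum_prodmass_pred; apply: (@sum_prodmass_fibre _ _ _ _ pmv_ge0 pm1 ord_max G beta) => x.
  have x0u v : xv (ffupd x ord_max v) ord0 = xv x ord0.
    by rewrite /xv ffunE -val_eqE /= ltn_eqF.
  rewrite /beta; case: ifPn => [/eqP Zx|Zx].
    rewrite big1 // => v /asboolP[b [cb [b0 _ _]]].
    have := proj1 cb; rewrite x0u Zx => /eqP; rewrite intr_eq0 => /eqP b00.
    by rewrite b00 eqxx in b0.
  rewrite /dependent_weight -/(Z x) (negPf Zx).
  apply: (@fibre_bound R n L Q QL F ord_max (pm ord_max) m _ n0 m0 _ core_max x).
  - by move=> u; apply: pmm.
  - by move=> b [].
  move=> a0 a0x; have a00 : a0 ord0 != 0.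
    by apply: contraNneq Zx => a00; rewrite /Z /xv -a0x a00.
  have [s [ss sP]] := reducible_last_coef n0 a00.
  exists [seq u%:~R | u <- s]; split; first by rewrite size_map /xv -a0x intrKfloor.
  move=> b ba0 [_ _ rb]; apply: map_f; apply: sP => // i im; apply: ba0.
  by rewrite /= ltn_neqAle -ltnS ltn_ord andbT; apply: contraNneq im => e; apply/eqP/val_inj.
apply: (le_trans (lerD (lexx _) LG)); rewrite -big_split /=; apply: ler_sum => x _.
rewrite -mulrDr ler_wpM2l // /beta; case: ifPn => Zx; last by rewrite add0r.
by rewrite addr0 /dependent_weight /xv -/(xv x ord0) (eqP Zx) eqxx.
Qed.
End DependentProbability.

Lemma dependent_irreducible (R : realType) (P : {poly int}) : P != 0 ->
      exists C : R,
      forall (d : nat) (d_gt0 : (0 < d)%N) (H : nat) (H_ge3 : (3 <= H)%N)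
        (L : nat) (L_gt0 : (0 < L)%N)
        (disp : measure_display) (T : measurableType disp)
        (Pr : probability T R) (a : 'I_d -> {RV Pr >-> int})
        (t : 'I_d -> {RV Pr >-> R}) (S : 'I_d -> {fset R})
        (Q : forall i : 'I_d, mpoly.mpoly i.+1 R),
      (forall i : 'I_d, i = 0%N :> nat -> uniform_on (a i) (poly_values P H)) ->
      (forall i : 'I_d, (0 < i)%N -> #|` S i| = H /\ uniform_on (t i) (S i)) ->
      mutually_independent Pr
        (fun (i : 'I_d) (w : T) =>
           if i == 0%N :> nat then (a i w)%:~R : R else t i w) ->
      (forall i : 'I_d, (0 < i)%N -> (total_degree (Q i) <= L)%N) ->
      (forall i : 'I_d, (0 < i)%N -> forall c : int, c != 0 ->
         (0 < degree_in ord_max (subst_const ord0 c%:~R (Q i)))%N) ->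
      (forall i : 'I_d, (0 < i)%N ->
         {ae Pr, forall w : T,
            (a i w)%:~R = eval_step (Q i) (fun j => a j w) (t i w)}) ->
      ((1 - (size P).-1%:R / (2 * H + 1)%:R
          - 2 * d%:R ^+ 2 * (2 * L%:R) ^+ d * ((ln (H%:R : R)) `^ C) / H%:R)%:E
        <= Pr [set w : T |
                irreducible_overZ (monic_poly_of (fun j => a j w))])%E.
Proof.
(* The degeneracy term carries no logarithm. A nonnegative exponent makes the power of [ln H] at
   least 1, so that it can be inserted there. *)
move=> P0; have [C0 CP] := poly_values_mass R P0; exists (Num.max C0 0).
case=> // -[|n'] _ H H3 L L0 disp T Pr a t S Q a0U tU indep QL Qdeg aQ.
  rewrite [X in Pr X](_ : _ = setT); last first.
    by apply/seteqP; split => // w _; apply: irreducible_deg1.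
  rewrite probability_setT lee_fin -addrA -opprD lerBlDr lerDl.
  by rewrite addr_ge0 // divr_ge0 // mulr_ge0 // ?powR_ge0 // mulr_ge0 // exprn_ge0 // mulr_ge0.
have n0 : (0 < n'.+1)%N by [].
move: n'.+1 n0 a t S Q a0U tU indep QL Qdeg aQ => n n0 a t S Q a0U tU indep QL Qdeg aQ.
have [HA HB] := CP H H3; set A := poly_values P H in a0U HA HB.
set X := (fun (i : 'I_n.+1) (w : T) => _) in indep.
have mX i : measurable_fun setT (X i).
  rewrite /X; case: eqP => _ //; move=> _ B mB; rewrite setTI.
  rewrite (_ : _ @^-1` B = a i @^-1` [set u | B u%:~R]) //.
  by rewrite -[Y in measurable Y]setTI; apply: (@measurable_funPT _ _ _ _ (a i)).
have XE (i : 'I_n.+1) : (0 < i)%N -> X i = t i :> (T -> R).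
  by move=> i0; apply/funext => w; rewrite /X gtn_eqF.
have X0 w : X ord0 w = (a ord0 w)%:~R by [].
pose A' : {fset R} := [fset u%:~R | u in A]%fset.
have injR : injective (fun u : int => u%:~R : R) := @intr_inj R.
pose S' (j : 'I_n.+1) := if j == ord0 then A' else S j.
pose F := (\bigcup_(j <- enum 'I_n.+1) S' j)%fset.
have SF j : (S' j `<=` F)%fset by apply: bigfcup_sup; rewrite ?mem_enum.
have cardA' : #|` A'| = #|` A| by rewrite card_imfset.
have jpos (j : 'I_n.+1) : j != ord0 -> (0 < j)%N.
  by rewrite lt0n; apply: contraNneq => j0; apply/eqP/val_inj.
have S'U j : S' j != fset0 /\ forall u, u \in S' j ->
    Pr (X j @^-1` [set u]) = ((#|` S' j|%:R : R)^-1)%:E.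
  have [->|j0] := eqVneq j ord0.
    rewrite /S' eqxx; have [A0 AU] := a0U ord0 erefl; split.
      by rewrite -cardfs_gt0 cardA' cardfs_gt0.
    move=> _ /imfsetP[u /= uA ->]; rewrite cardA' -(AU u uA) /distribution /pushforward.
    congr (Pr _); apply/seteqP; split => w /=; first by rewrite X0 => /injR.
    by rewrite X0 => ->.
  by rewrite /S' (negPf j0) XE ?jpos //; have [] := tU j (jpos j j0).
have mset1 (u : R) : measurable [set u] by exact: measurable_set1.
have pmE j := uniform_point_mass mset1 (mX j) (proj1 (S'U j)) (proj2 (S'U j)).
have H0 : 0 < H%:R :> R by rewrite ltr0n; lia.
have aQ' (i : 'I_n.+1) : (0 < i)%N ->
  {ae Pr, forall w, (a i w)%:~R = eval_step (Q i) (fun j => a j w) (X i w)}.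
  by move=> i0; rewrite (XE i i0); apply: aQ.
apply: le_trans (@prob_irreducible_dependent R disp T Pr n L Q a X n0 QL Qdeg mX indep X0 aQ'
   F (H%:R)^-1 _ _ _); first last.
- move=> j j0 u; rewrite pmE; have [SH _] := tU j j0.
  have -> : S' j = S j by rewrite /S' -val_eqE /= gtn_eqF.
  by rewrite SH; case: ifP => // _; rewrite invr_ge0 ltW.
- move=> j; rewrite -[RHS](sum_uniform1 R (SF j) (proj1 (S'U j))).
  by apply: eq_bigr => v _; rewrite pmE.
- by rewrite invr_ge0 ltW.
rewrite lee_fin -!addrA -!opprD lerD2l lerN2.
under eq_bigr do rewrite pmE.
rewrite (sum_uniform (dependent_weight n L (H%:R)^-1) (SF ord0)).
have -> : S' ord0 = A' by rewrite /S' eqxx.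
rewrite cardA' big_imfset /=; last by move=> x y _ _; apply: injR.
pose lC := ln (H%:R : R) `^ Num.max C0 0.
have lH := ln_gt1 R H3.
have lC1 : 1 <= lC.
  by rewrite -(powRr0 (ln (H%:R : R))) ler_powR ?le_max ?lexx ?orbT // ltW.
have {}HB : (#|` A|%:R)^-1 * \sum_(u <- A) (if u == 0 then 0 else (tau `|u|)%:R) <= lC.
  by apply: (le_trans HB); rewrite ler_powR ?le_max ?lexx // ltW.
rewrite (eq_bigr (fun u => (u == 0)%:R + (2 * n.+1%:R * 2 ^+ n.+1 * L%:R / H%:R) *
   (if u == 0 then 0 else (tau `|u|)%:R))); last first.
  move=> u _; rewrite /dependent_weight intr_eq0; case: eqP => _; first by rewrite mulr0 addr0.
  rewrite intrKfloor natrM natr_divisor_bound add0r; field; exact: lt0r_neq0.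
rewrite big_split /= mulrDr -addrA lerD //.
  apply: le_trans HA; case: ifPn => zA.
    by rewrite (bigD1_seq 0) ?fset_uniq //= big1 ?addr0 ?mulr1 // => u /negPf ->.
  rewrite big_seq big1 ?mulr0 // => u uA; rewrite (_ : u == 0 = false) //.
  by apply: contraNF zA => /eqP <-.
rewrite -mulr_sumr mulrCA -/lC.
apply: (@le_trans _ _ (2 * n.+1%:R * 2 ^+ n.+1 * L%:R / H%:R * lC + (n.+1 ^ 2 * L ^ 2)%:R /
    H%:R * lC)).
  apply: lerD; first by rewrite ler_wpM2l // divr_ge0 // mulr_ge0.
  by rewrite ler_peMr // divr_ge0.
have -> : 2 * n.+1%:R * 2 ^+ n.+1 * L%:R / H%:R * lC + (n.+1 ^ 2 * L ^ 2)%:R / H%:R * lC =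
    (2 * n.+1 * 2 ^ n.+1 * L + n.+1 ^ 2 * L ^ 2)%N%:R * (lC / H%:R).
  by rewrite !(natrD, natrM, natrX); field; exact: lt0r_neq0.
have -> : 2 * n.+1%:R ^+ 2 * (2 * L%:R) ^+ n.+1 * lC / H%:R =
    (2 * n.+1 ^ 2 * (2 * L) ^ n.+1)%N%:R * (lC / H%:R).
  by rewrite !(natrD, natrM, natrX); field; exact: lt0r_neq0.
rewrite ler_wpM2r ?divr_ge0 ?powR_ge0 // ler_nat.
(* With [d = n + 1 >= 2], both [2 * d * 2 ^ d * L] and [d ^ 2 * L ^ 2] are at most
   [d ^ 2 * (2 * L) ^ d]; their sum explains the leading 2. *)
have e1 : (2 ^ n.+1 * L <= (2 * L) ^ n.+1)%N.
  by rewrite expnMn leq_mul2l -{1}(expn1 L) leq_pexp2l ?orbT.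
have e2 : (L ^ 2 <= (2 * L) ^ n.+1)%N.
  apply: (@leq_trans (L ^ n.+1)); first by rewrite leq_pexp2l.
  by rewrite leq_exp2r // leq_pmull.
have e3 : (2 * n.+1 <= n.+1 ^ 2)%N by rewrite -mulnn leq_mul2r.
have -> : (2 * n.+1 * 2 ^ n.+1 * L = (2 * n.+1) * (2 ^ n.+1 * L))%N by rewrite !mulnA.
have -> : (2 * n.+1 ^ 2 * (2 * L) ^ n.+1 = n.+1 ^ 2 * (2 * L) ^ n.+1 + n.+1 ^ 2 * (2 * L) ^ n.+1)%N.
  by rewrite -mulnA mul2n addnn.
by rewrite leq_add // leq_mul.
Qed.

(** * Binomial coefficients *)

Section BinomialPmf.
Variable R : realType.
Implicit Types (H k N : nat) (p : R).

Lemma binomial_pmfE H p k :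
  binomial_pmf H p k = 'C(H, k)%:R * (p ^+ k * (1 - p) ^+ (H - k)).
Proof. by rewrite /binomial_pmf -[LHS]mulr_natl. Qed.

Lemma binomial_pmf_small H p k : (H < k)%N -> binomial_pmf H p k = 0.
Proof. by move=> Hk; rewrite binomial_pmfE bin_small // mul0r. Qed.

Lemma binomial_pmf_sym H p k : (k <= H)%N ->
  binomial_pmf H p k = binomial_pmf H (1 - p) (H - k).
Proof.
by move=> kH; rewrite !binomial_pmfE bin_sub // subKn // subKr [_ ^+ k * _]mulrC.
Qed.

Lemma sum_binomial_pmf H p : \sum_(0 <= k < H.+1) binomial_pmf H p k = 1.
Proof.
rewrite big_mkord -[RHS](expr1n _ H) -[X in X ^+ _](subrK p) exprDn.
apply: eq_bigr => i _.
by rewrite binomial_pmfE mulrC mulr_natr [_ ^+ i * _]mulrC.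
Qed.

Lemma sum_binomial_pmf_le1 H p N : 0 <= p <= 1 ->
  \sum_(0 <= k < N) binomial_pmf H p k <= 1.
Proof.
move=> p01; rewrite -(sum_binomial_pmf H p).
have b0 k : 0 <= binomial_pmf H p k by apply: binomial_pmf_ge0.
have [NH|HN] := leqP N H.+1.
  by rewrite [leRHS](big_cat_nat _ NH) //= lerDl sumr_ge0.
rewrite (big_cat_nat _ (ltnW HN)) //= gerDl big_nat big1 // => k /andP[Hk _].
exact: binomial_pmf_small.
Qed.

Lemma mean_binomial_pmf H p : \sum_(0 <= k < H.+1) k%:R * binomial_pmf H p k = H%:R * p.
Proof.
case: H => [|H]; first by rewrite big_nat1 !mul0r.
rewrite big_nat_recl // mul0r add0r -[RHS]mulr1 -[X in _ = _ * X](sum_binomial_pmf H p) mulr_sumr.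
rewrite !big_mkord; apply: eq_bigr => k _.
rewrite !binomial_pmfE subSS exprS.
have : (H.+1 * 'C(H, k) = k.+1 * 'C(H.+1, k.+1))%N by rewrite -mul_bin_diag.
move/(congr1 (fun m : nat => m%:R : R)); rewrite !natrM => E.
rewrite [LHS]mulrA. rewrite -E; move: (_ ^+ (H - k)) ('C(H, k)%:R) (H.+1%:R) (p ^+ k) => u c h v.
by ring.
Qed.

Lemma binomial_pmf_step H p k : (k <= H)%N ->
  binomial_pmf H p k.+1 * (k.+1%:R * (1 - p)) = binomial_pmf H p k * ((H - k)%:R * p).
Proof.
move=> kH; have [kH'|Hk] := ltnP k H; last first.
  have -> : k = H by apply/eqP; rewrite eqn_leq kH.
  by rewrite binomial_pmf_small // subnn !mul0r mulr0.
rewrite !binomial_pmfE.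
have -> : (H - k = (H - k.+1).+1)%N by lia.
rewrite !exprS.
have : (k.+1 * 'C(H, k.+1) = (H - k) * 'C(H, k))%N by rewrite mul_bin_left.
have -> : (H - k = (H - k.+1).+1)%N by lia.
move/(congr1 (fun m : nat => m%:R : R)); rewrite !natrM => E.
move: E; move: (_ ^+ (H - k.+1)) ('C(H, k)%:R) ('C(H, k.+1)%:R) (p ^+ k) => u c c' v.
move: (k.+1%:R : R) ((H - k.+1).+1%:R : R) => x y E.
transitivity (p * v * u * (1 - p) * (x * c')); first by ring.
by rewrite E; ring.
Qed.

(** The ratio of consecutive masses is [(H - j) * p / ((j + 1) * (1 - p))], and denominator minus
    numerator is [j + 1 - (H + 1) * p <= s + 1]. If this is positive, the denominator is at least
    [(H + 1) * p * (1 - p)]; otherwise the ratio is at least 1. *)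
Lemma binomial_pmf_next H p j (s : R) : 0 < p < 1 -> 0 <= s -> j%:R <= H.+1%:R * p + s ->
  (1 - (s + 1) / (H.+1%:R * p * (1 - p))) * binomial_pmf H p j <= binomial_pmf H p j.+1.
Proof.
move=> p01 s0 js; have /andP[p0 p1] := p01; have q0 : 0 < 1 - p by rewrite subr_gt0.
have p01' : 0 <= p <= 1 by rewrite !ltW.
have b0 k : 0 <= binomial_pmf H p k by apply: binomial_pmf_ge0.
have [jH|Hj] := leqP j H; last first.
  by rewrite binomial_pmf_small // mulr0.
have E := binomial_pmf_step p jH; rewrite natrB // in E.
set v := H.+1%:R * p * (1 - p); have v0 : 0 < v by rewrite !mulr_gt0 // ltr0n.
have c0 : 0 < j.+1%:R * (1 - p) by rewrite mulr_gt0 // ltr0n.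
have Hp : H.+1%:R = H%:R + 1 :> R by rewrite natr1.
have jp : j.+1%:R = j%:R + 1 :> R by rewrite natr1.
rewrite -(ler_pM2r c0) E mulrAC mulrC ler_wpM2l //.
have [h|h] := lerP (j.+1%:R) (H.+1%:R * p).
  apply: (@le_trans _ _ (j.+1%:R * (1 - p))).
    rewrite ler_piMl ?(ltW c0) // gerBl divr_ge0 ?addr_ge0 // ltW //.
  by rewrite jp; rewrite jp Hp in h; nra.
have vc : v <= j.+1%:R * (1 - p) by rewrite /v ler_wpM2r // ltW.
have : s + 1 <= (s + 1) / v * (j.+1%:R * (1 - p)).
  by rewrite mulrAC ler_pdivlMr // ler_wpM2l // addr_ge0.
rewrite mulrBl mul1r; move: (_ / v * _) => z hz.
by rewrite jp Hp in js *; nra.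
Qed.

Lemma binomial_pmf_run H p k N : 0 < p < 1 -> k%:R <= H.+1%:R * p ->
  N%:R ^+ 2 <= H.+1%:R * p * (1 - p) ->
  (1 - N%:R ^+ 2 / (H.+1%:R * p * (1 - p))) * binomial_pmf H p k <= binomial_pmf H p (k + N).
Proof.
move=> p01 kp; set v := H.+1%:R * p * (1 - p).
have /andP[p0 p1] := p01; have q0 : 0 < 1 - p by rewrite subr_gt0.
have v0 : 0 < v by rewrite !mulr_gt0 // ltr0n.
have b0 : 0 <= binomial_pmf H p k by apply: binomial_pmf_ge0; rewrite !ltW.
elim: N => [|N IH] Nv; first by rewrite expr0n mul0r subr0 mul1r addn0.
have N1 : N.+1%:R = N%:R + 1 :> R by rewrite natr1.
have N0 : 0 <= N%:R :> R by [].
have {}IH := IH (_ : N%:R ^+ 2 <= v); rewrite addnS.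
have h1 : N%:R ^+ 2 <= v by apply: le_trans Nv; rewrite N1; nra.
have h2 := @binomial_pmf_next H p (k + N) N%:R p01 N0.
rewrite natrD lerD2r in h2; apply: le_trans (h2 kp).
have c0 : 0 <= 1 - (N%:R + 1) / v.
  by rewrite subr_ge0 ler_pdivrMr // mul1r; apply: le_trans Nv; rewrite N1; nra.
apply: le_trans (ler_wpM2l c0 (IH h1)); rewrite mulrA ler_wpM2r //.
have -> : (1 - (N%:R + 1) / v) * (1 - N%:R ^+ 2 / v) =
   1 - (N%:R + 1 + N%:R ^+ 2) / v + (N%:R + 1) * N%:R ^+ 2 / v ^+ 2.
  by field; exact: lt0r_neq0.
have : 0 <= (N%:R + 1) * N%:R ^+ 2 / v ^+ 2 by rewrite divr_ge0 ?exprn_ge0 ?(ltW v0) //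
    mulr_ge0 ?exprn_ge0 // addr_ge0.
have : (N%:R + 1 + N%:R ^+ 2) / v <= N.+1%:R ^+ 2 / v.
  by rewrite ler_wpM2r ?invr_ge0 ?(ltW v0) // N1; nra.
lra.
Qed.

(** The masses at [k, ..., k + N - 1] are all at least half the mass at [k], and they add up to at
    most 1. This gives the order of the local limit theorem without Stirling's formula. *)
Lemma binomial_pmf_max_left H p k N : 0 < p < 1 -> k%:R <= H.+1%:R * p ->
  2 * N%:R ^+ 2 <= H.+1%:R * p * (1 - p) -> N%:R * binomial_pmf H p k <= 2.
Proof.
move=> p01 kp Nv; set v := H.+1%:R * p * (1 - p) in Nv.
have /andP[p0 p1] := p01; have q0 : 0 < 1 - p by rewrite subr_gt0.
have v0 : 0 < v by rewrite !mulr_gt0 // ltr0n.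
have b0 i : 0 <= binomial_pmf H p i by apply: binomial_pmf_ge0; rewrite !ltW.
suff : N%:R * (2^-1 * binomial_pmf H p k) <= 1 by lra.
apply: (@le_trans _ _ (\sum_(0 <= i < N) binomial_pmf H p (k + i))); last first.
  apply: le_trans (sum_binomial_pmf_le1 H (k + N) (_ : 0 <= p <= 1)); last by rewrite !ltW.
  rewrite (@big_cat_nat _ _ _ k 0 (k + N)) ?leq_addr //=.
  have -> : \sum_(k <= i < k + N) binomial_pmf H p i = \sum_(0 <= i < N) binomial_pmf H p (k + i).
    by rewrite -{1}[k]add0n big_addn addKn; apply: eq_bigr => i _; rewrite addnC.
  by rewrite lerDr sumr_ge0.
have -> : N%:R * (2^-1 * binomial_pmf H p k) = \sum_(0 <= i < N) 2^-1 * binomial_pmf H p k.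
  by rewrite sumr_const_nat subn0 mulr_natl.
rewrite big_nat [leRHS]big_nat; apply: ler_sum => i /andP[_ iN].
have iN2 : i%:R ^+ 2 <= N%:R ^+ 2 :> R by rewrite lerXn2r ?nnegrE // ler_nat ltnW.
have NN : 0 <= N%:R ^+ 2 :> R by rewrite exprn_ge0.
have iv : i%:R ^+ 2 <= v by lra.
apply: (le_trans _ (binomial_pmf_run p01 kp iv)).
rewrite ler_wpM2r // -/v.
have : i%:R ^+ 2 / v <= 2^-1 by rewrite ler_pdivrMr //; lra.
lra.
Qed.

Lemma binomial_pmf_max H p k N : 0 < p < 1 ->
  2 * N%:R ^+ 2 <= H.+1%:R * p * (1 - p) -> N%:R * binomial_pmf H p k <= 2.
Proof.
move=> p01 Nv; have [kH|Hk] := leqP k H; last by rewrite binomial_pmf_small // mulr0.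
have [kp|pk] := lerP k%:R (H.+1%:R * p); first exact: binomial_pmf_max_left.
rewrite binomial_pmf_sym //; apply: binomial_pmf_max_left.
- by case/andP: p01 => p0 p1; rewrite subr_gt0 p1 gtrBl.
- by rewrite natrB //; rewrite -natr1 in pk *; lra.
- by rewrite opprB addrCA subrr addr0 mulrAC.
Qed.

End BinomialPmf.

Lemma tail_le_mean (R : realFieldType) (r : seq nat) (w : nat -> R) (g : nat -> nat) (W : nat) :
  (0 < W)%N -> (forall k, 0 <= w k) ->
  \sum_(k <- r | (W < g k)%N) w k <= (\sum_(k <- r) (g k)%:R * w k) / W%:R.
Proof.
move=> W0 w0; rewrite ler_pdivlMr ?ltr0n // mulr_suml [leLHS]big_mkcond /=.
apply: ler_sum => k _; case: ifP => [Wk|_]; last by rewrite mulr_ge0.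
by rewrite mulrC ler_wpM2r // ler_nat ltnW.
Qed.

(** * Two bounds for binomial coefficient vectors *)

Section BinomialCoefficients.
Context (R : realType) (disp : measure_display) (T : measurableType disp)
  (Pr : probability T R) (n : nat) (a : 'I_n.+1 -> {RV Pr >-> int}) (H : nat) (p : R) (N : nat).
Hypothesis n0 : (0 < n)%N.
Hypothesis p01 : 0 < p < 1.
Hypothesis law : forall j, binomial_law (a j) H p.
Hypothesis indep : mutually_independent Pr (fun j : 'I_n.+1 => (a j : T -> int)).
Hypothesis N0 : (0 < N)%N.
Hypothesis NH : 2 * N%:R ^+ 2 <= H.+1%:R * p * (1 - p).

Let b := binomial_pmf H p.

Let pm j u : R := fine (Pr (a j @^-1` [set u])).

Let p01' : 0 <= p <= 1. Proof. by case/andP: p01 => ? ?; rewrite !ltW. Qed.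

Let b_ge0 k : 0 <= b k. Proof. exact: binomial_pmf_ge0. Qed.

Let pmE j u : pm j u = if u is Posz k then b k else 0.
Proof.
rewrite /pm (_ : Pr _ = binomial_prob H p (Posz @^-1` [set u])); last exact: law.
rewrite /binomial_prob p01'; case: u => k.
  rewrite (_ : Posz @^-1` [set Posz k] = [set k]); last first.
    by apply/seteqP; split => l /=; [case|move=> ->].
  by rewrite esum_set1 // lee_fin b_ge0.
rewrite (_ : Posz @^-1` [set Negz k] = set0); first by rewrite esum_set0.
by apply/seteqP; split.
Qed.

Let F : {fset int} := [fset k%:Z | k in iota 0 H.+1]%fset.

Let sum_F (G : int -> R) : \sum_(v : F) G (val v) = \sum_(0 <= k < H.+1) G k%:Z.
Proof.
rewrite -(big_seq_fsetE _ _ xpredT G) /= /index_iota subn0 -(big_map Posz xpredT G).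
apply: perm_big; apply: uniq_perm; first exact: fset_uniq.
  by rewrite map_inj_uniq ?iota_uniq // => x y [].
by move=> u; apply/imfsetP/mapP => -[k /= kH ->]; exists k.
Qed.

Let pm1 j : \sum_(v : F) pm j (val v) = 1.
Proof.
rewrite sum_F -(sum_binomial_pmf H p); apply: eq_bigr => k _.
by rewrite pmE.
Qed.

Let m : R := 2 / N%:R.

Let m0 : 0 <= m. Proof. by rewrite divr_ge0. Qed.

Let pmm j u : pm j u <= m.
Proof.
rewrite pmE; case: u => k //; rewrite /m ler_pdivlMr ?ltr0n // mulrC.
exact: binomial_pmf_max.
Qed.

Let E := [set w : T | irreducible_overZ (monic_poly_of (fun j => a j w))].

Lemma prob_irreducible_binomial (W : nat) (c : R) : 0 <= c ->
  (forall u : int, u != 0 -> (`|u| <= W)%N -> (divisor_bound n u)%:R * m <= c) ->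
  ((1 - (m + \sum_(0 <= k < H.+1 | (W < k)%N) b k + c))%:E <= Pr E)%E.
Proof.
move=> c0 cP; pose Z (u : int) := (u == 0) || (W < `|u|)%N.
apply: le_trans (@prob_irreducible_ge R disp T Pr n a n0 indep Z F m _ m0 pm1 (pmm ord_max)) => //.
rewrite lee_fin lerD2l lerN2.
rewrite (sum_F (fun u => pm ord0 u * (if Z u then 1 else (divisor_bound n u)%:R * m))).
apply: (@le_trans _ _ (\sum_(0 <= k < H.+1)
   ((if k == 0%N then b k else 0) + (if (W < k)%N then b k else 0) + c * b k))).
  apply: ler_sum => k _; rewrite pmE /Z /= eqz_nat.
  have cb : 0 <= c * b k by rewrite mulr_ge0.
  case: eqP => [_|/eqP k0] /=.
    by rewrite mulr1 -addrA lerDl addr_ge0 //; case: ifP.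
  case: ltnP => Wk; first by rewrite mulr1 add0r lerDl.
  by rewrite !add0r mulrC ler_wpM2r // cP.
rewrite !big_split /= -mulr_sumr sum_binomial_pmf mulr1 lerD2r lerD //.
  rewrite big_nat_recl //= big1 ?addr0 // ; first by have := pmm ord0 0; rewrite pmE.
by rewrite [leRHS]big_mkcond.
Qed.

(** Either some [H - a_j] exceeds [W], which the tail sum covers for each [j], or a root of unity
    satisfies the linear relation between the differences [H - a_j]. *)
Lemma prob_irreducible_binomial_shift (W : nat) : (2 * (W.+1 * 8 ^ n.+1) < H)%N ->
  ((1 - n.+1%:R * (\sum_(0 <= k < H.+1 | (W < H - k)%N) b k + m))%:E <= Pr E)%E.
Proof.
move=> WH; pose bad (x : {ffun 'I_n.+1 -> F}) : bool :=
  `[< ~ irreducible_overZ (monic_poly_of (fun j => val (x j))) >].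
have mX j : measurable_fun setT (a j : T -> int) by [].
apply: le_trans (@probability_ge_good _ _ T int R Pr _ _ indep mX measurable_int_set1
   F bad _ set0 pm1 _ _ _); first last.
- move=> x w; rewrite /bad asbool_neg negbK => /asboolP irr aw _ /=.
  by rewrite /E /= (_ : (fun j => a j w) = fun j => val (x j)) //; apply/funext.
- exact: negligible_set0.
- exact: (@measurable_countable_event _ T _ (fun j => a j : T -> int)
    (fun x => irreducible_overZ (monic_poly_of x))).
rewrite lee_fin lerD2l lerN2.
have pm_ge0 (j : 'I_n.+1) (v : F) : 0 <= pm j (val v) by apply: fine_ge0.
set w := prodmass _; have w0 x : 0 <= w x by apply: prodmass_ge0.
have FH (v : F) : exists2 k, (k <= H)%N & val v = k%:Z.
  have /imfsetP[k kH vk] := valP v; exists k => //.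
  by move: kH; rewrite mem_iota.
pose B (j : 'I_n.+1) (x : {ffun 'I_n.+1 -> F}) : bool := (W < `|H%:Z - val (x j)|)%N.
pose G (x : {ffun 'I_n.+1 -> F}) : bool := `[< exists zeta : algC, zeta ^+ n.+1 = 1 /\
  \sum_(j < n.+1) (H%:Z - val (x j))%:~R * zeta ^+ j = 1 >].
apply: (@le_trans _ _ (\sum_x w x * ((G x)%:R + \sum_j (B j x)%:R))).
  rewrite big_mkcond /=; apply: ler_sum => x _.
  have S0 : 0 <= \sum_j (B j x)%:R :> R by apply: sumr_ge0.
  case: ifP => [/asboolP red|_]; last by rewrite mulr_ge0 // addr_ge0.
  rewrite -[leLHS]mulr1 ler_wpM2l //.
  have [/existsP[j Bj]|/existsPn nB] := boolP [exists j, B j x].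
    by rewrite (bigD1 j) //= Bj addrCA lerDl addr_ge0 // sumr_ge0.
  suff -> : G x by rewrite lerDl.
  pose b' (i : nat) := `|H%:Z - val (x (inord i))|%N.
  have xb (j : 'I_n.+1) : (val (x j)) = H%:Z - (b' j)%:Z /\ (b' j <= H)%N.
    by rewrite /b' inord_val; have [k kH ->] := FH (x j); split; lia.
  have [|||zeta [z1 _ zE]] := @reducible_large_shift algC n H W b' _ n0 _ _ WH
      (monic_monic_poly_of (fun j => val (x j))) (size_monic_poly_of _) _ red.
  - move=> j jn; have := nB (Ordinal jn); rewrite /B -leqNgt /b'.
    by rewrite (_ : inord j = Ordinal jn) //; apply: val_inj; rewrite /= inordK.
  - by move=> j jn; have [_] := xb (Ordinal jn).
  - by move=> j jn; rewrite (coef_monic_poly_of _ (Ordinal jn)); have [->] := xb (Ordinal jn).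
  apply/asboolP; exists zeta; split=> //; rewrite -[RHS]zE; apply: eq_bigr => j _.
  by have [-> _] := xb j; rewrite opprB addrCA subrr addr0.
have -> : \sum_x w x * ((G x)%:R + \sum_j (B j x)%:R) =
    \sum_x w x * (G x)%:R + \sum_j \sum_x w x * (B j x)%:R.
  under eq_bigr do rewrite mulrDr mulr_sumr.
  by rewrite big_split /= exchange_big.
rewrite mulrDr addrC lerD //.
  rewrite mulr_natl -[X in _ *+ X](card_ord n.+1) -sumr_const; apply: ler_sum => j _.
  pose phi (v : F) : R := (W < `|H%:Z - val v|)%N%:R.
  rewrite (sum_prodmass_coord pm1 j phi) (sum_F (fun u => pm j u * (W < `|H%:Z - u|)%N%:R)).
  rewrite [leRHS]big_mkcond /= big_nat [leRHS]big_nat; apply: ler_sum => k /andP[_ kH].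
  rewrite pmE (_ : `|H%:Z - k%:Z|%N = (H - k)%N); last by lia.
  by case: ifP => _; rewrite ?mulr1 ?mulr0.
have xn1 : ('X^(n.+1) - 1 : {poly algC}) != 0 by rewrite -size_poly_eq0 size_XnsubC.
have [s [ss sP]] := roots_seq xn1.
rewrite -[leRHS](sum_prodmass_const pm1).
rewrite (eq_bigr (fun x => w x * (G x)%:R)) //.
rewrite (_ : \sum_x w x * (G x)%:R = \sum_(x | G x) w x); last first.
  by rewrite [RHS]big_mkcond /=; apply: eq_bigr => x _; case: (G x); rewrite ?mulr1 ?mulr0.
(* Coordinate 0 is resampled because [zeta ^ 0 = 1]: for each of the at most [n + 1] roots of unity,
   the other coefficients determine [a_0]. *)
apply: (@sum_prodmass_fibre _ _ _ _ pm_ge0 pm1 ord0 G (fun=> n.+1%:R * m)) => x.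
pose rest (zeta : algC) := \sum_(j < n.+1 | j != ord0) (H%:Z - val (x j))%:~R * zeta ^+ j.
have /choice[u uP] : forall zeta : algC, exists u : int, forall v : int,
    (H%:Z - v)%:~R + rest zeta = 1 -> v = u.
  move=> zeta; have [[u hu]|none] := pselect (exists u : int, (H%:Z - u)%:~R + rest zeta = 1).
    exists u => v hv; have /addIr e := etrans hv (esym hu); have := intr_inj e; lia.
  by exists 0 => v hv; case: none; exists v.
apply: (@le_trans _ _ ((size [seq u z | z <- s])%:R * m)); last first.
  rewrite ler_wpM2r // ler_nat size_map -ltnS (leq_trans ss) //.
  by rewrite size_XnsubC.
apply: (sum_seq_le m0 _ (pmm ord0)) => v /asboolP[zeta [z1 zE]].
apply/mapP; exists zeta; first by apply: sP;
    rewrite -[root _ _]/(n.+1.-unity_root zeta) unity_rootE z1.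
apply: uP; rewrite -[RHS]zE [RHS](bigD1 ord0) //= ffunE eqxx expr0 mulr1; congr (_ + _).
by apply: eq_bigr => j /negPf j0; rewrite ffunE j0.
Qed.

End BinomialCoefficients.

Lemma nat_above (R : realType) (x : R) : exists N : nat, x <= N%:R.
Proof.
have [x0|x0] := lerP 0 x; last by exists 0%N; apply: ltW.
by exists (Num.truncn x).+1; have /andP[_ /ltW] := truncn_itv x0.
Qed.

Lemma sqrt_bracket (R : realType) (N1 : nat) (x : R) : 4 * N1%:R ^+ 2 <= x ->
  exists N : nat, [/\ (N1 <= N)%N, 4 * N%:R ^+ 2 <= x & x < 4 * N.+1%:R ^+ 2].
Proof.
move=> Nx; have x0 : 0 <= x by apply: le_trans Nx; rewrite mulr_ge0 // exprn_ge0.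
pose y := Num.sqrt (x / 4); have y0 : 0 <= y by apply: sqrtr_ge0.
have y2 : y ^+ 2 = x / 4 by rewrite sqr_sqrtr // divr_ge0.
have /andP[Ny yN] := truncn_itv y0; exists (Num.truncn y); split.
- rewrite truncn_ge_nat // -(@ler_pXn2r _ 2) ?nnegrE // y2; lra.
- have : (Num.truncn y)%:R ^+ 2 <= y ^+ 2 by rewrite lerXn2r ?nnegrE.
  by rewrite y2; lra.
have : y ^+ 2 < (Num.truncn y).+1%:R ^+ 2 by rewrite ltrXn2r ?nnegrE.
by rewrite y2; lra.
Qed.

(** [|u|] is of order at most [N ^ 3], so its divisor function is [O(sqrt N)] against the mass
    [2 / N]. Twelfth powers avoid fractional exponents: [N ^ 6] is compared with [N ^ 12]. *)
Lemma divisor_bound_small (R : realType) (n : nat) (eps : R) : 0 < eps ->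
  exists N1 : nat, forall N : nat, (0 < N)%N -> (N1 <= N)%N -> forall u : int, u != 0 ->
    (`|u| <= 2 * ((N.+1 ^ 3).+1 * 8 ^ n.+1))%N ->
    (divisor_bound n u)%:R * (2 / N%:R) <= eps.
Proof.
move=> eps0; have [A [A0 AP]] := tau_pow_le R 12.
pose c1 : R := (4 * (n.+1 * 2 ^ n.+1))%N%:R; pose c2 : R := (32 * 8 ^ n.+1)%N%:R.
have [N1 N1P] := nat_above (c1 ^+ 12 * A * c2 ^+ 2 / eps ^+ 12).
exists N1 => N N0 N1N u u0 uW; have Np : 0 < N%:R :> R by rewrite ltr0n.
have -> : (divisor_bound n u)%:R * (2 / N%:R) = c1 * (tau `|u|)%:R / N%:R.
  by rewrite natr_divisor_bound /c1 !natrM natrX; field; exact: lt0r_neq0.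
have e12 : 0 < eps ^+ 12 by rewrite exprn_gt0.
have c10 : 0 <= c1 by []. have c20 : 0 <= c2 by [].
rewrite -(@ler_pXn2r _ 12) ?nnegrE ?(ltW eps0) // ?divr_ge0 ?mulr_ge0 //.
rewrite expr_div_n exprMn ler_pdivrMr ?exprn_gt0 //.
have uc2 : (`|u|%N)%:R <= c2 * N%:R ^+ 3.
  rewrite /c2 -natrX -natrM ler_nat (leq_trans uW) //.
  have h : ((N.+1 ^ 3).+1 <= 16 * N ^ 3)%N.
    have : (N.+1 ^ 3 <= (2 * N) ^ 3)%N by rewrite leq_exp2r //; lia.
    have : (0 < N ^ 3)%N by rewrite expn_gt0 N0.
    by rewrite expnMn; move: (N.+1 ^ 3)%N (N ^ 3)%N => x y; lia.
  apply: (@leq_trans (2 * (16 * N ^ 3 * 8 ^ n.+1))).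
    by rewrite leq_mul2l leq_mul2r h orbT.
  by move: (N ^ 3)%N (8 ^ n.+1)%N => x y; nia.
apply: (@le_trans _ _ (c1 ^+ 12 * (A * (c2 * N%:R ^+ 3) ^+ 2))).
  rewrite ler_wpM2l ?exprn_ge0 // (le_trans (AP _ _)) ?absz_gt0 //.
  rewrite ler_wpM2l ?(ltW A0) // lerXn2r ?nnegrE // mulr_ge0 // exprn_ge0 //.
have -> : c1 ^+ 12 * (A * (c2 * N%:R ^+ 3) ^+ 2) = c1 ^+ 12 * A * c2 ^+ 2 * N%:R ^+ 6.
  by ring.
have K0 : 0 <= c1 ^+ 12 * A * c2 ^+ 2 by rewrite !mulr_ge0 ?exprn_ge0 // ltW.
have KN : c1 ^+ 12 * A * c2 ^+ 2 <= eps ^+ 12 * N%:R.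
  by rewrite [leRHS]mulrC -ler_pdivrMr // (le_trans N1P) // ler_nat.
have -> : eps ^+ 12 * N%:R ^+ 12 = eps ^+ 12 * N%:R * N%:R ^+ 5 * N%:R ^+ 6 by ring.
rewrite ler_wpM2r ?exprn_ge0 //; apply: (le_trans KN).
by rewrite ler_peMr ?exprn_ege1 ?ler1n // mulr_ge0 // ltW.
Qed.

Lemma binomial_irreducible (R : realType) :
      forall (d : nat) (d_gt0 : (0 < d)%N) (eps : R) (eps_gt0 : 0 < eps),
      exists M : R,
      forall (H : nat) (H_gt0 : (0 < H)%N) (p : R) (p01 : 0 < p < 1)
        (disp : measure_display) (T : measurableType disp)
        (Pr : probability T R) (a : 'I_d -> {RV Pr >-> int}),
      M <= Num.min (H%:R * p) (H%:R * (1 - p)) ->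
      (forall j : 'I_d, binomial_law (a j) H p) ->
      mutually_independent Pr (fun j : 'I_d => (a j : T -> int)) ->
      ((1 - eps)%:E
        <= Pr [set w : T |
                irreducible_overZ (monic_poly_of (fun j => a j w))])%E.
Proof.
case=> // -[|n'] _ eps eps0.
  exists 0 => H _ p _ disp T Pr a _ _ _.
  rewrite [X in Pr X](_ : _ = setT); last first.
    by apply/seteqP; split => // w _; apply: irreducible_deg1.
  by rewrite probability_setT lee_fin lerBlDr lerDl ltW.
have n0 : (0 < n'.+1)%N by []; move: n'.+1 n0 => n n0.
have e4 : 0 < eps / 4 by rewrite divr_gt0.
have [N1 N1P] := divisor_bound_small n e4.
have [N2 N2P] := nat_above (8 * n.+1%:R / eps).
pose N3 := (N1 + N2).+1; exists (4 * N3%:R ^+ 2) => H H0 p p01 disp T Pr a.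
set M0 := Num.min _ _ => N3M law indep.
have [N [N3N NM MN]] := sqrt_bracket N3M.
have N0 : (0 < N)%N by apply: leq_trans N3N.
have Np : 0 < N%:R :> R by rewrite ltr0n.
have N1N : (N1 <= N)%N by apply: leq_trans N3N; rewrite /N3 leqW // leq_addr.
have N2N : 8 * n.+1%:R <= eps * N%:R.
  rewrite [leRHS]mulrC -ler_pdivrMr //; apply: (le_trans N2P).
  by rewrite ler_nat (leq_trans _ N3N) // /N3 leqW // leq_addl.
have /andP[p0 p1] := p01.
have [Mp Mq] : M0 <= H%:R * p /\ M0 <= H%:R * (1 - p) by rewrite /M0; split;
    rewrite ge_min lexx ?orbT.
have H1 : H.+1%:R = H%:R + 1 :> R by rewrite natr1.
(* One of [p] and [1 - p] is at least 1/2, so the variance is at least half of [M0]. *)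
have NH : 2 * N%:R ^+ 2 <= H.+1%:R * p * (1 - p).
  have NN : 0 <= N%:R ^+ 2 :> R by rewrite exprn_ge0.
  have [ph|ph] := lerP p (1 / 2).
    have : 4 * N%:R ^+ 2 * (1 / 2) <= H%:R * p * (1 - p) by apply: ler_pM; lra.
    by rewrite H1; nra.
  have : 4 * N%:R ^+ 2 * (1 / 2) <= H%:R * (1 - p) * p by apply: ler_pM; lra.
  by rewrite H1; nra.
pose W := (N.+1 ^ 3)%N; have W0 : (0 < W)%N by rewrite expn_gt0.
have b0 k : 0 <= binomial_pmf H p k by apply: binomial_pmf_ge0; rewrite !ltW.
have tail (x : R) (V : nat) : x <= M0 -> (W <= V)%N -> x / V%:R <= 4 / N%:R.
  move=> xM WV; have V0 : 0 < V%:R :> R by rewrite ltr0n (leq_trans W0).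
  rewrite ler_pdivrMr // mulrAC ler_pdivlMr // (le_trans (ler_wpM2r _ xM)) //.
  apply: (@le_trans _ _ (4 * N.+1%:R ^+ 2 * N.+1%:R)).
    by apply: ler_pM => //; [apply: le_trans NM;
        rewrite mulr_ge0 ?exprn_ge0|exact: ltW|rewrite ler_nat].
  by rewrite -mulrA -exprSr ler_wpM2l // -natrX ler_nat.
have mean2 : \sum_(0 <= k < H.+1) (H - k)%:R * binomial_pmf H p k = H%:R * (1 - p).
  rewrite mulrBr -(mean_binomial_pmf H p) -[X in H%:R * X](sum_binomial_pmf H p) mulr_sumr.
  rewrite -sumrB big_nat [RHS]big_nat; apply: eq_bigr => k /andP[_ kH].
  by rewrite natrB // mulrBl.
(* The size of [H] beyond which the shifted argument applies. It also serves as the cut in the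
   direct argument, so for [H <= V] there is no tail at all. *)
pose V := (2 * (W.+1 * 8 ^ n.+1))%N.
have WV : (W <= V)%N.
  apply: (@leq_trans (2 * W.+1)); first by rewrite (leq_trans (leqnSn W)) // leq_pmull.
  by rewrite /V mulnA leq_pmulr // expn_gt0.
have n1 : 1 <= n.+1%:R :> R by rewrite ler1n.
have [small|/norP[]] := boolP ((p <= 1 / 2) || (H <= V)%N).
  apply: le_trans (@prob_irreducible_binomial R disp T Pr n a H p N n0 p01 law indep N0 NH V
    (eps / 4) (ltW e4) _) => [|u u0 uV]; last exact: N1P.
  rewrite lee_fin lerD2l lerN2.
  have t : \sum_(0 <= k < H.+1 | (V < k)%N) binomial_pmf H p k <= 4 / N%:R.
    case/orP: small => [ph|HV].
      apply: (le_trans (@tail_le_mean R _ _ id V (leq_trans W0 WV) b0)).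
      rewrite mean_binomial_pmf; apply: tail => //.
      by rewrite /M0 le_min lexx /= ler_wpM2l //; lra.
    rewrite big_nat_cond big_pred0 ?divr_ge0 // => k.
    by apply/negP => /andP[/andP[_ kH] /(leq_ltn_trans HV)]; rewrite ltnNge -ltnS kH.
  have : 6 / N%:R <= eps * (3 / 4) by rewrite ler_pdivrMr //; nra.
  lra.
rewrite -ltNge -ltnNge => ph VH.
apply: le_trans (@prob_irreducible_binomial_shift R disp T Pr n a H p N n0 p01 law indep N0 NH
    W VH).
rewrite lee_fin lerD2l lerN2.
have t : \sum_(0 <= k < H.+1 | (W < H - k)%N) binomial_pmf H p k <= 4 / N%:R.
  apply: (le_trans (@tail_le_mean R _ _ (fun k => H - k)%N W W0 b0)).
  rewrite mean2; apply: tail => //.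
  by rewrite /M0 le_min lexx andbT ler_wpM2l //; lra.
apply: (@le_trans _ _ (n.+1%:R * (6 / N%:R))); first by rewrite ler_wpM2l //; lra.
by rewrite mulrA ler_pdivrMr //; lra.
Qed.

Theorem theorem1p1 (R : realType) :
  [/\ (* (1) sparse coefficient distribution *)
      forall P : {poly int}, P != 0 ->
      exists C : R,
      forall (d : nat) (d_gt0 : (0 < d)%N) (H : nat) (H_ge3 : (3 <= H)%N)
        (disp : measure_display) (T : measurableType disp)
        (Pr : probability T R) (a : 'I_d -> {RV Pr >-> int})
        (S : 'I_d -> {fset int}),
      (forall i : 'I_d, i = 0%N :> nat -> uniform_on (a i) (poly_values P H)) ->
      (forall j : 'I_d, (0 < j)%N -> #|` S j| = H /\ uniform_on (a j) (S j)) ->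
      mutually_independent Pr (fun j : 'I_d => (a j : T -> int)) ->
      ((1 - (size P).-1%:R / (2 * H + 1)%:R
          - 2 * d%:R * 2 ^+ d * ((ln (H%:R : R)) `^ C) / H%:R)%:E
        <= Pr [set w : T |
                irreducible_overZ (monic_poly_of (fun j => a j w))])%E,
      (* (2) nonuniform coefficient distribution *)
      forall (d : nat) (d_gt0 : (0 < d)%N) (eps : R) (eps_gt0 : 0 < eps),
      exists M : R,
      forall (H : nat) (H_gt0 : (0 < H)%N) (p : R) (p01 : 0 < p < 1)
        (disp : measure_display) (T : measurableType disp)
        (Pr : probability T R) (a : 'I_d -> {RV Pr >-> int}),
      M <= Num.min (H%:R * p) (H%:R * (1 - p)) ->
      (forall j : 'I_d, binomial_law (a j) H p) ->
      mutually_independent Pr (fun j : 'I_d => (a j : T -> int)) ->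
      ((1 - eps)%:E
        <= Pr [set w : T |
                irreducible_overZ (monic_poly_of (fun j => a j w))])%E
    & (* (3) dependent coefficient distribution *)
      forall P : {poly int}, P != 0 ->
      exists C : R,
      forall (d : nat) (d_gt0 : (0 < d)%N) (H : nat) (H_ge3 : (3 <= H)%N)
        (L : nat) (L_gt0 : (0 < L)%N)
        (disp : measure_display) (T : measurableType disp)
        (Pr : probability T R) (a : 'I_d -> {RV Pr >-> int})
        (t : 'I_d -> {RV Pr >-> R}) (S : 'I_d -> {fset R})
        (Q : forall i : 'I_d, mpoly.mpoly i.+1 R),
      (forall i : 'I_d, i = 0%N :> nat -> uniform_on (a i) (poly_values P H)) ->
      (forall i : 'I_d, (0 < i)%N -> #|` S i| = H /\ uniform_on (t i) (S i)) ->
      (* independence of a_0, t_1, ..., t_(d-1) *)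
      mutually_independent Pr
        (fun (i : 'I_d) (w : T) =>
           if i == 0%N :> nat then (a i w)%:~R : R else t i w) ->
      (forall i : 'I_d, (0 < i)%N -> (total_degree (Q i) <= L)%N) ->
      (forall i : 'I_d, (0 < i)%N -> forall c : int, c != 0 ->
         (0 < degree_in ord_max (subst_const ord0 c%:~R (Q i)))%N) ->
      (forall i : 'I_d, (0 < i)%N ->
         {ae Pr, forall w : T,
            (a i w)%:~R = eval_step (Q i) (fun j => a j w) (t i w)}) ->
      ((1 - (size P).-1%:R / (2 * H + 1)%:R
          - 2 * d%:R ^+ 2 * (2 * L%:R) ^+ d * ((ln (H%:R : R)) `^ C) / H%:R)%:E
        <= Pr [set w : T |
                irreducible_overZ (monic_poly_of (fun j => a j w))])%E
  ].
Proof.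
split; [exact: sparse_irreducible|exact: binomial_irreducible|exact: dependent_irreducible].
Qed.
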